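(* Let $G\rightrightarrows X$ be a proper locally compact groupoid, $A\to X$ a Banach algebra $G$-bundle, $E\to X$ a Banach $A$-module bundle, $\sigma$ an $A$-valued multiplier for $G$, and $T:s^*E\to t^*E$ an $A$-linear almost $\sigma$-representation. Then there exists a $\sigma$-representation $R:s^*E\to t^*E$ such that $\|R(g)-T(g)\|\le 4\,b(T,tg)\,r(T,tg)$ for all $g\in G$. Moreover, if $E\to X$ is locally trivial of class $C^0$ with a given $\mathrm{GI}(\boldsymbol E)$-structure and $T$ is uniformly continuous relative to it, then $R$ can be chosen uniformly continuous relative to the same structure.
   Context: A locally compact groupoid is a topological groupoid $G\rightrightarrows X$ (source $s$, target $t$, units $1x$, composable pairs $G\times_{s,t}G=\{(g,h):sg=th\}$) whose arrow space is locally compact Hausdorff, equipped with a continuous left Haar system $\{\mu^x\}$: Radon measures with support $t^{-1}(x)$, left invariant, with $x\mapsto\int\varphi\,d\mu^x$ continuous for $\varphi\in C_c(G)$. A cutoff function is a continuous $c:X\to\mathbb R_{\ge0}$ with $\mathrm{supp}(c\circ s)\cap t^{-1}(C)$ compact for compact $C$ and every orbit meeting $\{c>0\}$; $G$ is proper if one exists. $Gx$ is the orbit of $x$. Banach bundle (Fell): Hausdorff space $E$ with continuous open surjection $p:E\to X$, continuous fiberwise real vector operations, continuous norm making fibers Banach spaces, such that nets $e_i$ with $pe_i\to x$, $|e_i|\to0$ converge to $0_x$; morphisms are continuous fiberwise linear maps. Banach algebra bundle: continuous fiberwise multiplications and unit section, fibers unital Banach algebras with $|ab|\le|a||b|$,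 $|1|=1$; $A^\times$ invertibles. Banach $A$-module bundle: continuous action $A\times_XE\to E$ with $|ae|\le|a||e|$, $1e=e$. Banach algebra $G$-bundle: continuous left $G$-action by isometric algebra isomorphisms $A_{sg}\to A_{tg}$, $a\mapsto ga$. $A$-valued multiplier: continuous $\sigma$ on $G\times_{s,t}G$ with $\sigma(g,h)\in A_{tg}^\times$ central, $\sigma(g,h)=1$ if $g$ or $h$ is a unit, $\sigma(g,h)\sigma(gh,k)=g\sigma(h,k)\sigma(g,hk)$. A pseudorepresentation is a morphism $T:s^*E\to t^*E$ over $\mathrm{id}_G$ (operators $T(g):E_{sg}\to E_{tg}$); $A$-linear if $T(g)(ae)=ga\cdot T(g)e$. A $\sigma$-representation is an $A$-linear pseudorepresentation $R$ with $R(1x)=\mathrm{id}$ and $\sigma(g,h)R(gh)=R(g)R(h)$ for composable $(g,h)$. With $\ell(\sigma,g)=\max\{1,|\sigma(g,g^{-1})^{-1}|\}$: $r(T,x)=\sup_{y\in Gx}\|\mathrm{id}-T(1y)\|+\sup_{g\in t^{-1}(Gx),h\in G^{sg}}\ell(\sigma,g)\|\sigma(g,h)T(gh)-T(g)T(h)\|$, $b(T,x)=\sup_{g\in t^{-1}(Gx)}\ell(\sigma,g)\|T(g)\|$; $T$ is an almost $\sigma$-representation if $r(T,x)\le\min\{1/4,b(T,x)^{-2}/9\}$ for all $x$. Local triviality: a local trivialization of the Banach $A$-module bundle $E$ by a Banach space $\boldsymbol E$ over an open $U$ is an isomorphism $U\times\boldsymbol E\cong E|U$ of Banach bundles over $U$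 under which the action of $A|U$ becomes an operator-norm continuous map $A|U\to\mathrm{End}(\boldsymbol E)$. A $\mathrm{GL}(\boldsymbol E)$-structure is an equivalence class of atlases of such trivializations whose transition functions $U\to\mathrm{GL}(\boldsymbol E)$ are operator-norm continuous; it is a $\mathrm{GI}(\boldsymbol E)$-structure if it contains an atlas of norm-preserving trivializations ($E$ is then ''locally trivial of class $C^0$''). Pullbacks $s^*E,t^*E\to G$ inherit such structures. A pseudorepresentation $T$ is uniformly continuous if for every pair of local trivializations of $s^*E$ and $t^*E$ over a common open $W\subset G$ belonging to the pulled-back structures, the local expression $W\to\mathcal L(\boldsymbol E,\boldsymbol E)$ of $T$ is operator-norm continuous. *)

(* Defs.v *)
From HB Require Import structures.
From mathcomp Require Import all_boot all_order all_algebra.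
From mathcomp Require Import all_classical all_reals all_analysis.
From Stdlib Require Import ClassicalEpsilon.
Set Implicit Arguments. Unset Strict Implicit. Unset Printing Implicit Defensive.
Import Order.TTheory GRing.Theory Num.Theory.
Import numFieldNormedType.Exports.
Local Open Scope classical_set_scope.
Local Open Scope ring_scope.

Record top_groupoid (X G : topologicalType) := TopGroupoid {
  src : G -> X;
  tgt : G -> X;
  unt : X -> G;
  gmul : G -> G -> G;
  ginv : G -> G;
  src_unt : forall x, src (unt x) = x;
  tgt_unt : forall x, tgt (unt x) = x;
  src_gmul : forall g h, src g = tgt h -> src (gmul g h) = src h;
  tgt_gmul : forall g h, src g = tgt h -> tgt (gmul g h) = tgt g;
  gmulA : forall g h k, src g = tgt h -> src h = tgt k ->
    gmul g (gmul h k) = gmul (gmul g h) k;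
  gmul_untl : forall g, gmul (unt (tgt g)) g = g;
  gmul_untr : forall g, gmul g (unt (src g)) = g;
  src_ginv : forall g, src (ginv g) = tgt g;
  tgt_ginv : forall g, tgt (ginv g) = src g;
  gmulV : forall g, gmul g (ginv g) = unt (tgt g);
  gmulVl : forall g, gmul (ginv g) g = unt (src g);
  src_cont : continuous src;
  tgt_cont : continuous tgt;
  unt_cont : continuous unt;
  ginv_cont : continuous ginv;
  gmul_cont : {within [set p : G * G | src p.1 = tgt p.2],
                 continuous (fun p => gmul p.1 p.2)}
}.

Definition is_unit_arrow X G (Gd : top_groupoid X G) (g : G) :=
  exists x, g = unt Gd x.

Definition orbit X G (Gd : top_groupoid X G) (x : X) : set X :=
  [set y | exists g, src Gd g = x /\ tgt Gd g = y].

Definition BG (G : ptopologicalType) := g_sigma_algebraType (@open G).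

Record haar_system (R : realType) (X : topologicalType) (G : ptopologicalType)
    (Gd : top_groupoid X G) := HaarSystem {
  hmu : X -> {measure set (BG G) -> \bar R};
  hmu_compact : forall x (K : set G), compact K -> (hmu x K < +oo)%E;
  hmu_outer : forall x (B : set (BG G)), measurable B ->
    hmu x B = ereal_inf [set hmu x U | U in [set U : set G | open U /\ B `<=` U]];
  hmu_inner : forall x (U : set G), open U ->
    hmu x U = ereal_sup [set hmu x K | K in [set K : set G | compact K /\ K `<=` U]];
  hmu_support : forall x,
    ~` (\bigcup_(U in [set U : set G | open U /\ hmu x U = 0%E]) U)
      = tgt Gd @^-1` [set x];
  hmu_inv : forall (g : G) (B : set (BG G)), measurable B ->
    hmu (tgt Gd g) B = hmu (src Gd g) [set h : G | tgt Gd h = src Gd g /\ B (gmul Gd g h)];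
  hmu_cont : forall phi : G -> R, continuous phi ->
    compact (closure [set g | phi g != 0]) ->
    continuous (fun x => fine (\int[hmu x]_(g in [set: BG G]) (phi g)%:E)%E)
}.

Definition cutoff X G (Gd : top_groupoid X G) (R : realType) (c : X -> R) :=
  continuous c /\ (forall x, 0 <= c x) /\
  (forall C : set X, compact C ->
     compact (closure [set g | c (src Gd g) != 0] `&` tgt Gd @^-1` C)) /\
  (forall x, exists y, orbit Gd x y /\ 0 < c y).

Definition proper_groupoid X G (Gd : top_groupoid X G) (R : realType) :=
  exists c : X -> R, cutoff Gd c.

Record banach_bundle (R : realType) (X E : topologicalType) := BanachBundle {
  bproj : E -> X;
  bzero : X -> E;
  badd : E -> E -> E;
  bscale : R -> E -> E;
  bnorm : E -> R;
  bproj_cont : continuous bproj;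
  bproj_open : forall U : set E, open U -> open (bproj @` U);
  bproj_surj : forall x, exists e, bproj e = x;
  bproj_zero : forall x, bproj (bzero x) = x;
  bproj_add : forall e e', bproj e = bproj e' -> bproj (badd e e') = bproj e;
  bproj_scale : forall a e, bproj (bscale a e) = bproj e;
  baddA : forall e1 e2 e3, bproj e1 = bproj e2 -> bproj e2 = bproj e3 ->
    badd e1 (badd e2 e3) = badd (badd e1 e2) e3;
  baddC : forall e1 e2, bproj e1 = bproj e2 -> badd e1 e2 = badd e2 e1;
  badd0 : forall e, badd (bzero (bproj e)) e = e;
  baddN : forall e, badd e (bscale (-1) e) = bzero (bproj e);
  bscaleA : forall a b e, bscale a (bscale b e) = bscale (a * b) e;
  bscale1 : forall e, bscale 1 e = e;
  bscaleDr : forall a e1 e2, bproj e1 = bproj e2 ->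
    bscale a (badd e1 e2) = badd (bscale a e1) (bscale a e2);
  bscaleDl : forall a b e, bscale (a + b) e = badd (bscale a e) (bscale b e);
  bnorm_ge0 : forall e, 0 <= bnorm e;
  bnorm_eq0 : forall e, bnorm e = 0 -> e = bzero (bproj e);
  bnormZ : forall a e, bnorm (bscale a e) = `|a| * bnorm e;
  bnormD : forall e1 e2, bproj e1 = bproj e2 ->
    bnorm (badd e1 e2) <= bnorm e1 + bnorm e2;
  bcomplete : forall (x : X) (u : nat -> E), (forall n, bproj (u n) = x) ->
    (forall eps : R, 0 < eps -> exists N, forall m n, (N <= m)%N -> (N <= n)%N ->
       bnorm (badd (u m) (bscale (-1) (u n))) < eps) ->
    exists l, bproj l = x /\
      (fun n => bnorm (badd (u n) (bscale (-1) l))) @ \oo --> (0 : R);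
  badd_cont : {within [set p : E * E | bproj p.1 = bproj p.2],
                 continuous (fun p => badd p.1 p.2)};
  bscale_cont : continuous (fun p : R * E => bscale p.1 p.2);
  bnorm_cont : continuous bnorm;
  bzero_lim : forall (F : set_system E) (x : X), ProperFilter F ->
    bproj @ F --> x -> bnorm @ F --> (0 : R) -> F --> bzero x
}.

Definition bsub R X E (bE : banach_bundle R X E) (e e' : E) :=
  badd bE e (bscale bE (-1) e').

Definition bopnorm R X E (bE : banach_bundle R X E) (x : X) (F : E -> E) : \bar R :=
  ereal_sup [set (bnorm bE (F e))%:E | e in [set e | bproj bE e = x /\ bnorm bE e <= 1]].

Record banach_alg_bundle (R : realType) (X A : topologicalType) := BanachAlgBundle {
  bab :> banach_bundle R X A;
  amul : A -> A -> A;
  aone : X -> A;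
  bproj_mul : forall a b, bproj bab a = bproj bab b -> bproj bab (amul a b) = bproj bab a;
  bproj_one : forall x, bproj bab (aone x) = x;
  amulA : forall a b c, bproj bab a = bproj bab b -> bproj bab b = bproj bab c ->
    amul a (amul b c) = amul (amul a b) c;
  amul1l : forall a, amul (aone (bproj bab a)) a = a;
  amul1r : forall a, amul a (aone (bproj bab a)) = a;
  amulDl : forall a b c, bproj bab a = bproj bab b -> bproj bab b = bproj bab c ->
    amul (badd bab a b) c = badd bab (amul a c) (amul b c);
  amulDr : forall a b c, bproj bab a = bproj bab b -> bproj bab b = bproj bab c ->
    amul a (badd bab b c) = badd bab (amul a b) (amul a c);
  amulZl : forall (k : R) a b, bproj bab a = bproj bab b ->
    amul (bscale bab k a) b = bscale bab k (amul a b);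
  amulZr : forall (k : R) a b, bproj bab a = bproj bab b ->
    amul a (bscale bab k b) = bscale bab k (amul a b);
  amul_cont : {within [set p : A * A | bproj bab p.1 = bproj bab p.2],
                 continuous (fun p => amul p.1 p.2)};
  aone_cont : continuous aone;
  anormM : forall a b, bproj bab a = bproj bab b ->
    bnorm bab (amul a b) <= bnorm bab a * bnorm bab b;
  anorm1 : forall x, bnorm bab (aone x) = 1
}.

Definition ainvertible R X A (bA : banach_alg_bundle R X A) (a : A) :=
  exists b, bproj bA b = bproj bA a /\
    amul bA a b = aone bA (bproj bA a) /\ amul bA b a = aone bA (bproj bA a).

Definition acentral R X A (bA : banach_alg_bundle R X A) (a : A) :=
  forall b, bproj bA b = bproj bA a -> amul bA a b = amul bA b a.

Definition ainv R X A (bA : banach_alg_bundle R X A) (a : A) : A :=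
  epsilon (inhabits a) (fun b => bproj bA b = bproj bA a /\
    amul bA a b = aone bA (bproj bA a) /\ amul bA b a = aone bA (bproj bA a)).

Record banach_module_bundle (R : realType) (X A : topologicalType)
    (bA : banach_alg_bundle R X A) (E : topologicalType) := BanachModBundle {
  bmb :> banach_bundle R X E;
  act : A -> E -> E;
  bproj_act : forall a e, bproj bA a = bproj bmb e -> bproj bmb (act a e) = bproj bmb e;
  act_cont : {within [set p : A * E | bproj bA p.1 = bproj bmb p.2],
                continuous (fun p => act p.1 p.2)};
  actDl : forall a b e, bproj bA a = bproj bA b -> bproj bA b = bproj bmb e ->
    act (badd bA a b) e = badd bmb (act a e) (act b e);
  actDr : forall a e e', bproj bA a = bproj bmb e -> bproj bmb e = bproj bmb e' ->
    act a (badd bmb e e') = badd bmb (act a e) (act a e');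
  actZl : forall (k : R) a e, bproj bA a = bproj bmb e ->
    act (bscale bA k a) e = bscale bmb k (act a e);
  actZr : forall (k : R) a e, bproj bA a = bproj bmb e ->
    act a (bscale bmb k e) = bscale bmb k (act a e);
  actM : forall a b e, bproj bA a = bproj bA b -> bproj bA b = bproj bmb e ->
    act (amul bA a b) e = act a (act b e);
  act1 : forall e, act (aone bA (bproj bmb e)) e = e;
  act_norm : forall a e, bproj bA a = bproj bmb e ->
    bnorm bmb (act a e) <= bnorm bA a * bnorm bmb e
}.

Record alg_G_bundle (R : realType) (X G A : topologicalType)
    (Gd : top_groupoid X G) (bA : banach_alg_bundle R X A) := AlgGBundle {
  gact : G -> A -> A;
  bproj_gact : forall g a, bproj bA a = src Gd g -> bproj bA (gact g a) = tgt Gd g;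
  gact_cont : {within [set p : G * A | src Gd p.1 = bproj bA p.2],
                 continuous (fun p => gact p.1 p.2)};
  gact_add : forall g a b, bproj bA a = src Gd g -> bproj bA b = src Gd g ->
    gact g (badd bA a b) = badd bA (gact g a) (gact g b);
  gact_scale : forall g (k : R) a, bproj bA a = src Gd g ->
    gact g (bscale bA k a) = bscale bA k (gact g a);
  gact_mul : forall g a b, bproj bA a = src Gd g -> bproj bA b = src Gd g ->
    gact g (amul bA a b) = amul bA (gact g a) (gact g b);
  gact_one : forall g, gact g (aone bA (src Gd g)) = aone bA (tgt Gd g);
  gact_norm : forall g a, bproj bA a = src Gd g -> bnorm bA (gact g a) = bnorm bA a;
  gact_surj : forall g b, bproj bA b = tgt Gd g ->
    exists a, bproj bA a = src Gd g /\ gact g a = b;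
  gact_unt : forall x a, bproj bA a = x -> gact (unt Gd x) a = a;
  gact_comp : forall g h a, src Gd g = tgt Gd h -> bproj bA a = src Gd h ->
    gact (gmul Gd g h) a = gact g (gact h a)
}.

Section Reps.
Variables (R : realType) (X G A E : topologicalType) (Gd : top_groupoid X G)
  (bA : banach_alg_bundle R X A) (gA : alg_G_bundle Gd bA)
  (bE : banach_module_bundle bA E).

Definition multiplier (sigma : G -> G -> A) :=
  {within [set p : G * G | src Gd p.1 = tgt Gd p.2],
     continuous (fun p => sigma p.1 p.2)} /\
  (forall g h, src Gd g = tgt Gd h ->
     [/\ bproj bA (sigma g h) = tgt Gd g, ainvertible bA (sigma g h)
       & acentral bA (sigma g h)]) /\
  (forall g h, src Gd g = tgt Gd h ->
     is_unit_arrow Gd g \/ is_unit_arrow Gd h -> sigma g h = aone bA (tgt Gd g)) /\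
  (forall g h k, src Gd g = tgt Gd h -> src Gd h = tgt Gd k ->
     amul bA (sigma g h) (sigma (gmul Gd g h) k)
     = amul bA (gact gA g (sigma h k)) (sigma g (gmul Gd h k))).

(* pseudorepresentation: morphism s^*E -> t^*E over id_G *)
Definition pseudorep (T : G -> E -> E) :=
  (forall g e, bproj bE e = src Gd g -> bproj bE (T g e) = tgt Gd g) /\
  (forall g e e', bproj bE e = src Gd g -> bproj bE e' = src Gd g ->
     T g (badd bE e e') = badd bE (T g e) (T g e')) /\
  (forall g (k : R) e, bproj bE e = src Gd g ->
     T g (bscale bE k e) = bscale bE k (T g e)) /\
  {within [set p : G * E | src Gd p.1 = bproj bE p.2],
     continuous (fun p => (p.1, T p.1 p.2))}.

Definition A_linear (T : G -> E -> E) :=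
  forall g a e, bproj bA a = src Gd g -> bproj bE e = src Gd g ->
    T g (act bE a e) = act bE (gact gA g a) (T g e).

Definition sigma_rep (sigma : G -> G -> A) (Rr : G -> E -> E) :=
  pseudorep Rr /\ A_linear Rr /\
  (forall x e, bproj bE e = x -> Rr (unt Gd x) e = e) /\
  (forall g h e, src Gd g = tgt Gd h -> bproj bE e = src Gd h ->
     act bE (sigma g h) (Rr (gmul Gd g h) e) = Rr g (Rr h e)).

Definition ell (sigma : G -> G -> A) (g : G) : R :=
  Num.max 1 (bnorm bA (ainv bA (sigma g (ginv Gd g)))).

Definition rT (sigma : G -> G -> A) (T : G -> E -> E) (x : X) : \bar R :=
  (ereal_sup [set bopnorm bE y (fun e => bsub bE e (T (unt Gd y) e)) |
                y in orbit Gd x]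
   + ereal_sup [set (ell sigma p.1)%:E *
        bopnorm bE (src Gd p.2)
          (fun e => bsub bE (act bE (sigma p.1 p.2) (T (gmul Gd p.1 p.2) e))
                            (T p.1 (T p.2 e))) |
        p in [set p : G * G | orbit Gd x (tgt Gd p.1) /\ tgt Gd p.2 = src Gd p.1]])%E.

Definition bT (sigma : G -> G -> A) (T : G -> E -> E) (x : X) : \bar R :=
  ereal_sup [set ((ell sigma g)%:E * bopnorm bE (src Gd g) (T g))%E |
               g in [set g | orbit Gd x (tgt Gd g)]].

(* b^{-2}/9 with the conventions 1/0 = +oo, 1/+oo = 0 *)
Definition inv_sq_ninth (b : \bar R) : \bar R :=
  match b with
  | r%:E => if r == 0 then +oo%E else (r ^- 2 / 9)%:E
  | +oo%E => 0%E
  | -oo%E => +oo%E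
  end.

Definition almost_rep (sigma : G -> G -> A) (T : G -> E -> E) :=
  forall x, (rT sigma T x <= Order.min (1 / 4)%:E (inv_sq_ninth (bT sigma T x)))%E.

End Reps.

Definition opnormV (R : realType) (V : normedModType R) (F : V -> V) : \bar R :=
  ereal_sup [set (`|F v|)%:E | v in [set v : V | `|v| <= 1]].

Definition opcont (R : realType) (V : normedModType R) (Z : topologicalType)
    (D : set Z) (F : Z -> V -> V) :=
  forall z0, D z0 -> forall eps : R, 0 < eps ->
    \forall z \near z0, D z -> (opnormV (fun v => (F z v - F z0 v)%R) <= eps%:E)%E.

(* a (candidate) local trivialization of the pullback f^*E over tdom,
   given by tphi y : V -> E_{f y} and its inverse tpsi y : E_{f y} -> V *)
Record triv (Y : Type) (V : Type) (E : Type) := Triv {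
  tdom : set Y;
  tphi : Y -> V -> E;
  tpsi : Y -> E -> V
}.

Section Triv.
Variables (R : realType) (X A E : topologicalType)
  (bA : banach_alg_bundle R X A) (bE : banach_module_bundle bA E)
  (V : completeNormedModType R).

Definition is_triv (Y : topologicalType) (f : Y -> X) (tau : triv Y V E) :=
  open (tdom tau) /\
  (forall y v, tdom tau y -> bproj bE (tphi tau y v) = f y) /\
  (forall y (k : R) (v w : V), tdom tau y ->
     tphi tau y (k *: v + w) = badd bE (bscale bE k (tphi tau y v)) (tphi tau y w)) /\
  (forall y v, tdom tau y -> tpsi tau y (tphi tau y v) = v) /\
  (forall y e, tdom tau y -> bproj bE e = f y -> tphi tau y (tpsi tau y e) = e) /\
  {within [set p : Y * V | tdom tau p.1], continuous (fun p => tphi tau p.1 p.2)} /\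
  {within [set p : Y * E | tdom tau p.1 /\ bproj bE p.2 = f p.1],
     continuous (fun p => tpsi tau p.1 p.2)} /\
  opcont [set p : Y * A | tdom tau p.1 /\ bproj bA p.2 = f p.1]
    (fun p v => tpsi tau p.1 (act bE p.2 (tphi tau p.1 v))).

Definition norm_preserving (Y : Type) (tau : triv Y V E) :=
  forall y v, tdom tau y -> bnorm bE (tphi tau y v) = `|v|.

Definition compatible (Y : topologicalType) (tau1 tau2 : triv Y V E) :=
  opcont [set y | tdom tau1 y /\ tdom tau2 y]
    (fun y v => tpsi tau2 y (tphi tau1 y v)) /\
  opcont [set y | tdom tau1 y /\ tdom tau2 y]
    (fun y v => tpsi tau1 y (tphi tau2 y v)).

Definition atlas (Y : topologicalType) (f : Y -> X) (al : set (triv Y V E)) :=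
  [/\ forall tau, al tau -> is_triv f tau,
      forall y, exists tau, al tau /\ tdom tau y
    & forall tau1 tau2, al tau1 -> al tau2 -> compatible tau1 tau2].

Definition equiv_atlas (Y : topologicalType) (f : Y -> X) (al be : set (triv Y V E)) :=
  atlas f (al `|` be).

(* a GL(V)-structure on f^*E: an equivalence class of atlases *)
Definition gl_structure (Y : topologicalType) (f : Y -> X) (S : set (set (triv Y V E))) :=
  [/\ exists al, S al,
      forall al, S al -> atlas f al,
      forall al be, S al -> S be -> equiv_atlas f al be
    & forall al be, S al -> atlas f be -> equiv_atlas f al be -> S be].

Definition gi_structure (S : set (set (triv X V E))) :=
  gl_structure (fun x : X => x) S /\
  exists al, S al /\ forall tau, al tau -> norm_preserving tau.

Definition pullback_triv (Y : topologicalType) (f : Y -> X) (tau : triv X V E) : triv Y V E :=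
  Triv (f @^-1` tdom tau) (fun y v => tphi tau (f y) v) (fun y e => tpsi tau (f y) e).

Definition pullback_structure (Y : topologicalType) (f : Y -> X)
    (S : set (set (triv X V E))) : set (set (triv Y V E)) :=
  [set be | atlas f be /\ exists al, S al /\ equiv_atlas f be (pullback_triv f @` al)].

Definition unif_cont (G : topologicalType) (Gd : top_groupoid X G)
    (S : set (set (triv X V E))) (T : G -> E -> E) :=
  forall tau1 tau2 : triv G V E,
    (exists be, pullback_structure (src Gd) S be /\ be tau1) ->
    (exists be, pullback_structure (tgt Gd) S be /\ be tau2) ->
    tdom tau1 = tdom tau2 ->
    opcont (tdom tau1) (fun g v => tpsi tau2 g (T g (tphi tau1 g v))).

End Triv.

(* Main.v *)
(** Let L_x f be the average of f over t^-1(x) for mu^x weighted by c(s(h)), normalised by L_x 1 = 1.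
    The operators xi(g, e, h) = sigma(g,h) T(gh) T(h)^-1 e, h in t^-1(sg), would all equal T(g) e
    for an exact representation; averaging them in h gives a new pseudorepresentation T'.
    Put y = T'(h) e, X_k = xi(g, ., hk) and Y_k = xi(h, e, k). By the cocycle identity
    sigma(g,h) xi(gh, e, k) = X_k Y_k and left invariance, sigma(g,h) T'(gh) e - T'(g) T'(h) e is the
    average over k of (X_k - T(g)) (Y_k - y), which is quadratic in the defect of T. For
    d = r b / (1 - r) one has ell(g) ||X_k - T(g)|| <= d, and (b, r) becomes (b / (1 - r), 2 d^2):
    the iteration is Newton-like and converges geometrically to R.

    The fiberwise means are Cauchy limits of Riemann sums over finite partitions of unity,
    and since finitely many base points serve for all nearby fibers, the average of a continuous
    family is again continuous. In norm-preserving trivializations the same Riemann sums approximate the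
    local expression of T' in operator norm, so every iterate is uniformly continuous, and so is R,
    as the convergence T_n -> R is uniform in operator norm. *)

Require Import Defs.
From HB Require Import structures.
From mathcomp Require Import all_boot all_order all_algebra.
From mathcomp Require Import finmap.
From mathcomp Require Import all_classical all_reals all_analysis.
From mathcomp Require Import measurable_realfun ring lra.
From Stdlib Require Import ClassicalEpsilon.
Set Implicit Arguments.
Unset Strict Implicit.
Unset Printing Implicit Defensive.
Import Order.TTheory GRing.Theory Num.Theory.
Import numFieldNormedType.Exports.
Local Open Scope classical_set_scope.
Local Open Scope ring_scope.

(** * Averages over the fibers of the target map *)

Section ContinuousWithin.

(** The weight [ell] is what makes T(h) invertible with a bound free of sigma. It dominates
    |sigma(h,h^-1)^-1|, so sigma(h,h^-1)^-1 T(h) T(h^-1) is within r of the identity; since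
    ell(h^-1) = ell(h), the weight lost in solving is regained from ell(h^-1) ||T(h^-1)|| <= b,
    whence ||T(h)^-1|| <= b / (1 - r). The constants r and b belong to single orbits and may vary
    wildly across them, so they cannot serve for continuity: local bounds are derived separately
    from continuity at the zero section, and convergence uniform on G comes from 4 b r <= 1. No
    continuous section through a given vector is at hand either; nearby vectors are produced from
    openness of the projection. Put y = b^2 r. A step sends y to 2 (y / (1 - r)^2)^2 and r to 2 r y
    / (1 - r)^2, so r <= 1/4 and y <= 1/9 are preserved and r shrinks at least by the factor q =
    2/5. The step sizes are then dominated by 4 b r (q^n - q^(n+1)), which telescopes to the factor
    4 of the theorem. *)

Definition catw (Z Y : topologicalType) (D : set Z) (f : Z -> Y) (z : Z) :=
  f @ within D (nbhs z) --> f z.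

Lemma catwP (Z Y : topologicalType) (D : set Z) (f : Z -> Y) (z : Z) :
  catw D f z <-> (forall W, nbhs (f z) W -> \forall y \near z, D y -> W (f y)).
Proof. by split => [h W /h|h W /h]. Qed.

Lemma within_catw (Z Y : topologicalType) (D : set Z) (f : Z -> Y) :
  {within D, continuous f} <-> forall z, D z -> catw D f z.
Proof. by rewrite subspace_continuousP. Qed.

Lemma continuous_catw (Z Y : topologicalType) (D : set Z) (f : Z -> Y) z :
  {for z, continuous f} -> catw D f z.
Proof. by move=> cf; apply: cvg_trans cf; apply: cvg_app; exact: cvg_within. Qed.

(** The structure maps of groupoids and bundles are continuous on fiber products only. With [D']
    such a fiber product, this is how each of them is applied to continuous families. *)
Lemma catw_comp (Z Y W : topologicalType) (D : set Z) (D' : set Y)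
    (f : Z -> Y) (g : Y -> W) z :
  (forall y, D y -> D' (f y)) -> catw D f z -> catw D' g (f z) ->
  catw D (fun y => g (f y)) z.
Proof.
move=> DD' /catwP cf /catwP cg; apply/catwP => U /cg /cf.
by apply: filterS => y h Dy; apply: h => //; exact: DD'.
Qed.

Lemma catw_pair (Z Y W : topologicalType) (D : set Z) (f : Z -> Y) (g : Z -> W) z :
  catw D f z -> catw D g z -> catw D (fun y => (f y, g y)) z.
Proof. by move=> cf cg; apply: cvg_pair. Qed.

Lemma catw_eq (Z Y : topologicalType) (D : set Z) (f g : Z -> Y) z :
  D z -> (forall y, D y -> f y = g y) -> catw D f z -> catw D g z.
Proof.
move=> Dz fg /catwP cf; apply/catwP => W; rewrite -fg// => /cf.
by apply: filterS => y + Dy; rewrite fg//; exact.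
Qed.

End ContinuousWithin.

Section HaarAveraging.
Variables (R : realType) (X : topologicalType) (G : ptopologicalType)
  (Gd : top_groupoid X G) (hG : hausdorff_space G)
  (lcG : locally_compact [set: G]) (mu : haar_system R Gd)
  (c : X -> R) (cutc : cutoff Gd c).
Local Notation src := (src Gd).
Local Notation tgt := (tgt Gd).

(** The unit map is a continuous injection into [G], with left inverse [src], so separation is
    inherited from [G]. *)
Lemma unit_space_hausdorff : hausdorff_space X.
Proof.
move=> x y xy; rewrite -(src_unt Gd x) -(src_unt Gd y); congr src.
apply: hG => A B /(@unt_cont _ _ Gd) UA /(@unt_cont _ _ Gd) UB.
by have [z [/= zA zB]] := xy _ _ UA UB; exists (unt Gd z).
Qed.

(** Integrating over this part of the fiber rather than the whole of it keeps the measure finite,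
    because the cutoff condition places it inside a compact set. *)
Definition carrier (x : X) : set G := [set g | tgt g = x /\ c (src g) != 0].

Lemma compact_carrier_hull (C : set X) : compact C -> exists2 K : set G,
  compact K & forall x, C x -> carrier x `<=` K.
Proof.
move=> /(cutc.2.2.1 _) cK; eexists; first exact: cK.
by move=> x Cx g [tx cg]; split; [apply: subset_closure | rewrite /= tx].
Qed.

Lemma cutoff_src_continuous : continuous (c \o src).
Proof. by move=> g; apply: continuous_comp; [exact: src_cont|exact: cutc.1]. Qed.

Lemma borel_open (U : set G) : open U -> measurable (U : set (BG G)).
Proof. by move=> oU; apply: sub_sigma_algebra. Qed.

Lemma borel_closed (U : set G) : closed U -> measurable (U : set (BG G)).
Proof. by move=> oU; rewrite -(setCK U); apply: measurableC; apply: borel_open; rewrite openC. Qed.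

Lemma continuous_borel (f : G -> R) : continuous f ->
  measurable_fun [set: BG G] (f : BG G -> R).
Proof.
move=> /continuousP cf; apply: (measurability _ (measurable_realfun.RGenOpens.measurableE R)).
move=> _ [_ [a [b ->] <-]]; rewrite setTI; apply: borel_open.
by apply: cf; exact: interval_open.
Qed.

(** Borel rather than continuous functions, because composition with [translate] below need not
    preserve continuity across the fiber. *)
Definition borel_bounded (f : G -> R) :=
  measurable_fun [set: BG G] (f : BG G -> R) /\ exists C : R, forall g, `|f g| <= C.

Lemma fiber_closed x : closed (tgt @^-1` [set x]).
Proof.
apply: preimage_closed; first by move=> g _; exact: tgt_cont.
exact/accessible_closed_set1/hausdorff_accessible/unit_space_hausdorff.
Qed.


Lemma carrier_measurable x : measurable (carrier x : set (BG G)).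
Proof.
have -> : carrier x = tgt @^-1` [set x] `&` (c \o src) @^-1` [set~ 0].
  by apply/seteqP; split => g /= [tx cg]; split => //; apply/eqP.
apply: measurableI; first by apply: borel_closed; exact: fiber_closed.
apply: borel_open; apply: open_comp; last exact/closed_openC/closed_eq.
by move=> g _; exact: cutoff_src_continuous.
Qed.

Lemma carrier_finite x : (hmu mu x (carrier x : set (BG G)) < +oo)%E.
Proof.
have [K cK /(_ x erefl) sK] := compact_carrier_hull (@compact_set1 _ x).
apply: le_lt_trans (hmu_compact mu x cK); apply: le_measure => //.
- by rewrite inE; exact: carrier_measurable.
- by rewrite inE; apply: borel_closed; exact: compact_closed.
Qed.

Lemma cutoff_bounded x : exists2 M, 0 < M & forall g, carrier x g -> `|c (src g)| <= M.
Proof.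
have [K cK /(_ x erefl) sK] := compact_carrier_hull (@compact_set1 _ x).
have : compact ((c \o src) @` K).
  apply: continuous_compact => //; apply: continuous_subspaceT; exact: cutoff_src_continuous.
move=> /compact_bounded [M [_ HM]]; exists (Num.max (M + 1) 1).
  by rewrite lt_max ltr01 orbT.
move=> g /sK Kg; apply: HM; last by exists g.
by rewrite lt_max ltrDl ltr01.
Qed.

Lemma borel_bounded_integrable x f : borel_bounded f ->
  (hmu mu x).-integrable (carrier x) (EFin \o (fun g => f g * c (src g))).
Proof.
move=> [mf [C fC]]; apply: measurable_bounded_integrable.
- exact: carrier_measurable.
- exact: carrier_finite.
- apply: measurable_funTS; apply: measurable_funM => //.
  by apply: continuous_borel; exact: cutoff_src_continuous.
- have [M M0 HM] := cutoff_bounded x.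
  exists (`|C| * M); split; first exact: num_real.
  move=> B /ltW CMB g /HM cg; apply: le_trans CMB; rewrite /= normrM.
  by apply: ler_pM => //; apply: le_trans (fC g) _; exact: ler_norm.
Qed.

Lemma borel_bounded_cst k : borel_bounded (fun=> k).
Proof. by split; [exact: measurable_cst | exists `|k|]. Qed.

Lemma borel_boundedD f f' : borel_bounded f -> borel_bounded f' ->
  borel_bounded (fun g => f g + f' g).
Proof.
move=> [mf [C fC]] [mf' [C' fC']]; split; first exact: measurable_funD.
by exists (C + C') => g; apply: le_trans (ler_normD _ _) _; exact: lerD.
Qed.

Lemma borel_boundedM f f' : borel_bounded f -> borel_bounded f' ->
  borel_bounded (fun g => f g * f' g).
Proof.
move=> [mf [C fC]] [mf' [C' fC']]; split; first exact: measurable_funM.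
by exists (C * C') => g; rewrite normrM; exact: ler_pM.
Qed.

Definition mass x := \int[hmu mu x]_(g in carrier x) c (src g).

(** The complement of the support is a union of possibly uncountably many open null sets. Inner
    regularity reduces its measure to that of compact subsets, which finitely many of these sets
    cover. *)
Lemma outside_fiber_null x : hmu mu x (~` (tgt @^-1` [set x]) : set (BG G)) = 0%E.
Proof.
set N := ~` _; have oN : open N by rewrite openC; exact: fiber_closed.
rewrite (hmu_inner mu x oN); apply/eqP; rewrite eq_le; apply/andP; split; last first.
  apply: ereal_sup_ubound; exists set0; last by rewrite measure0.
  by split; [exact: compact0|].
apply: ge_ereal_sup => _ [K [cK KN] <-].
have := cK; rewrite compact_cover => /(_ (set (BG G))
  [set U | open (U : set G) /\ hmu mu x U = 0%E] (fun U => U)).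
case.
- by move=> U [].
- by move=> g /KN; rewrite /N -(hmu_support mu x) setCK.
- move=> D DD KD.
  have mD (U : set (BG G)) : U \in D -> measurable U.
    by move=> /DD; rewrite inE => -[oU _]; exact: borel_open.
  apply: (@le_trans _ _ (hmu mu x (\bigcup_(U in [set` D]) U))).
    apply: le_measure => //; rewrite inE.
      by apply: borel_closed; exact: compact_closed.
    by apply: fin_bigcup_measurable => // U /= UD; exact: mD.
  apply: le_trans (content_sub_fsum (A_ := id) _ (finite_fset D) _ _ _) _ => //.
  - by apply: fin_bigcup_measurable => // U /= UD; exact: mD.
  - by rewrite fsbig1// => U /= UD; have /DD := UD; rewrite inE => -[].
Qed.

Lemma measureD_null x (B N : set (BG G)) : measurable B -> measurable N ->
  hmu mu x N = 0%E -> hmu mu x (B `\` N) = hmu mu x B.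
Proof.
move=> mB mN N0; rewrite [RHS](measureDI _ mB mN) [X in (_ + X)%E](_ : _ = 0%E) ?adde0//.
apply/eqP; rewrite eq_le measure_ge0 andbT -N0.
by apply: le_measure; rewrite ?inE//; exact: measurableI.
Qed.

Lemma mass_integrable x : (hmu mu x).-integrable (carrier x) (EFin \o (c \o src)).
Proof.
have := borel_bounded_integrable x (borel_bounded_cst 1).
by under eq_fun do rewrite mul1r.
Qed.

(** The orbit of [x] meets {c > 0}, so some arrow with target [x] has a source where [c] is
    positive. It lies in the support of the measure, hence its open neighborhood on which [c] of the
    source exceeds half that value has positive measure. *)
Lemma mass_gt0 x : 0 < mass x.
Proof.
have [y [[g [sg tg]] cy]] := cutc.2.2.2 x.
set U : set G := [set h | c y / 2 < c (src h)].
have oU : open U.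
  apply: (@open_comp _ _ (c \o src) [set r | c y / 2 < r]).
    by move=> h _; exact: cutoff_src_continuous.
  exact: open_gt.
have mU := borel_open oU.
have cy2 : 0 < c y / 2 by rewrite divr_gt0.
have mF := borel_closed (@fiber_closed x).
have muU : hmu mu x (U : set (BG G)) != 0%E.
  apply/eqP => U0.
  have : (~` (\bigcup_(V in [set V : set G | open V /\ hmu mu x V = 0%E]) V)) (ginv Gd g).
    by rewrite (hmu_support mu x) /= tgt_ginv.
  by apply; exists U => //; rewrite /U /= src_ginv tg ltr_pdivrMr// ltr_pMr// ltr1n.
set D : set G := U `&` (tgt @^-1` [set x]).
have mD : measurable (D : set (BG G)) by exact: measurableI.
have DC : D `<=` carrier x.
  by move=> h [Uh th]; split => //; rewrite gt_eqF// (lt_trans cy2).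
have muD : (0 < hmu mu x (D : set (BG G)))%E.
  rewrite lt0e measure_ge0 andbT; apply/eqP => D0; move/eqP: muU; apply.
  apply/eqP; rewrite eq_le measure_ge0 andbT.
  have -> : (U : set (BG G)) = (D : set (BG G)) `|` (U `\` (tgt @^-1` [set x])) by rewrite setUIDK.
  apply: le_trans (measureU2 _ _ _) _ => //; first exact: measurableD.
  rewrite [X in (X + _)%E]D0 add0e -(outside_fiber_null x); apply: le_measure => //.
  - by rewrite inE; exact: measurableD.
  - by rewrite inE; exact: measurableC.
have finD : (hmu mu x (D : set (BG G)) < +oo)%E.
  apply: le_lt_trans (carrier_finite x); apply: le_measure => //; rewrite inE //.
  exact: carrier_measurable.
have mC := @carrier_measurable x.
apply: (@lt_le_trans _ _ (\int[hmu mu x]_(h in D) (c y / 2))).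
  rewrite Rintegral_cst// mulr_gt0// fine_gt0// muD.
  by rewrite finD.
apply: (@le_trans _ _ (\int[hmu mu x]_(h in D) c (src h))).
  apply: le_Rintegral => //.
  - apply: measurable_bounded_integrable => //.
    by exists (c y / 2); split => //= M cM h _; rewrite ger0_norm ?ltW.
  - exact: integrableS (mass_integrable x).
  - by move=> h [/ltW].
rewrite /mass -(setDUK DC) Rintegral_setU //.
- by rewrite lerDl Rintegral_ge0// => h _; exact: cutc.2.1.
- exact: measurableD.
- by rewrite setDUK//; exact: mass_integrable.
- by apply/disj_setPS => h [? []].
Qed.

Definition avg (x : X) (f : G -> R) := (\int[hmu mu x]_(g in carrier x) (f g * c (src g))) / mass x.

Lemma avg_cst x k : avg x (fun=> k) = k.
Proof.
rewrite /avg RintegralZl; first by rewrite mulfK// gt_eqF// mass_gt0.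
- exact: carrier_measurable.
- exact: mass_integrable.
Qed.

Lemma avgD x f f' : borel_bounded f -> borel_bounded f' ->
  avg x (fun g => f g + f' g) = avg x f + avg x f'.
Proof.
move=> bf bf'; rewrite /avg -mulrDl -RintegralD//.
- by under eq_Rintegral do rewrite mulrDl.
- exact: carrier_measurable.
- exact: borel_bounded_integrable.
- exact: borel_bounded_integrable.
Qed.

Lemma avg_ge0 x f : (forall g, 0 <= f g) -> 0 <= avg x f.
Proof.
move=> f0; rewrite divr_ge0// ?(ltW (mass_gt0 _))//.
by apply: Rintegral_ge0 => g _; rewrite mulr_ge0//; exact: cutc.2.1.
Qed.

Lemma eq_avg x f f' : (forall g, carrier x g -> f g = f' g) -> avg x f = avg x f'.
Proof.
by move=> ff'; congr (_ / _); apply: eq_Rintegral => g; rewrite inE => /ff' ->.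
Qed.



(** Left translation by [h] makes sense on one fiber only. Extending preimages of open sets to open
    subsets of [G] shows that the totalised [translate] is Borel. *)
Lemma translation_preimage (h : G) (O : set G) : open O -> exists2 U : set G, open U &
  forall k, tgt k = src h -> U k <-> O (gmul Gd h k).
Proof.
move=> oO; pose V := [set k | tgt k = src h -> O (gmul Gd h k)].
exists (interior V); first exact: open_interior.
move=> k tk; split => [/interior_subset/(_ tk)//|Ohk].
have : catw [set k | src h = tgt k] (fun k => gmul Gd h k) k.
  apply: (catw_comp (D' := [set p : G * G | src p.1 = tgt p.2]) (f := fun k => (h, k))
    (g := fun p => gmul Gd p.1 p.2)) => //.
    by apply: catw_pair; apply: continuous_catw; [exact: cst_continuous|exact: cvg_id].
  by have /within_catw := @gmul_cont _ _ Gd; exact.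
by move=> /catwP/(_ O); rewrite /interior/= => H; have := H (open_nbhs_nbhs (conj oO Ohk));
  apply: filterS => z /[swap] tz; apply.
Qed.

(** Totalised by the identity off the fiber over [src h], a null set for the measure of that
    fiber. *)
Definition translate (h k : G) := if tgt k == src h :> X then gmul Gd h k else k.

Lemma translateE h k : tgt k = src h -> translate h k = gmul Gd h k.
Proof. by rewrite /translate => ->; rewrite eqxx. Qed.

Lemma translate_measurable h : measurable_fun [set: BG G] (translate h : BG G -> BG G).
Proof.
apply: (measurability _ (erefl (measurable : set (set (BG G))))).
move=> _ [V oV <-]; rewrite setTI.
have [U oU UO] := translation_preimage h oV.
have -> : translate h @^-1` V =
    (tgt @^-1` [set src h] `&` U) `|` (~` (tgt @^-1` [set src h]) `&` V).
  apply/seteqP; split => k /=.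
    rewrite /translate; case: eqP => tk Ok; [left|right]; split => //.
    by apply/UO.
  rewrite /translate; case=> -[tk Ok]; first by rewrite tk eqxx; apply/UO.
  by case: eqP.
have mF := borel_closed (@fiber_closed (src h)).
apply: measurableU; apply: measurableI => //; try exact: borel_open.
exact: measurableC.
Qed.

Lemma borel_bounded_translate h f : borel_bounded f ->
  borel_bounded (fun k => f (translate h k)).
Proof.
move=> [mf [C fC]]; split; last by exists C => g; exact: fC.
exact: measurableT_comp mf (translate_measurable h).
Qed.

(** By left invariance the measure at [tgt h] is, up to the null set off the fiber, the push-forward
    along [translate h] of the measure at [src h]. The weight is unaffected because [gmul Gd h k]
    and [k] have the same source. *)
Lemma Rintegral_carrier_translate h f : borel_bounded f ->
  \int[hmu mu (tgt h)]_(k in carrier (tgt h)) (f k * c (src k)) =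
  \int[hmu mu (src h)]_(k in carrier (src h)) (f (translate h k) * c (src k)).
Proof.
move=> bf; congr fine.
have mT := translate_measurable h.
have mC := carrier_measurable (tgt h).
have mC' := carrier_measurable (src h).
set T : BG G -> BG G := translate h.
have tT A : A `<=` carrier (tgt h) -> T @^-1` A `\` ~` (tgt @^-1` [set src h]) =
    [set k : G | tgt k = src h /\ A (gmul Gd h k)].
  move=> AC; apply/seteqP; split => k /=.
    by case=> + /contrapT tk; rewrite /T translateE.
  by move=> [tk Ak]; split; [rewrite /T translateE|apply].
have mN : measurable (~` (tgt @^-1` [set src h]) : set (BG G)).
  by apply: measurableC; apply: borel_closed; exact: fiber_closed.
have N0 := outside_fiber_null (src h).
have eC : T @^-1` carrier (tgt h) `\` ~` (tgt @^-1` [set src h]) = carrier (src h).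
  rewrite tT//; apply/seteqP; split => k /=.
    by move=> [tk [_]]; rewrite src_gmul.
  by move=> [tk ck]; split => //; split; rewrite ?tgt_gmul ?src_gmul.
have mTC : measurable (T @^-1` carrier (tgt h)).
  by rewrite -[X in measurable X]setTI; exact: mT.
pose F (k : BG G) := (f k * c (src k))%:E.
have mF : measurable_fun [set: BG G] F.
  apply/measurable_EFinP; apply: measurable_funM; first exact: bf.1.
  by apply: continuous_borel; exact: cutoff_src_continuous.
have iF : (hmu mu (src h)).-integrable (T @^-1` carrier (tgt h)) (F \o T).
  have mFT : measurable_fun (T @^-1` carrier (tgt h)) (F \o T).
    by apply: measurable_funTS; exact: measurableT_comp.
  apply/integrableP; split => //.
  rewrite (ge0_negligible_integral mN)//; last exact: measurableT_comp.
  rewrite eC.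
  have /integrableP[_] := borel_bounded_integrable (src h) (borel_bounded_translate h bf).
  apply: le_lt_trans; rewrite le_eqVlt; apply/orP; left; apply/eqP.
  apply: eq_integral => k; rewrite inE => -[tk _].
  by rewrite /F /T /= translateE// src_gmul.
rewrite (@eq_measure_integral _ _ _ _ (pushforward (hmu mu (src h)) T)); last first.
  move=> A mA AC; rewrite (hmu_inv mu h mA) -tT// /pushforward.
  have mTA : measurable (T @^-1` A) by rewrite -[X in measurable X]setTI; exact: mT.
  by rewrite measureD_null.
rewrite -/F integral_pushforward //.
rewrite (negligible_integral mN) // eC.
apply: eq_integral => k; rewrite inE => -[tk _].
by rewrite /F /T /= translateE// src_gmul.
Qed.

Lemma avg_translate h f : borel_bounded f ->
  avg (tgt h) f = avg (src h) (fun k => f (translate h k)).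
Proof.
move=> bf; rewrite /avg Rintegral_carrier_translate//; congr (_ / _).
rewrite /mass.
have := Rintegral_carrier_translate h (borel_bounded_cst 1).
by under eq_Rintegral do rewrite mul1r; under [X in _ = X]eq_Rintegral do rewrite mul1r.
Qed.


(** Locally compact Hausdorff spaces are completely regular, so a continuous function separates [h0]
    from the complement of the interior of [O]. *)
Lemma bump (h0 : G) (O : set G) : nbhs h0 O -> exists psi : G -> R,
  [/\ continuous psi, forall g, 0 <= psi g <= 1, psi h0 = 1 & forall g, psi g != 0 -> O g].
Proof.
move=> /nbhs_interior Oh0.
have := @locally_compact_completely_regular G R lcG hG h0 (~` interior O).
rewrite /uniform_separator.
case.
- by rewrite closedC; exact: open_interior.
- by apply; exact: nbhs_singleton.
move=> uT [E sep].
have /uniform_separatorP : uniform_separator [set h0] (~` interior O) by exists uT, E.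
move=> /(_ R) [f [cf rf f0 f1]]; exists (fun g => 1 - f g); split.
- by move=> g; apply: cvgB; [exact: cvg_cst|exact: cf].
- move=> g; have : f g \in `[0, 1] by apply: rf; exists g.
  by rewrite in_itv /= => /andP[? ?]; apply/andP; split; lra.
- have -> : f h0 = 0 by apply: f0; exists h0.
  by rewrite subr0.
- move=> g; apply: contra_neqP => nOg; have -> : f g = 1; last by rewrite subrr.
  by apply: f1; exists g => //; apply: contra_not nOg => /interior_subset.
Qed.

(** If [K] is a compact neighborhood of the unit at [x], its image under [src] is compact and
    contains the neighborhood of all points whose units lie in [K]. *)
Lemma unit_space_locally_compact (x : X) : exists2 C : set X, nbhs x C & compact C.
Proof.
have [K] := lcG (x := unt Gd x) I; rewrite /= withinET => nK [cK _].
exists (src @` K); last first.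
  by apply: continuous_compact => //; apply: continuous_subspaceT => g; exact: src_cont.
have nK' : nbhs x (unt Gd @^-1` K) by exact: (@unt_cont _ _ Gd x).
apply: filterS nK' => y /= Ky.
by exists (unt Gd y) => //; rewrite src_unt.
Qed.

(** Continuity of the Haar system concerns compactly supported functions, whereas the weight has
    compact support only over compact subsets of [X]. The integrand is therefore multiplied by [chi]
    of the target, where [chi] is 1 at [x] and vanishes off a compact set; this factor is divided
    out again near [x]. *)
Lemma continuous_carrier_integral (phi : G -> R) : continuous phi -> borel_bounded phi ->
  continuous (fun x => \int[hmu mu x]_(g in carrier x) (phi g * c (src g))).
Proof.
move=> cphi bphi x.
have [C nC cC] := unit_space_locally_compact x.
have nC' : nbhs (unt Gd x) (src @^-1` C).
  by apply: (@src_cont _ _ Gd); rewrite src_unt.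
have [eta [ceta _ eta1 etaC]] := bump nC'.
pose chi y := eta (unt Gd y).
have cchi : continuous chi.
  by move=> y; apply: continuous_comp; [exact: unt_cont|exact: ceta].
have chi1 : chi x = 1 by [].
have chiC y : chi y != 0 -> C y by move=> /etaC; rewrite /= src_unt.
pose psi g := phi g * c (src g) * chi (tgt g).
have cpsi : continuous psi.
  move=> g; apply: cvgM; first apply: cvgM.
  - exact: cphi.
  - exact: cutoff_src_continuous.
  - by apply: continuous_comp; [exact: tgt_cont|exact: cchi].
have spsi : compact (closure [set g | psi g != 0]).
  have [K cK CK] := compact_carrier_hull cC.
  apply: (subclosed_compact _ cK); first exact: closed_closure.
  rewrite [X in _ `<=` X]((closure_id _).1 (compact_closed hG cK)).
  apply: closure_subset => g /=; rewrite /psi !mulf_eq0 !negb_or => /andP[/andP[_ cg] chig].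
  by apply: (CK (tgt g)) => //; exact: chiC.
(* The measure vanishes off the fiber, and on the fiber the weight vanishes off the carrier; [chi]
   of the target is constant on the fiber. *)
have key y : fine (\int[hmu mu y]_(g in [set: BG G]) (psi g)%:E)%E =
    (\int[hmu mu y]_(g in carrier y) (phi g * c (src g))) * chi y.
  rewrite (@ae_eq_integral _ _ _ (hmu mu y) _ ((EFin \o psi) \_ (carrier y)))//.
  - rewrite -integral_mkcond -(@RintegralZr _ _ _ (hmu mu y)).
    + by congr fine; apply: eq_integral => g; rewrite inE /= => -[tg _]; rewrite /psi tg.
    + exact: carrier_measurable.
    + exact: borel_bounded_integrable.
  - by apply/measurable_EFinP; exact: continuous_borel.
  - apply/(measurable_restrictT _ _).1; first exact: carrier_measurable.
    by apply: measurable_funTS; apply/measurable_EFinP; exact: continuous_borel.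
  - exists (~` (tgt @^-1` [set y])); split.
    + by apply: measurableC; apply: borel_closed; exact: fiber_closed.
    + exact: outside_fiber_null.
    + move=> g /= H tg; apply: H => _; rewrite patchE; case: ifPn => //.
      rewrite notin_setE /carrier /= => H; rewrite /psi (_ : c (src g) = 0) ?mulr0 ?mul0r//.
      by apply/eqP/negPn/negP => cg; exact: H.
have := @hmu_cont R X G Gd mu psi cpsi spsi x; rewrite /continuous_at.
under eq_fun do rewrite key.
rewrite key chi1 mulr1 => cI.
pose J y := \int[hmu mu y]_(g in carrier y) (phi g * c (src g)).
change (J @ x --> J x).
have : (fun y => (J y * chi y) / chi y) @ x --> J x / chi x.
  by apply: cvgM cI _; apply: cvgV; [rewrite chi1 oner_eq0|exact: cchi].
rewrite chi1 divr1; apply: cvg_trans; apply: near_eq_cvg.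
have : \forall y \near x, chi y != 0.
  apply: (cchi x [set r | r != 0]); apply: open_nbhs_nbhs; split => /=.
    have -> : [set r : R | r != 0] = ~` [set 0] by apply/seteqP; split => r /= /eqP.
    exact/closed_openC/closed_eq.
  by rewrite chi1 oner_eq0.
by apply: filterS => y y0; rewrite mulfK.
Qed.

Lemma continuous_avg (phi : G -> R) : continuous phi -> borel_bounded phi ->
  continuous (fun x => avg x phi).
Proof.
move=> cphi bphi x; apply: cvgM; first exact: continuous_carrier_integral.
apply: cvgV; first by rewrite gt_eqF// mass_gt0.
have -> : mass = fun y => \int[hmu mu y]_(g in carrier y) (1 * c (src g)).
  by apply/funext => y; apply: eq_Rintegral => g _; rewrite mul1r.
apply: (continuous_carrier_integral (phi := fun=> 1)).
  exact: cst_continuous.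
exact: borel_bounded_cst.
Qed.

Lemma borel_bounded_continuous (phi : G -> R) C : continuous phi ->
  (forall g, `|phi g| <= C) -> borel_bounded phi.
Proof. by move=> cphi bphi; split; [exact: continuous_borel|exists C]. Qed.

(** One finite family serves all fibers near the one over [x z0], with base points on that fiber
    alone. The carriers of nearby fibers lie in a common compact set, which is covered by finitely
    many sets on which a bump function exceeds 1/2; the bumps are then normalised. *)
Lemma near_partition (Z : topologicalType) (z0 : Z) (D : set Z) (x : Z -> X)
    (Q : G -> Z -> G -> Prop) : D z0 -> catw D x z0 ->
  (forall h0, tgt h0 = x z0 -> \forall z \near z0 & h \near h0,
     D z -> tgt h = x z -> Q h0 z h) ->
  exists (I : finType) (hs : I -> G) (phi : I -> G -> R),
    (forall i, [/\ tgt (hs i) = x z0, continuous (phi i), borel_bounded (phi i) &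
      forall g, 0 <= phi i g]) /\
    \forall z \near z0, D z -> forall h, carrier (x z) h ->
      \sum_i phi i h = 1 /\ forall i, phi i h != 0 -> Q (hs i) z h.
Proof.
move=> Dz0 /catwP cx locQ.
have loc h0 : exists UNp : set G * set Z * (G -> R), let: (U, N, psi) := UNp in
  [/\ open U /\ U h0, nbhs z0 N, (continuous psi /\ forall g, 0 <= psi g <= 1),
    (forall h z, U h -> N z -> D z -> tgt h = x z -> tgt h0 = x z0 /\ 1 / 2 < psi h) &
    (forall h z, N z -> D z -> tgt h = x z -> psi h != 0 -> Q h0 z h)].
  have [th0|th0] := pselect (tgt h0 = x z0).
    have [[N V] /= [nN nV] NV] := locQ h0 th0.
    have [psi [cpsi psi01 psi1 psiV]] := bump nV.
    exists ([set h | 1 / 2 < psi h], N, psi); split => //.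
    - split => /=; last by rewrite psi1; lra.
      by apply: (@open_comp _ _ psi [set r | 1 / 2 < r]) => [h _|]; [exact: cpsi|exact: open_gt].
    - by move=> h z Nz Dz th /psiV Vh; exact: (NV (z, h)).
  (* A point off the fiber over [x z0] has a neighborhood which nearby fibers miss. It receives the
     bump 0 and is left out of the index type [I]. *)
  have := unit_space_hausdorff; rewrite open_hausdorff => /(_ _ _ (introN eqP th0)).
  case=> -[A B] /= [Ah Bx] [oA oB /eqP AB].
  exists (tgt @^-1` A, [set z | D z -> B (x z)], fun=> 0); split => //.
  - split; last by rewrite inE in Ah.
    by apply: open_comp => // g _; exact: tgt_cont.
  - by apply: cx; apply: open_nbhs_nbhs; split => //; rewrite inE in Bx.
  - by split; [exact: cst_continuous|move=> g; rewrite lexx ler01].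
  - move=> h z /= Ah' Bz Dz th; exfalso; move: AB; rewrite -subset0; apply.
    by split; [exact: Ah'|rewrite th; exact: Bz].
  - by move=> h z _ _ _; rewrite eqxx.
have {loc}[F HF] := boolp.choice loc.
pose U h := (F h).1.1; pose N h := (F h).1.2; pose psi h := (F h).2.
have {}HF h0 : [/\ open (U h0) /\ U h0 h0, nbhs z0 (N h0),
    (continuous (psi h0) /\ forall g, 0 <= psi h0 g <= 1),
    (forall h z, U h0 h -> N h0 z -> D z -> tgt h = x z ->
       tgt h0 = x z0 /\ 1 / 2 < psi h0 h) &
    (forall h z, N h0 z -> D z -> tgt h = x z -> psi h0 h != 0 -> Q h0 z h)].
  by move: (HF h0); rewrite /U /N /psi; case: (F h0) => [[? ?] ?].
have [C nC cC] := unit_space_locally_compact (x z0).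
have [K cK CK] := compact_carrier_hull cC.
have := cK; rewrite compact_cover => /(_ G setT U).
case.
- by move=> h _; have [[]] := HF h.
- by move=> h Kh; exists h => //; have [[]] := HF h.
move=> F0 _ KF0.
pose I := {i : F0 | tgt (val i) == x z0 :> X}.
pose hs (i : I) : G := val (val i).
pose S g := \sum_(i : I) psi (hs i) g.
have cS : continuous S.
  apply: continuous_big => [|i _]; first exact: add_continuous.
  by have [_ _ [+ _] _ _] := HF (hs i).
(* On the relevant carriers [S] exceeds 1/2, so [m] equals [S] there. The floor 1/2 makes the
   quotients continuous on all of [G] and bounded by 2. *)
pose m g := Num.max (S g) (1 / 2).
have m0 g : 0 < m g by rewrite lt_max; apply/orP; right; lra.
have psi0 h g : 0 <= psi h g by have [_ _ [_ /(_ g)/andP[]]] := HF h.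
have psi1 h g : psi h g <= 1 by have [_ _ [_ /(_ g)/andP[]]] := HF h.
have cm : continuous m.
  by move=> g; apply: continuous_max; [exact: cS|exact: cst_continuous].
pose phi (i : I) g := psi (hs i) g / m g.
have cphi i : continuous (phi i).
  move=> g; apply: cvgM; first by have [_ _ [+ _] _ _] := HF (hs i); exact.
  by apply: cvgV; [rewrite gt_eqF|exact: cm].
have phi0 i g : 0 <= phi i g by rewrite divr_ge0 // ltW.
exists I, hs, phi; split.
  move=> i; split => //; first by exact/eqP/(valP i).
  apply: (@borel_bounded_continuous _ 2) => // g; rewrite ger0_norm//.
  rewrite ler_pdivrMr//; apply: (@le_trans _ _ 1); first exact: psi1.
  have : 1 / 2 <= m g by rewrite le_max lexx orbT.
  lra.
have nN : \forall z \near z0, forall i : F0, N (val i) z.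
  by apply: filter_forall => i; have [_ + _ _ _] := HF (val i).
have nC' : \forall z \near z0, D z -> C (x z) by exact: cx.
move: nC' nN; apply: filterS2 => z CDz Nz Dz h hz.
have Kh : K h by apply: (CK (x z)) => //; exact: CDz.
have [g /= gF0 Ugh] := KF0 _ Kh.
have [tg psig] : tgt g = x z0 /\ 1 / 2 < psi g h.
  have [_ _ _ + _] := HF g; apply; first exact: Ugh.
  - exact: (Nz [` gF0]%fset).
  - exact: Dz.
  - exact: hz.1.
have Ig : tgt (val [` gF0]%fset) == x z0 :> X by apply/eqP.
have Sh : 1 / 2 < S h.
  apply: (lt_le_trans psig); rewrite /S (bigD1 (exist _ [` gF0]%fset Ig : I))//=.
  by rewrite lerDl sumr_ge0.
split.
  rewrite -mulr_suml -/(S h) /m max_l ?ltW// divff// gt_eqF//.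
  by apply: lt_trans Sh; lra.
move=> i; rewrite /phi mulf_eq0 negb_or => /andP[psii _].
have [_ _ _ _ +] := HF (hs i); apply => //.
  exact: Nz.
exact: hz.1.
Qed.

End HaarAveraging.

(** * Vector-valued means *)

(** Stated for sequences, in the form of [bcomplete], so that it applies to bundle fibers, which are
    equipped below with the structure of normed modules only. *)
Definition sequentially_complete (R : realType) (B : normedModType R) :=
  forall u : nat -> B,
    (forall eps : R, 0 < eps -> exists N, forall m n, (N <= m)%N -> (N <= n)%N -> `|u m - u n| < eps) ->
    exists l, forall eps : R, 0 < eps -> exists N, forall n, (N <= n)%N -> `|u n - l| < eps.

Section VectorIntegral.
Variables (R : realType) (G : Type) (M : (G -> R) -> Prop) (L : (G -> R) -> R) (K : set G).

(** A positive normalised functional: [M] is the domain on which additivity is known, [K] the set on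
    which the values of a function matter. Abstracting from the Haar measure allows means over
    different fibers to be compared. *)
Record mean := Mean {
  mean_cst_dom : forall k, M (fun=> k);
  mean_add_dom : forall f f', M f -> M f' -> M (fun g => f g + f' g);
  mean_mul_dom : forall f f', M f -> M f' -> M (fun g => f g * f' g);
  mean_cst : forall k, L (fun=> k) = k;
  meanD : forall f f', M f -> M f' -> L (fun g => f g + f' g) = L f + L f';
  mean_ge0 : forall f, (forall g, 0 <= f g) -> 0 <= L f;
  eq_mean : forall f f', (forall g, K g -> f g = f' g) -> L f = L f'
}.

Hypothesis hL : mean.

Lemma mean_sum (I : Type) (s : seq I) (phi : I -> G -> R) : (forall i, M (phi i)) ->
  M (fun g => \sum_(i <- s) phi i g) /\
  L (fun g => \sum_(i <- s) phi i g) = \sum_(i <- s) L (phi i).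
Proof.
move=> Mphi; elim: s => [|i s [Ms Ls]].
  have -> : (fun g : G => \sum_(i <- [::]) phi i g) = fun=> 0.
    by apply/funext => g; rewrite big_nil.
  by rewrite big_nil; split; [exact: mean_cst_dom | exact: mean_cst].
have -> : (fun g : G => \sum_(j <- i :: s) phi j g) =
    fun g => phi i g + \sum_(j <- s) phi j g.
  by apply/funext => g; rewrite big_cons.
by rewrite big_cons -Ls; split; [exact: mean_add_dom | exact: meanD].
Qed.

Definition partition (I : finType) (phi : I -> G -> R) :=
  (forall i, M (phi i) /\ forall g, 0 <= phi i g) /\ forall g, K g -> \sum_i phi i g = 1.

Lemma partition_mul (I J : finType) (phi : I -> G -> R) (psi : J -> G -> R) i :
  partition phi -> partition psi ->
  L (phi i) = \sum_j L (fun g => phi i g * psi j g).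
Proof.
move=> [Mphi _] [Mpsi psi1].
have Mprod j : M (fun g => phi i g * psi j g).
  by apply: mean_mul_dom => //; [exact: (Mphi i).1|exact: (Mpsi j).1].
rewrite -(mean_sum _ Mprod).2; apply: (eq_mean hL) => g Kg.
by rewrite -mulr_sumr psi1// mulr1.
Qed.

Lemma partition_sum (I : finType) (phi : I -> G -> R) : partition phi -> \sum_i L (phi i) = 1.
Proof.
move=> [Mphi phi1]; rewrite -(mean_sum _ (fun i => (Mphi i).1)).2 -[RHS](mean_cst hL).
exact: eq_mean.
Qed.

Lemma partition1 : partition (fun (_ : unit) => (fun=> 1) : G -> R).
Proof.
split=> [i|g _]; last by rewrite big_const card_unit /= addr0.
by split; [exact: mean_cst_dom|move=> g].
Qed.

Section Codomain.
Variable B : normedModType R.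
Implicit Types xi : G -> B.

Definition approx (xi : G -> B) (eps : R) (I : finType) (phi : I -> G -> R) (v : I -> B) :=
  forall i g, K g -> phi i g != 0 -> `|xi g - v i| <= eps.

Definition riemann (I : finType) (phi : I -> G -> R) (v : I -> B) := \sum_i L (phi i) *: v i.

(** Uniform approximability along finite partitions takes the place of measurability with values in
    [B]; partitions of unity provide it for functions continuous on a fiber. *)
Definition vintegrable (xi : G -> B) := forall eps : R, 0 < eps ->
  exists (I : finType) (phi : I -> G -> R) (v : I -> B), partition phi /\ approx xi eps phi v.

(** Both sums are rewritten over the common refinement [phi i * psi j]. Where both factors are
    nonzero at a point of [K] the two values differ by at most eps + del + eta; elsewhere the weight
    is 0; and the weights add up to 1. *)
Lemma riemann_dist xi xi' eps del eta (I J : finType) (phi : I -> G -> R)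
    (psi : J -> G -> R) (v : I -> B) (w : J -> B) :
  partition phi -> partition psi -> approx xi eps phi v -> approx xi' del psi w ->
  (forall g, K g -> `|xi g - xi' g| <= eta) ->
  `|riemann phi v - riemann psi w| <= eps + del + eta.
Proof.
move=> Pphi Ppsi av aw xixi'.
have -> : riemann phi v = \sum_i \sum_j L (fun g => phi i g * psi j g) *: v i.
  by apply: eq_bigr => i _; rewrite (partition_mul i Pphi Ppsi) scaler_suml.
have -> : riemann psi w = \sum_i \sum_j L (fun g => phi i g * psi j g) *: w j.
  rewrite exchange_big; apply: eq_bigr => j _.
  rewrite (partition_mul j Ppsi Pphi) scaler_suml; apply: eq_bigr => i _.
  by congr (_ *: _); apply: (eq_mean hL) => g _; rewrite mulrC.
rewrite -sumrB.
apply: (@le_trans _ _ (\sum_i \sum_j L (fun g => phi i g * psi j g) * (eps + del + eta))).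
  apply: le_trans (ler_norm_sum _ _ _) _; apply: ler_sum => i _.
  rewrite -sumrB; apply: le_trans (ler_norm_sum _ _ _) _; apply: ler_sum => j _.
  rewrite -scalerBr normrZ.
  have [[g [Kg [p0 q0]]]|nex] := pselect (exists g, K g /\ phi i g != 0 /\ psi j g != 0).
    rewrite ger0_norm; last first.
      by apply: (mean_ge0 hL) => h; rewrite mulr_ge0//; [exact: (Pphi.1 i).2|exact: (Ppsi.1 j).2].
    apply: ler_wpM2l.
      by apply: (mean_ge0 hL) => h; rewrite mulr_ge0//; [exact: (Pphi.1 i).2|exact: (Ppsi.1 j).2].
    have -> : v i - w j = - (xi g - v i) + (xi' g - w j) + (xi g - xi' g).
      by rewrite opprB -addrA (addrC (xi' g - w j)) !subrKA.
    apply: le_trans (ler_normD _ _) _; apply: lerD; last exact: xixi'.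
    apply: le_trans (ler_normD _ _) _; apply: lerD; first by rewrite normrN; exact: av.
    exact: aw.
  have -> : L (fun g => phi i g * psi j g) = 0.
    rewrite -[RHS](mean_cst hL); apply: (eq_mean hL) => g Kg; apply/eqP.
    rewrite mulf_eq0; apply/negP/negP; rewrite -[_ || _]negbK negb_or; apply/negP => /andP[p0 q0].
    by apply: nex; exists g.
  by rewrite normr0 !mul0r.
under eq_bigr do rewrite -mulr_suml -(partition_mul _ Pphi Ppsi).
by rewrite -mulr_suml partition_sum// mul1r.
Qed.

(** The error bound is required of every approximating partition at once, so that later estimates
    may use whichever partition suits them. *)
Definition is_vint xi (v : B) := forall eps (I : finType) (phi : I -> G -> R) w,
  partition phi -> approx xi eps phi w -> `|v - riemann phi w| <= eps.

Definition vint xi : B := xget 0 [set v | is_vint xi v].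

Hypothesis cB : sequentially_complete B.

Lemma is_vint_ex xi : vintegrable xi -> exists v, is_vint xi v.
Proof.
move=> ixi.
have pos n : 0 < n.+1%:R^-1 :> R by rewrite invr_gt0 ltr0n.
have /boolp.choice[u hu] : forall n, exists u : B, exists (I : finType) (phi : I -> G -> R)
    (v : I -> B), [/\ partition phi, approx xi n.+1%:R^-1 phi v & u = riemann phi v].
  move=> n; have [I [phi [v [Pphi av]]]] := ixi _ (pos n).
  by exists (riemann phi v), I, phi, v.
have small (eps : R) : 0 < eps -> exists N, forall n, (N <= n)%N -> n.+1%:R^-1 < eps :> R.
  move=> e0; have := near_infty_natSinv_lt (PosNum e0) => -[N _ HN].
  by exists N => n Nn; exact: HN.
have [l Hl] : exists l, forall eps : R, 0 < eps -> exists N, forall n, (N <= n)%N -> `|u n - l| < eps.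
  apply: cB => eps e0; have e2 : 0 < eps / 2 by rewrite divr_gt0.
  have [N HN] := small _ e2; exists N => m n Nm Nn.
  have [I [phi [v [Pphi av ->]]]] := hu m; have [J [psi [w [Ppsi aw ->]]]] := hu n.
  have := @riemann_dist xi xi _ _ 0 _ _ _ _ _ _ Pphi Ppsi av aw.
  have := HN _ Nm; have := HN _ Nn => h1 h2 h3.
  have z0 g : K g -> `|xi g - xi g| <= 0 by rewrite subrr normr0.
  by apply: le_lt_trans (h3 z0) _; rewrite addr0 [eps]splitr; exact: ltrD.
exists l => eps I phi w Pphi aw; apply/ler_addgt0Pr => e e0.
have e2 : 0 < e / 2 by rewrite divr_gt0.
have [N1 H1] := small _ e2; have [N2 H2] := Hl _ e2.
pose n := maxn N1 N2.
have := H1 n (leq_maxl _ _); have := H2 n (leq_maxr _ _).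
have [J [psi [v [Ppsi av ->]]]] := hu n.
have := @riemann_dist xi xi _ _ 0 _ _ _ _ _ _ Ppsi Pphi av aw => h3.
have z0 g : K g -> `|xi g - xi g| <= 0 by rewrite subrr normr0.
move: (h3 z0); rewrite distrC => {}h3 h1 h2.
have -> : l - riemann phi w = (l - riemann psi v) + (riemann psi v - riemann phi w) by rewrite subrKA.
apply: le_trans (ler_normD _ _) _; rewrite distrC in h1; rewrite distrC in h3.
apply: le_trans (lerD (ltW h1) h3) _.
rewrite addr0 addrA addrC lerD2l [X in _ <= X]splitr lerD2l.
exact: ltW.
Qed.

Lemma vintP xi : vintegrable xi -> is_vint xi (vint xi).
Proof.
move=> /is_vint_ex[v hv]; rewrite /vint; case: xgetP => [w -> //|/(_ v)]; by [].
Qed.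

Lemma is_vint_unique xi v : vintegrable xi ->
  (forall eps : R, 0 < eps -> exists (I : finType) (phi : I -> G -> R) (w : I -> B),
    [/\ partition phi, approx xi eps phi w & `|v - riemann phi w| <= eps]) ->
  v = vint xi.
Proof.
move=> ixi hv; apply/eqP; rewrite -subr_eq0 -normr_le0; apply/ler_addgt0Pr => e e0.
have e2 : 0 < e / 2 by rewrite divr_gt0.
have [I [phi [w [Pphi aw h]]]] := hv _ e2.
have := vintP ixi Pphi aw; rewrite distrC => h'.
have -> : v - vint xi = (v - riemann phi w) + (riemann phi w - vint xi) by rewrite subrKA.
by apply: le_trans (ler_normD _ _) _; lra.
Qed.

Lemma vint_norm xi C : vintegrable xi -> (forall g, K g -> `|xi g| <= C) -> `|vint xi| <= C.
Proof.
move=> ixi hC.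
(* The trivial partition with the single value 0 approximates [xi] within [C]. *)
have := vintP ixi partition1 (_ : approx xi C (fun _ : unit => fun=> 1) (fun=> 0)).
rewrite /riemann big1 ?subr0; last by move=> i _; rewrite scaler0.
by apply=> i g Kg _; rewrite subr0; exact: hC.
Qed.

Lemma eq_vint xi xi' : (forall g, K g -> xi g = xi' g) -> vint xi = vint xi'.
Proof.
move=> e; rewrite /vint; congr (xget _ _); apply/seteqP; split => v hv eps I phi w Pphi aw;
  apply: hv => // i g Kg; [rewrite e//|rewrite -e//]; exact: aw.
Qed.

Lemma eq_vintegrable xi xi' : (forall g, K g -> xi g = xi' g) -> vintegrable xi -> vintegrable xi'.
Proof.
move=> e ixi eps /ixi[I [phi [v [Pphi av]]]]; exists I, phi, v; split => // i g Kg.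
by rewrite -e//; exact: av.
Qed.

Lemma vint_cst v : vintegrable (fun=> v) /\ vint (fun=> v) = v.
Proof.
have i : vintegrable (fun=> v).
  move=> eps e0; exists unit, (fun=> (fun=> 1)), (fun=> v); split; first exact: partition1.
  by move=> i g _ _; rewrite subrr normr0 ltW.
split => //; apply/esym/is_vint_unique => // eps e0.
exists unit, (fun=> (fun=> 1)), (fun=> v); split; first exact: partition1.
  by move=> j g _ _; rewrite subrr normr0 ltW.
rewrite /riemann big_const card_unit /= addr0 (mean_cst hL) scale1r subrr normr0.
exact: ltW.
Qed.

Lemma vintD xi xi' : vintegrable xi -> vintegrable xi' ->
  vintegrable (fun g => xi g + xi' g) /\
  vint (fun g => xi g + xi' g) = vint xi + vint xi'.
Proof.
move=> ixi ixi'.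
have key (eps : R) : 0 < eps -> exists (I : finType) (phi : I -> G -> R) (w : I -> B),
    [/\ partition phi, approx (fun g => xi g + xi' g) eps phi w &
        `|vint xi + vint xi' - riemann phi w| <= eps].
  move=> e0; have e2 : 0 < eps / 2 by rewrite divr_gt0.
  have [I [phi [v [Pphi av]]]] := ixi _ e2.
  have [J [psi [w [Ppsi aw]]]] := ixi' _ e2.
  have h1 := vintP ixi Pphi av; have h2 := vintP ixi' Ppsi aw.
  (* The product partition refines both, so it approximates the sum with the sum of the two
     errors. *)
  exists (I * J)%type, (fun ij g => phi ij.1 g * psi ij.2 g), (fun ij => v ij.1 + w ij.2); split.
  - split=> [[i j]|g Kg]; first split.
    + by apply: mean_mul_dom => //; [exact: (Pphi.1 i).1|exact: (Ppsi.1 j).1].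
    + by move=> g; rewrite mulr_ge0//; [exact: (Pphi.1 i).2|exact: (Ppsi.1 j).2].
    + rewrite -(pair_bigA _ (fun i j => phi i g * psi j g))/= -(Pphi.2 g Kg).
      by apply: eq_bigr => i _; rewrite -mulr_sumr Ppsi.2// mulr1.
  - move=> [i j] g Kg /=; rewrite mulf_eq0 negb_or => /andP[p0 q0].
    rewrite opprD addrACA; apply: le_trans (ler_normD _ _) _.
    by have := av i g Kg p0; have := aw j g Kg q0; lra.
  - have -> : riemann (fun ij : I * J => fun g => phi ij.1 g * psi ij.2 g)
       (fun ij => v ij.1 + w ij.2) = riemann phi v + riemann psi w.
      rewrite /riemann -(pair_bigA _ (fun i j => L (fun g => phi i g * psi j g) *: (v i + w j)))/=.
      transitivity (\sum_i \sum_j (L (fun g => phi i g * psi j g) *: v i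
         + L (fun g => phi i g * psi j g) *: w j)).
        by apply: eq_bigr => i _; apply: eq_bigr => j _; rewrite scalerDr.
      rewrite (eq_bigr (fun i => \sum_j L (fun g => phi i g * psi j g) *: v i
         + \sum_j L (fun g => phi i g * psi j g) *: w j)); last first.
        by move=> i _; rewrite big_split.
      rewrite big_split /=; congr (_ + _).
        by apply: eq_bigr => i _; rewrite (partition_mul i Pphi Ppsi) scaler_suml.
      rewrite exchange_big; apply: eq_bigr => j _.
      rewrite (partition_mul j Ppsi Pphi) scaler_suml; apply: eq_bigr => i _.
      by congr (_ *: _); apply: (eq_mean hL) => g _; rewrite mulrC.
    rewrite opprD addrACA; apply: le_trans (ler_normD _ _) _; lra.
have i : vintegrable (fun g => xi g + xi' g).
  by move=> eps /key[I [phi [w [? ? _]]]]; exists I, phi, w.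
by split => //; apply/esym/is_vint_unique.
Qed.

End Codomain.

Lemma vint_linear (B B' : normedModType R) (cB : sequentially_complete B)
    (cB' : sequentially_complete B') (F : B -> B') (C : R) (xi : G -> B) :
  (forall u v, F (u + v) = F u + F v) -> (forall k u, F (k *: u) = k *: F u) ->
  (forall u, `|F u| <= C * `|u|) -> vintegrable xi ->
  vintegrable (fun g => F (xi g)) /\ vint (fun g => F (xi g)) = F (vint xi).
Proof.
move=> FD FZ FC ixi.
have FB u v : F (u - v) = F u - F v by rewrite FD -scaleN1r FZ scaleN1r.
have F0 : F 0 = 0 by rewrite -(scale0r 0) FZ scale0r.
have Fsum (I : finType) (f : I -> B) : F (\sum_i f i) = \sum_i F (f i).
  by apply: (big_morph F FD F0).
pose C' := `|C| + 1.
have C'0 : 0 < C' by rewrite ltr_wpDl.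
have {}FC u : `|F u| <= C' * `|u|.
  apply: le_trans (FC u) _; apply: ler_wpM2r => //; rewrite /C'.
  by apply: le_trans (ler_norm _) _; rewrite lerDl.
have key (eps : R) : 0 < eps -> exists (I : finType) (phi : I -> G -> R) (w : I -> B'),
    [/\ partition phi, approx (fun g => F (xi g)) eps phi w &
        `|F (vint xi) - riemann phi w| <= eps].
  move=> e0; have eC : 0 < eps / C' by rewrite divr_gt0.
  have [I [phi [v [Pphi av]]]] := ixi _ eC.
  have h1 := vintP cB ixi Pphi av.
  exists I, phi, (fun i => F (v i)); split => //.
    move=> i g Kg p0; rewrite -FB; apply: le_trans (FC _) _.
    by rewrite mulrC -ler_pdivlMr//; exact: av.
  have -> : riemann phi (fun i => F (v i)) = F (riemann phi v).
    by rewrite Fsum; apply: eq_bigr => i _; rewrite FZ.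
  by rewrite -FB; apply: le_trans (FC _) _; rewrite mulrC -ler_pdivlMr.
have i : vintegrable (fun g => F (xi g)).
  by move=> eps /key[I [phi [w [? ? _]]]]; exists I, phi, w.
by split => //; apply/esym/is_vint_unique.
Qed.

Lemma vint_dist (B : normedModType R) (cB : sequentially_complete B) (xi xi' : G -> B) C :
  vintegrable xi -> vintegrable xi' -> (forall g, K g -> `|xi g - xi' g| <= C) ->
  `|vint xi - vint xi'| <= C.
Proof.
move=> ixi ixi' h.
have [||u|iN eN] := @vint_linear _ _ cB cB (fun v : B => - v) 1 _ _ _ _ ixi'.
- exact: opprD.
- by move=> k u; rewrite scalerN.
- by rewrite normrN mul1r.
have [iD eD] := vintD cB ixi iN.
by rewrite -eN -eD; exact: vint_norm.
Qed.

End VectorIntegral.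

(** Partitions pulled back along [t], with unchanged values, have the same Riemann sums. With [t] a
    left translation this is left invariance of vector-valued means. *)
Lemma vint_transfer (R : realType) (G G' : Type) (M : (G -> R) -> Prop) (L : (G -> R) -> R)
    (K : set G) (M' : (G' -> R) -> Prop) (L' : (G' -> R) -> R) (K' : set G')
    (hL : mean M L K) (hL' : mean M' L' K') (t : G' -> G) (B : normedModType R)
    (cB : sequentially_complete B) (xi : G -> B) :
  (forall f, M f -> M' (fun g => f (t g)) /\ L f = L' (fun g => f (t g))) ->
  (forall g, K' g -> K (t g)) -> vintegrable M K xi ->
  vintegrable M' K' (fun g => xi (t g)) /\
  vint M' L' K' (fun g => xi (t g)) = vint M L K xi.
Proof.
move=> ht Kt ixi.
have key (eps : R) : 0 < eps -> exists (I : finType) (phi : I -> G' -> R) (w : I -> B),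
    [/\ partition M' K' phi, approx K' (fun g => xi (t g)) eps phi w &
        `|vint M L K xi - riemann L' phi w| <= eps].
  move=> e0; have [I [phi [v [Pphi av]]]] := ixi _ e0.
  have h1 := vintP hL cB ixi Pphi av.
  exists I, (fun i g => phi i (t g)), v; split => //.
  - split=> [i|g Kg]; last by rewrite Pphi.2//; exact: Kt.
    by split; [exact: (ht _ (Pphi.1 i).1).1|move=> g; exact: (Pphi.1 i).2].
  - by move=> i g /Kt Kg; exact: av.
  - rewrite (_ : riemann _ _ _ = riemann L phi v)//.
    by apply: eq_bigr => i _; rewrite (ht _ (Pphi.1 i).1).2.
have i : vintegrable M' K' (fun g => xi (t g)).
  by move=> eps /key[I [phi [w [? ? _]]]]; exists I, phi, w.
by split => //; apply/esym/(is_vint_unique hL').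
Qed.

(** * Fibers of a Banach bundle *)

Section Fiber.
Variables (R : realType) (X E : topologicalType) (bE : banach_bundle R X E) (x : X).

(** Packaging a fiber as a normed module makes the scalar theory of means and the usual vector
    identities available; elements of [E] are lifted by [liftE] and read back through [fvalD],
    [fvalZ] and [fvalB]. *)
Record fiber := Fiber { fval : E; fvalP : bproj bE fval = x }.

Lemma fval_inj : injective fval.
Proof. by move=> [e He] [e' He'] /= ee'; subst e'; congr Fiber; exact: Prop_irrelevance. Qed.

HB.instance Definition _ := gen_eqMixin fiber.
HB.instance Definition _ := gen_choiceMixin fiber.

Definition fiber_zero := Fiber (bproj_zero bE x).

Definition fiber_add (u v : fiber) :=
  Fiber (etrans (bproj_add (etrans (fvalP u) (esym (fvalP v)))) (fvalP u)).

Definition fiber_scale (a : R) (u : fiber) := Fiber (etrans (bproj_scale bE a (fval u)) (fvalP u)).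

Lemma fiber_addA : associative fiber_add.
Proof. by move=> u v w; apply: fval_inj; rewrite /= baddA// !fvalP. Qed.

Lemma fiber_addC : commutative fiber_add.
Proof. by move=> u v; apply: fval_inj; rewrite /= baddC// !fvalP. Qed.

Lemma fiber_add0 : left_id fiber_zero fiber_add.
Proof. by move=> u; apply: fval_inj; rewrite /= -(fvalP u) badd0. Qed.

Lemma fiber_addN : left_inverse fiber_zero (fiber_scale (-1)) fiber_add.
Proof. by move=> u; rewrite fiber_addC; apply: fval_inj; rewrite /= baddN fvalP. Qed.

HB.instance Definition _ := GRing.isZmodule.Build fiber fiber_addA fiber_addC fiber_add0 fiber_addN.

Lemma fiber_scaleA a b u : fiber_scale a (fiber_scale b u) = fiber_scale (a * b) u.
Proof. by apply: fval_inj; rewrite /= bscaleA. Qed.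

Lemma fiber_scale1 : left_id 1 fiber_scale.
Proof. by move=> u; apply: fval_inj; rewrite /= bscale1. Qed.

Lemma fiber_scaleDr : right_distributive fiber_scale +%R.
Proof. by move=> a u v; apply: fval_inj; rewrite /= bscaleDr// !fvalP. Qed.

Lemma fiber_scaleDl u : {morph fiber_scale^~ u : a b / a + b}.
Proof. by move=> a b; apply: fval_inj; rewrite /= bscaleDl. Qed.

HB.instance Definition _ := GRing.Zmodule_isLmodule.Build R fiber
  fiber_scaleA fiber_scale1 fiber_scaleDr fiber_scaleDl.

Definition fiber_norm (u : fiber) : R := bnorm bE (fval u).

Lemma fiber_normD u v : fiber_norm (u + v) <= fiber_norm u + fiber_norm v.
Proof. by apply: bnormD; rewrite !fvalP. Qed.

Lemma fiber_normZ (a : R) u : fiber_norm (a *: u) = `|a| * fiber_norm u.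
Proof. exact: bnormZ. Qed.

Lemma fiber_norm_eq0 u : fiber_norm u = 0 -> u = 0.
Proof. by move=> u0; apply: fval_inj; rewrite (bnorm_eq0 u0) fvalP. Qed.

HB.instance Definition _ := Lmodule_isNormed.Build R fiber fiber_normD fiber_normZ fiber_norm_eq0.

Lemma fvalD (u v : fiber) : badd bE (fval u) (fval v) = fval (u + v).
Proof. by []. Qed.

Lemma fvalZ a (u : fiber) : bscale bE a (fval u) = fval (a *: u).
Proof. by []. Qed.

Lemma fvalB (u v : fiber) : bsub bE (fval u) (fval v) = fval (u - v).
Proof. by []. Qed.

Lemma fval0 : bzero bE x = fval 0.
Proof. by []. Qed.

Lemma fval_norm (u : fiber) : bnorm bE (fval u) = `|u|.
Proof. by []. Qed.

Lemma fiber_complete : sequentially_complete fiber.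
Proof.
move=> u cu; have [l [Hl ul]] := @bcomplete _ _ _ bE x (fun n => fval (u n)) (fun n => fvalP (u n)) cu.
exists (Fiber Hl) => eps e0.
move/cvgrPdist_lt : ul => /(_ _ e0) [N _ HN]; exists N => n Nn.
have := HN n Nn; rewrite /= sub0r normrN ger0_norm//; exact: bnorm_ge0.
Qed.

Definition tofiber (e : E) : fiber :=
  if pselect (bproj bE e = x) is left H then Fiber H else 0.

Lemma tofiberK e : bproj bE e = x -> fval (tofiber e) = e.
Proof. by rewrite /tofiber; case: pselect. Qed.

Lemma fvalK u : tofiber (fval u) = u.
Proof. by apply: fval_inj; rewrite tofiberK// fvalP. Qed.

Lemma liftE e : bproj bE e = x -> exists u : fiber, e = fval u.
Proof. by move=> H; exists (Fiber H). Qed.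

End Fiber.

(** * The bundle topology in terms of fiber norms *)

Section BundleTopology.
Variables (R : realType) (X E : topologicalType) (bE : banach_bundle R X E).
Local Notation p := (bproj bE).

Definition bdist (e e' : E) : R := bnorm bE (bsub bE e e').

Lemma bproj_sub e e' : p e = p e' -> p (bsub bE e e') = p e.
Proof. by move=> ee'; rewrite bproj_add// bproj_scale. Qed.

Lemma lift2 e e' : p e = p e' -> exists x (u v : fiber bE x), e = fval u /\ e' = fval v.
Proof. by move=> ee'; exists (p e'), (Fiber ee'), (Fiber (erefl (p e'))). Qed.

Lemma bdist_ge0 e e' : 0 <= bdist e e'. Proof. exact: bnorm_ge0. Qed.

Lemma bdistxx e : bdist e e = 0.
Proof. by have [u ->] := liftE (erefl (p e)); rewrite /bdist fvalB subrr fval_norm normr0. Qed.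

Lemma bdistC e e' : p e = p e' -> bdist e e' = bdist e' e.
Proof.
by move=> /lift2[x [u [v [-> ->]]]]; rewrite /bdist !fvalB !fval_norm distrC.
Qed.

Lemma bdist_triangle e1 e2 e3 : p e1 = p e2 -> p e3 = p e2 ->
  bdist e1 e3 <= bdist e1 e2 + bdist e2 e3.
Proof.
move=> /lift2[x [u [v [-> ->]]]]; rewrite fvalP => /liftE[w ->].
by rewrite /bdist !fvalB !fval_norm ler_distD.
Qed.

Lemma bdist_eq0 e e' : p e = p e' -> bdist e e' <= 0 -> e = e'.
Proof.
move=> /lift2[x [u [w [-> ->]]]].
by rewrite /bdist fvalB fval_norm normr_le0 subr_eq0 => /eqP ->.
Qed.

Lemma bnorm_zero x : bnorm bE (bzero bE x) = 0.
Proof. by rewrite fval0 fval_norm normr0. Qed.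

Lemma bnorm_le_dist e e' : p e = p e' -> bnorm bE e <= bnorm bE e' + bdist e e'.
Proof.
move=> /lift2[x [u [w [-> ->]]]].
by rewrite /bdist fvalB !fval_norm -{1}(subrK w u) addrC ler_normD.
Qed.

(** The axiom on convergence to zero vectors is applied to the filter generated by the tubes
    themselves. *)
Lemma zero_tube (x : X) W : nbhs (bzero bE x) W -> exists (U : set X) (eps : R),
  [/\ nbhs x U, 0 < eps & forall e, U (p e) -> bnorm bE e < eps -> W e].
Proof.
pose F : set_system E := [set W | exists (U : set X) (eps : R),
  [/\ nbhs x U, 0 < eps & forall e, U (p e) -> bnorm bE e < eps -> W e]].
have FF : ProperFilter F.
  apply: Build_ProperFilter_ex.
    move=> A [U [eps [nU e0 UA]]]; exists (bzero bE x); apply: UA.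
      by rewrite bproj_zero; exact: nbhs_singleton.
    by rewrite bnorm_zero.
  split.
  - by exists setT, 1; split => //; exact: filterT.
  - move=> A B [U [eps [nU e0 UA]]] [V [eps' [nV e0' VB]]].
    exists (U `&` V), (Num.min eps eps'); split; first exact: filterI.
      by rewrite lt_min e0.
    move=> e [Ue Ve]; rewrite lt_min => /andP[? ?]; split; [exact: UA|exact: VB].
  - move=> A B AB [U [eps [nU e0 UA]]]; exists U, eps; split => // e Ue ee.
    by apply: AB; exact: UA.
have pF : p @ F --> x by move=> U nU; exists U, 1; split.
have nF : bnorm bE @ F --> (0 : R).
  move=> V /nbhs_ballP[eps /= e0 eV]; exists setT, eps; split => //; first exact: filterT.
  move=> e _ ee; apply: eV; rewrite /ball /= sub0r normrN ger0_norm//; exact: bnorm_ge0.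
by move=> /(bzero_lim FF pF nF).
Qed.

(** Openness of the projection: every base point near [p e] has a lift in [W]. This is the
    substitute for continuous sections through [e]. *)
Lemma near_lift e W : nbhs e W -> nbhs (p e) (p @` W).
Proof.
rewrite !nbhsE => -[V [oV Ve] VW]; exists (p @` V); last exact: image_subset.
by split; [exact: bproj_open|exists e].
Qed.

Section CatwOps.
Variables (Z : topologicalType) (D : set Z) (z : Z) (Dz : D z).

Lemma catw_add (f g : Z -> E) : (forall y, D y -> p (f y) = p (g y)) ->
  catw D f z -> catw D g z -> catw D (fun y => badd bE (f y) (g y)) z.
Proof.
move=> fg cf cg.
apply: (catw_comp (D' := [set q : E * E | p q.1 = p q.2]) (f := fun y => (f y, g y))
  (g := fun q => badd bE q.1 q.2)) => //; first exact: catw_pair.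
by have /within_catw := @badd_cont _ _ _ bE; apply; exact: fg.
Qed.

Lemma catw_scale (k : Z -> R) (f : Z -> E) :
  catw D k z -> catw D f z -> catw D (fun y => bscale bE (k y) (f y)) z.
Proof.
move=> ck cf.
apply: (catw_comp (D' := setT) (f := fun y => (k y, f y))
  (g := fun q => bscale bE q.1 q.2)) => //; first exact: catw_pair.
apply: continuous_catw; exact: bscale_cont.
Qed.

Lemma catw_bsub (f g : Z -> E) : (forall y, D y -> p (f y) = p (g y)) ->
  catw D f z -> catw D g z -> catw D (fun y => bsub bE (f y) (g y)) z.
Proof.
move=> fg cf cg; apply: catw_add => //.
  by move=> y Dy; rewrite bproj_scale fg.
by apply: catw_scale => //; apply: continuous_catw; exact: cst_continuous.
Qed.

Lemma catw_bnorm (f : Z -> E) : catw D f z -> catw D (fun y => bnorm bE (f y)) z.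
Proof.
move=> cf; apply: (catw_comp (D' := setT) (g := bnorm bE)) => //.
by apply: continuous_catw; exact: bnorm_cont.
Qed.

Lemma catw_bdist (f g : Z -> E) : (forall y, D y -> p (f y) = p (g y)) ->
  catw D f z -> catw D g z -> catw D (fun y => bdist (f y) (g y)) z.
Proof. by move=> fg cf cg; apply: catw_bnorm; exact: catw_bsub. Qed.

Lemma catw_bproj (f : Z -> E) : catw D f z -> catw D (fun y => p (f y)) z.
Proof.
move=> cf; apply: (catw_comp (D' := setT) (g := p)) => //.
by apply: continuous_catw; exact: bproj_cont.
Qed.

Lemma catw_lt (f : Z -> R) r : catw D f z -> f z < r -> \forall y \near z, D y -> f y < r.
Proof.
move=> /catwP cf fr; apply: (cf [set y | y < r]).
by apply: open_nbhs_nbhs; split => //; exact: open_lt.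
Qed.

End CatwOps.

(** Tubes around an arbitrary vector arise from tubes around zero by continuity of addition at the
    pair of [e] and the zero vector. *)
Lemma near_add (e : E) W : nbhs e W -> exists (W' : set E) (eps : R), [/\ nbhs e W', 0 < eps &
  forall e1 e2, W' e1 -> p e2 = p e1 -> bdist e2 e1 < eps -> W e2].
Proof.
move=> nW.
have : catw [set q : E * E | p q.1 = p q.2] (fun q => badd bE q.1 q.2) (e, bzero bE (p e)).
  by have /within_catw := @badd_cont _ _ _ bE; apply; rewrite /= bproj_zero.
move=> /catwP/(_ W); rewrite /= (baddC (esym (bproj_zero _ _))) badd0.
move=> /(_ nW) [[W1 W2] /= [nW1 nW2] HW].
have [U [eps [nU e0 UW2]]] := zero_tube nW2.
have nU' : nbhs e (p @^-1` U) by exact: (@bproj_cont _ _ _ bE).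
exists (W1 `&` p @^-1` U), eps; split => //; first exact: filterI.
move=> e1 e2 [We1 Ue1] ee h.
have := HW (e1, bsub bE e2 e1); rewrite /=.
have -> : badd bE e1 (bsub bE e2 e1) = e2.
  move/lift2 : ee => [x [u [w [-> ->]]]].
  by rewrite fvalB fvalD addrC subrK.
apply; last by rewrite bproj_sub.
by split => //; apply: UW2 => //=; rewrite bproj_sub// ee.
Qed.

(** A criterion for limits, means and inverses alike: it suffices to approximate [f y] by vectors
    [e'] close to one fixed [e1]. A lift [w] of the projection of [f y] near [f z] is compared with
    [e'], the two being close because [(w, e')] is near [(f z, e1)]; hence [w] is close to [f y]
    too. *)
Lemma catw_approx (Z : topologicalType) (D : set Z) (z : Z) (f : Z -> E) : D z ->
  catw D (fun y => p (f y)) z ->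
  (forall eps : R, 0 < eps -> exists e1, [/\ p e1 = p (f z), bdist (f z) e1 <= eps &
     forall W, nbhs e1 W -> \forall y \near z, D y ->
       exists e', [/\ W e', p e' = p (f y) & bdist (f y) e' <= eps]]) ->
  catw D f z.
Proof.
move=> Dz cpf H; apply/catwP => W /near_add[W' [eps [nW' e0 HW]]].
have e4 : 0 < eps / 4 by rewrite divr_gt0.
have [e1 [pe1 d1 He1]] := H _ e4.
have : catw [set q : E * E | p q.1 = p q.2] (fun q => bdist q.1 q.2) (f z, e1).
  by apply: catw_bdist => //; [apply: continuous_catw; exact: cvg_fst|
    apply: continuous_catw; exact: cvg_snd].
move=> /(catw_lt (r := eps / 2)) /=; case.
  by apply: le_lt_trans d1 _; lra.
move=> [V1 V2] /= [nV1 nV2] HV.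
have := He1 _ nV2.
have : \forall y \near z, D y -> (p @` (W' `&` V1)) (p (f y)).
  by move/catwP : cpf; apply; apply: near_lift; exact: filterI.
apply: filterS2 => y Hy1 Hy2 Dy.
have [w [W'w V1w] pw] := Hy1 Dy; have [e' [V2e' pe' de']] := Hy2 Dy.
apply: (HW w) => //.
apply: le_lt_trans (bdist_triangle (e2 := e') _ _) _; rewrite ?pe'//.
have : bdist w e' < eps / 2.
  by apply: (HV (w, e')) => //=; rewrite pw pe'.
rewrite (bdistC (e := w)) ?pw//; lra.
Qed.

End BundleTopology.

(** * Means of sections *)

(** Riemann sums are moved to neighboring fibers: the vectors are lifted one at a time by openness
    of the projection, and continuity of the operations keeps the weighted sum inside [W]. *)
Lemma near_lift_sum (R : realType) (X E Z : topologicalType) (bE : banach_bundle R X E)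
    (D : set Z) (z0 : Z) (y : Z -> X) (I : eqType) (lam : I -> Z -> R)
    (v : I -> fiber bE (y z0)) (V : I -> set E) (s : seq I) :
  D z0 -> catw D y z0 -> uniq s -> (forall i, catw D (lam i) z0) ->
  (forall i, nbhs (fval (v i)) (V i)) ->
  forall W, nbhs (fval (\sum_(i <- s) lam i z0 *: v i)) W ->
  \forall z \near z0, D z -> exists w : I -> fiber bE (y z),
    (forall i, i \in s -> V i (fval (w i))) /\ W (fval (\sum_(i <- s) lam i z *: w i)).
Proof.
move=> Dz0 /catwP cy us clam nV; elim: s us => [_|i s IH /= /andP[nis us]] W.
  rewrite big_nil -fval0 => /zero_tube[U [eps [nU e0 UW]]].
  have := cy _ nU; apply: filterS => z Uz Dz; exists (fun=> 0); split => //.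
  rewrite big_nil; apply: UW; first by rewrite fvalP; exact: Uz.
  by rewrite fval_norm normr0.
rewrite big_cons -fvalD -fvalZ => nW.
pose f (q : R * E * E) := badd bE (bscale bE q.1.1 q.1.2) q.2.
have : catw [set q : R * E * E | bproj bE q.1.2 = bproj bE q.2] f
    (lam i z0, fval (v i), fval (\sum_(j <- s) lam j z0 *: v j)).
  apply: catw_add.
  - by rewrite /= !fvalP.
  - by move=> q /=; rewrite bproj_scale.
  - apply: catw_scale; apply: continuous_catw.
      by apply: continuous_comp; [exact: cvg_fst|exact: cvg_fst].
    by apply: continuous_comp; [exact: cvg_fst|exact: cvg_snd].
  - by apply: continuous_catw; exact: cvg_snd.
move=> /catwP/(_ W nW) [[AB W'] /= [[[A B] /= [nA nB] AB_] nW'] HW].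
have h1 : \forall z \near z0, D z -> A (lam i z) by move/catwP: (clam i); exact.
have h2 : \forall z \near z0, D z -> (bproj bE @` (B `&` V i)) (y z).
  by apply: cy; rewrite -(fvalP (v i)); apply: near_lift; exact: filterI.
have h3 := IH us W' nW'.
move: h1 h2 h3; apply: filterS3 => z Az Bz IHz Dz.
have [b [Bb Vb] pb] := Bz Dz; have [w [Vw W'w]] := IHz Dz.
exists (fun j => if j == i then Fiber pb else w j); split.
  move=> j; rewrite inE; case: eqP => [-> //|_ /= js].
  exact: Vw.
rewrite big_cons eqxx.
have -> : \sum_(j <- s) lam j z *: (if j == i then Fiber pb else w j) = \sum_(j <- s) lam j z *: w j.
  apply: eq_big_seq => j js; case: eqP => // ji; exfalso.
  by move: nis; rewrite -ji js.
rewrite -fvalD -fvalZ; apply: (HW (lam i z, b, fval (\sum_(j <- s) lam j z *: w j))) => /=.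
  by split => //; apply: AB_; split => //; exact: Az.
by rewrite pb fvalP.
Qed.

Section BundleAverage.
Variables (R : realType) (X : topologicalType) (G : ptopologicalType)
  (Gd : top_groupoid X G) (hG : hausdorff_space G)
  (lcG : locally_compact [set: G]) (mu : haar_system R Gd)
  (c : X -> R) (cutc : cutoff Gd c) (E : topologicalType) (bE : banach_bundle R X E).
Local Notation src := (src Gd).
Local Notation tgt := (tgt Gd).
Local Notation p := (bproj bE).
Local Notation bb := (@borel_bounded R G).
Local Notation supp := (carrier Gd c).
Local Notation av := (avg mu c).

Lemma avg_mean x : mean bb (av x) (supp x).
Proof.
split.
- exact: borel_bounded_cst.
- exact: borel_boundedD.
- exact: borel_boundedM.
- exact: avg_cst.
- exact: avgD.
- exact: avg_ge0.
- exact: eq_avg.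
Qed.

Definition bint (x y : X) (xi : G -> E) : E :=
  fval (vint bb (av x) (supp x) (fun h => tofiber bE y (xi h))).

Definition bintegrable (x y : X) (xi : G -> E) :=
  (forall h, supp x h -> p (xi h) = y) /\ vintegrable bb (supp x) (fun h => tofiber bE y (xi h)).

Lemma bproj_bint x y xi : p (bint x y xi) = y.
Proof. exact: fvalP. Qed.

Lemma bdist_tofiber y e e' : p e = y -> p e' = y ->
  bdist bE e e' = `|tofiber bE y e - tofiber bE y e'|.
Proof. by move=> /liftE[u ->] /liftE[v ->]; rewrite !fvalK /bdist fvalB fval_norm. Qed.

Lemma bint_riemann x y xi (I : finType) (phi : I -> G -> R) (v : I -> fiber bE y) eps :
  bintegrable x y xi -> partition bb (supp x) phi ->
  (forall i h, supp x h -> phi i h != 0 -> bdist bE (xi h) (fval (v i)) <= eps) ->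
  bdist bE (bint x y xi) (fval (riemann (av x) phi v)) <= eps.
Proof.
move=> [pxi ixi] Pphi H; rewrite /bdist fvalB fval_norm.
apply: (vintP (avg_mean x) (@fiber_complete _ _ _ bE y) ixi Pphi) => i h sh ph.
by have := H i h sh ph; rewrite (bdist_tofiber (pxi _ sh) (fvalP _)) fvalK.
Qed.

Lemma bint_cst x y xi e : p e = y -> (forall h, supp x h -> xi h = e) ->
  bintegrable x y xi /\ bint x y xi = e.
Proof.
move=> pe xie; have cB := @fiber_complete _ _ _ bE y.
have [i v] := vint_cst (avg_mean x) cB (tofiber bE y e).
have e1 h : supp x h -> tofiber bE y e = tofiber bE y (xi h) by move=> sh; rewrite xie.
split; first by split; [move=> h /xie ->|exact: (eq_vintegrable e1)].
by rewrite /bint -(eq_vint _ _ e1) v tofiberK.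
Qed.

Lemma bint_dist x y xi xi' C : bintegrable x y xi -> bintegrable x y xi' ->
  (forall h, supp x h -> bdist bE (xi h) (xi' h) <= C) ->
  bdist bE (bint x y xi) (bint x y xi') <= C.
Proof.
move=> [pxi ixi] [pxi' ixi'] H; rewrite /bdist fvalB fval_norm.
apply: (vint_dist (avg_mean x) (@fiber_complete _ _ _ bE y)) => // h sh.
by rewrite -bdist_tofiber ?pxi ?pxi'//; exact: H.
Qed.

Lemma eq_bint x y xi xi' : (forall h, supp x h -> xi h = xi' h) ->
  (bintegrable x y xi -> bintegrable x y xi') /\ bint x y xi = bint x y xi'.
Proof.
move=> e; have e1 h : supp x h -> tofiber bE y (xi h) = tofiber bE y (xi' h).
  by move=> /e ->.
split; last by rewrite /bint (eq_vint _ _ e1).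
move=> [pxi ixi]; split; first by move=> h sh; rewrite -e// pxi.
exact: (eq_vintegrable e1).
Qed.

Lemma bint_add x y xi xi' : bintegrable x y xi -> bintegrable x y xi' ->
  bintegrable x y (fun h => badd bE (xi h) (xi' h)) /\
  bint x y (fun h => badd bE (xi h) (xi' h)) = badd bE (bint x y xi) (bint x y xi').
Proof.
move=> [pxi ixi] [pxi' ixi'].
have [i e] := vintD (avg_mean x) (@fiber_complete _ _ _ bE y) ixi ixi'.
have e1 h : supp x h -> tofiber bE y (xi h) + tofiber bE y (xi' h) =
    tofiber bE y (badd bE (xi h) (xi' h)).
  move=> sh; have [u ->] := liftE (pxi h sh); have [v ->] := liftE (pxi' h sh).
  by rewrite fvalD !fvalK.
split; first split.
- by move=> h sh; rewrite bproj_add ?pxi ?pxi'.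
- exact: (eq_vintegrable e1).
- by rewrite /bint fvalD -e (eq_vint _ _ e1).
Qed.

Definition fiber_linear (y y' : X) (F : E -> E) :=
  [/\ forall e, p e = y -> p (F e) = y',
      forall e e', p e = y -> p e' = y -> F (badd bE e e') = badd bE (F e) (F e') &
      forall (k : R) e, p e = y -> F (bscale bE k e) = bscale bE k (F e)].

Lemma bint_linear x y y' F C xi : fiber_linear y y' F ->
  (forall e, p e = y -> bnorm bE (F e) <= C * bnorm bE e) -> bintegrable x y xi ->
  bintegrable x y' (fun h => F (xi h)) /\ bint x y' (fun h => F (xi h)) = F (bint x y xi).
Proof.
move=> [Fp FD FZ] FC [pxi ixi].
pose F' (u : fiber bE y) : fiber bE y' := tofiber bE y' (F (fval u)).
have F'E u : fval (F' u) = F (fval u) by rewrite tofiberK// Fp// fvalP.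
have [||u|i e] := @vint_linear _ _ _ _ _ (avg_mean x) _ _ (@fiber_complete _ _ _ bE y)
   (@fiber_complete _ _ _ bE y') F' C _ _ _ _ ixi.
- by move=> u v; apply: fval_inj; rewrite F'E -!fvalD !F'E FD// fvalP.
- by move=> k u; apply: fval_inj; rewrite F'E -!fvalZ !F'E FZ// fvalP.
- by rewrite -!fval_norm F'E FC// fvalP.
have e1 h : supp x h -> F' (tofiber bE y (xi h)) = tofiber bE y' (F (xi h)).
  by move=> sh; have [u ->] := liftE (pxi h sh); rewrite fvalK.
split; first by split; [move=> h /pxi/Fp|exact: (eq_vintegrable e1)].
by rewrite /bint -(eq_vint _ _ e1) e F'E.
Qed.

Lemma fiber_linear_zero y y' F : fiber_linear y y' F -> F (bzero bE y) = bzero bE y'.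
Proof.
move=> [Fp FD FZ].
have e0 z : bscale bE 0 (bzero bE z) = bzero bE z by rewrite fval0 fvalZ scale0r.
rewrite -e0 FZ ?bproj_zero//; have [u ->] := liftE (Fp _ (bproj_zero bE y)).
by rewrite fvalZ scale0r.
Qed.

Lemma fiber_linear_sub y y' F e e' : fiber_linear y y' F -> p e = y -> p e' = y ->
  F (bsub bE e e') = bsub bE (F e) (F e').
Proof. by move=> [Fp FD FZ] pe pe'; rewrite /bsub FD ?bproj_scale// FZ. Qed.

Lemma fiber_linear_dist y y' F e e' : fiber_linear y y' F -> p e = y -> p e' = y ->
  bdist bE (F e) (F e') = bnorm bE (F (bsub bE e e')).
Proof. by move=> lF pe pe'; rewrite (fiber_linear_sub lF). Qed.

Lemma fiber_linear_comp y1 y2 y3 F F' : fiber_linear y1 y2 F -> fiber_linear y2 y3 F' ->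
  fiber_linear y1 y3 (fun e => F' (F e)).
Proof.
move=> [Fp FD FZ] [Fp' FD' FZ']; split.
- by move=> e /Fp/Fp'.
- by move=> e e' pe pe'; rewrite FD// FD' ?Fp.
- by move=> k e pe; rewrite FZ// FZ' ?Fp.
Qed.

Lemma fiber_linear_scale y k : fiber_linear y y (bscale bE k).
Proof.
split; first by move=> e pe; rewrite bproj_scale.
- by move=> e e' pe pe'; rewrite bscaleDr// pe pe'.
- by move=> k' e pe; rewrite !bscaleA mulrC.
Qed.

Lemma bint_sub x y xi xi' : bintegrable x y xi -> bintegrable x y xi' ->
  bintegrable x y (fun h => bsub bE (xi h) (xi' h)) /\
  bint x y (fun h => bsub bE (xi h) (xi' h)) = bsub bE (bint x y xi) (bint x y xi').
Proof.
move=> ixi ixi'.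
have [|i e] := bint_linear (C := 1) (fiber_linear_scale y (-1)) _ ixi'.
  by move=> u _; rewrite bnormZ normrN1.
by rewrite /bsub -e; exact: bint_add.
Qed.

Lemma supp_gmul g k : tgt k = src g -> supp (src g) k -> supp (tgt g) (gmul Gd g k).
Proof. by move=> tk [_ ck]; split; rewrite ?tgt_gmul ?src_gmul. Qed.

Lemma bint_translate g y xi : bintegrable (tgt g) y xi ->
  bintegrable (src g) y (fun k => xi (gmul Gd g k)) /\
  bint (src g) y (fun k => xi (gmul Gd g k)) = bint (tgt g) y xi.
Proof.
move=> [pxi ixi].
have [||i e] := @vint_transfer _ _ _ _ _ _ _ _ _ (avg_mean (tgt g)) (avg_mean (src g))
  (translate Gd g) _ (@fiber_complete _ _ _ bE y) _ _ _ ixi.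
- by move=> f bf; split; [exact: borel_bounded_translate|exact: avg_translate].
- by move=> k [tk ck]; rewrite translateE//; apply: supp_gmul.
have e1 k : supp (src g) k -> tofiber bE y (xi (translate Gd g k)) =
    tofiber bE y (xi (gmul Gd g k)).
  by move=> [tk _]; rewrite translateE.
split; first split.
- by move=> k [tk ck]; apply: pxi; exact: supp_gmul.
- exact: (eq_vintegrable e1).
- by rewrite /bint -(eq_vint _ _ e1) e.
Qed.

Lemma partition_near (Z : topologicalType) (z0 : Z) (D : set Z) (x : Z -> X)
    (Q : G -> Z -> G -> Prop) : D z0 -> catw D x z0 ->
  (forall h0, tgt h0 = x z0 -> \forall z \near z0 & h \near h0,
     D z -> tgt h = x z -> Q h0 z h) ->
  exists (I : finType) (hs : I -> G) (phi : I -> G -> R),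
    [/\ forall i, tgt (hs i) = x z0, forall i, catw D (fun z => av (x z) (phi i)) z0 &
    \forall z \near z0, D z -> partition bb (supp (x z)) phi /\
      forall i h, supp (x z) h -> phi i h != 0 -> Q (hs i) z h].
Proof.
move=> Dz0 cx locQ.
have [I [hs [phi [Hi H]]]] := near_partition hG lcG cutc Dz0 cx locQ.
exists I, hs, phi; split.
- by move=> i; have [] := Hi i.
- move=> i; have [_ cphi bphi _] := Hi i.
  apply: (catw_comp (D' := setT) (f := x) (g := fun y => av y (phi i))) => //.
  by apply: continuous_catw; exact: continuous_avg.
- apply: filterS H => z H Dz; split; last by move=> i h sh; apply: (H Dz h sh).2.
  split; last by move=> h sh; exact: (H Dz h sh).1.
  by move=> i; have [] := Hi i.
Qed.

Lemma continuous_bintegrable x y xi : (forall h, tgt h = x -> p (xi h) = y) ->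
  (forall h, tgt h = x -> catw [set h | tgt h = x] xi h) -> bintegrable x y xi.
Proof.
move=> pxi cxi; split; first by move=> h [th _]; exact: pxi.
move=> eps e0.
(* A single fiber is treated as a family parametrised by the one-point set of [x]. *)
have [||I [hs [phi [ths _ /nbhs_singleton/(_ erefl)[Pphi H]]]]] :=
  @partition_near X x [set x] idfun
  (fun h0 _ h => bdist bE (xi h) (xi h0) < eps) erefl.
- by apply: continuous_catw; exact: cvg_id.
- move=> h0 th0.
  have : catw [set h | tgt h = x] (fun h => bdist bE (xi h) (xi h0)) h0.
    apply: catw_bdist => //; first by move=> h /= th; rewrite !pxi.
      exact: cxi.
    by apply: continuous_catw; exact: cst_continuous.
  move=> /(catw_lt (r := eps)); rewrite bdistxx => /(_ e0) H.
  by exists (setT, [set h | tgt h = x -> bdist bE (xi h) (xi h0) < eps]) => /=;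
    [split; [exact: filterT|exact: H]|move=> [z h] /= [_ Hh] -> /Hh].
exists I, phi, (fun i => tofiber bE y (xi (hs i))); split => // i h sh ph.
rewrite -bdist_tofiber ?pxi//; last by case: sh.
by apply/ltW/H.
Qed.

(** The Riemann sum at [z0] uses values at base points on one fiber. For [z] near [z0] these values
    are lifted to vectors over [y z], which still approximate [xi z] on the pieces of the same
    partition. The weights vary continuously with [z], so [catw_approx] applies. *)
Lemma catw_bint (Z : topologicalType) (D : set Z) (x y : Z -> X) (xi : Z -> G -> E) z0 :
  D z0 -> catw D x z0 -> catw D y z0 ->
  (forall z h, D z -> tgt h = x z -> p (xi z h) = y z) ->
  (forall z h, D z -> tgt h = x z ->
     catw [set q : Z * G | D q.1 /\ tgt q.2 = x q.1] (fun q => xi q.1 q.2) (z, h)) ->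
  catw D (fun z => bint (x z) (y z) (xi z)) z0.
Proof.
move=> Dz0 cx cy pxi cxi.
have ixi z : D z -> bintegrable (x z) (y z) (xi z).
  move=> Dz; apply: continuous_bintegrable => [h th|h th]; first exact: pxi.
  apply: (catw_comp (D' := [set q : Z * G | D q.1 /\ tgt q.2 = x q.1])
    (f := fun h => (z, h)) (g := fun q => xi q.1 q.2)) => //; last exact: cxi.
  by apply: catw_pair; apply: continuous_catw; [exact: cst_continuous|exact: cvg_id].
apply: (catw_approx (bE := bE)) => //.
  apply: (catw_eq (f := y)) => //; by move=> z Dz; rewrite bproj_bint.
move=> eps e0.
(* Since the fiber distance is continuous and vanishes on the diagonal, every vector over [y z]
   close to [xi z0 h0] is within [eps] of [xi z h] for all nearby [z] and [h]. *)
have locW h0 : exists V : set E, tgt h0 = x z0 -> nbhs (xi z0 h0) V /\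
    \forall z \near z0 & h \near h0, D z -> tgt h = x z ->
      forall w, V w -> p w = y z -> bdist bE (xi z h) w < eps.
  have [th0|] := pselect (tgt h0 = x z0); last by exists setT.
  pose D' := [set q : Z * G * E | (D q.1.1 /\ tgt q.1.2 = x q.1.1) /\ p q.2 = y q.1.1].
  have : catw D' (fun q => bdist bE (xi q.1.1 q.1.2) q.2) (z0, h0, xi z0 h0).
    apply: catw_bdist.
    - by split => //=; exact: pxi.
    - by move=> [[z h] w] /= [[Dz th] ->]; exact: pxi.
    - apply: (catw_comp (D' := [set q : Z * G | D q.1 /\ tgt q.2 = x q.1])
        (f := fun q : Z * G * E => q.1) (g := fun q => xi q.1 q.2)).
      + by move=> [[z h] w] /= [].
      + by apply: continuous_catw; exact: cvg_fst.
      + exact: cxi.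
    - by apply: continuous_catw; exact: cvg_snd.
  move=> /(catw_lt (r := eps)); rewrite /= bdistxx => /(_ e0).
  move=> [[AB V] /= [nAB nV] HV]; exists V => _; split => //.
  apply: filterS nAB => -[z h] /= ABq Dz th w Vw pw.
  by apply: (HV ((z, h), w)) => //=.
have [V HV] := boolp.choice locW.
have [|I [hs [phi [ths cphi H]]]] := @partition_near Z z0 D x
  (fun h0 z h => forall w, V h0 w -> p w = y z -> bdist bE (xi z h) w < eps) Dz0 cx.
  by move=> h0 th0; exact: (HV h0 th0).2.
pose v i : fiber bE (y z0) := tofiber bE (y z0) (xi z0 (hs i)).
have vE i : fval (v i) = xi z0 (hs i) by rewrite tofiberK// pxi.
have nV i : nbhs (fval (v i)) (V (hs i)) by rewrite vE; exact: (HV _ (ths i)).1.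
exists (fval (riemann (av (x z0)) phi v)); split.
- by rewrite !fvalP.
- have [Pphi H0] := nbhs_singleton H Dz0.
  apply: bint_riemann => //; first exact: ixi.
  move=> i h sh ph; apply/ltW; apply: (H0 i) => //; last exact: fvalP.
  exact: nbhs_singleton (nV i).
- move=> W nW.
  have := near_lift_sum Dz0 cy (index_enum_uniq I) cphi nV nW.
  move: H; apply: filterS2 => z H /[swap] Dz /(_ Dz)[w [Vw Ww]].
  have [Pphi H0] := H Dz.
  exists (fval (riemann (av (x z)) phi w)); split => //; first by rewrite !fvalP.
  apply: bint_riemann => //; first exact: ixi.
  move=> i h sh ph; apply/ltW; apply: (H0 i) => //; last exact: fvalP.
  by apply: Vw; rewrite mem_index_enum.
Qed.

End BundleAverage.

(** * Inverses of almost representations *)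

Lemma cvg_geometric0 (R : realType) (q kap eps : R) : 0 <= q < 1 -> 0 <= kap -> 0 < eps ->
  exists N, forall n, (N <= n)%N -> kap * q ^+ n < eps.
Proof.
move=> /andP[q0 q1] k0 e0; have : (fun n => kap * q ^+ n) @ \oo --> (0 : R).
  by rewrite -(mulr0 kap); apply: cvgMr; apply: cvg_expr; rewrite ger0_norm.
move/cvgrPdist_lt => /(_ _ e0) [N _ HN]; exists N => n Nn; have := HN n Nn.
by rewrite /= sub0r normrN ger0_norm// mulr_ge0// exprn_ge0.
Qed.

(** Writing the step bound as a difference lets it telescope: the distance from [u n] to any later
    term, hence to the limit, is at most kap q^n. *)
Lemma geometric_limit (R : realType) (B : normedModType R) (u : nat -> B) (q kap : R) :
  sequentially_complete B -> 0 <= q < 1 -> 0 <= kap ->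
  (forall n, `|u n.+1 - u n| <= kap * (q ^+ n - q ^+ n.+1)) ->
  exists l, forall n, `|u n - l| <= kap * q ^+ n.
Proof.
move=> cB q01 k0 H; have /andP[q0 q1] := q01.
have step n m : `|u (n + m)%N - u n| <= kap * (q ^+ n - q ^+ (n + m)).
  elim: m => [|m IH]; first by rewrite addn0 !subrr normr0 mulr0.
  rewrite addnS -(subrKA (u (n + m)%N)); apply: le_trans (ler_normD _ _) _.
  by apply: le_trans (lerD (H _) IH) _; rewrite -mulrDr addrC subrKA.
have step' n m : `|u (n + m)%N - u n| <= kap * q ^+ n.
  apply: le_trans (step n m) _; apply: ler_wpM2l => //.
  by rewrite gerBl exprn_ge0.
have [l Hl] : exists l, forall eps : R, 0 < eps -> exists N, forall n, (N <= n)%N -> `|u n - l| < eps.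
  apply: cB => eps e0; have [N HN] := cvg_geometric0 q01 k0 (divr_gt0 e0 (ltr0Sn _ 1)).
  exists N => m n Nm Nn.
  have Nd k : (N <= k)%N -> `|u k - u N| < eps / 2.
    by move=> Nk; rewrite -(subnKC Nk); apply: le_lt_trans (step' _ _) _; exact: HN.
  rewrite -(subrKA (u N)); apply: le_lt_trans (ler_normD _ _) _.
  by rewrite [eps]splitr; apply: ltrD; [exact: Nd|rewrite distrC; exact: Nd].
exists l => n; apply/ler_addgt0Pr => eps e0; have [N HN] := Hl _ e0.
rewrite -(subrKA (u (n + N)%N)); apply: le_trans (ler_normD _ _) _.
apply: lerD; first by rewrite distrC.
by apply/ltW/HN; rewrite leq_addl.
Qed.

(** The Neumann series in the form of the iteration w := e + (w - F w), whose increments shrink by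
    the factor [r]. *)
Lemma neumann_solve (R : realType) (B : normedModType R) (F : B -> B) (r : R) (e : B) :
  sequentially_complete B -> 0 <= r < 1 -> (forall u v, F (u - v) = F u - F v) ->
  (forall u, `|u - F u| <= r * `|u|) ->
  exists w, F w = e /\ `|w| <= `|e| / (1 - r).
Proof.
move=> cB r01 FB Fr; have /andP[r0 r1] := r01.
have r1' : 0 < 1 - r by rewrite subr_gt0.
pose u := fix u n := if n is n'.+1 then e + (u n' - F (u n')) else 0.
have F0 : F 0 = 0 by have := FB 0 0; rewrite subrr => ->; rewrite subrr.
have Hu n : `|u n.+1 - u n| <= (`|e| / (1 - r)) * (r ^+ n - r ^+ n.+1).
  have -> : r ^+ n - r ^+ n.+1 = (1 - r) * r ^+ n by rewrite exprS mulrBl mul1r.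
  rewrite mulrA divfK ?gt_eqF//; elim: n => [|n IH].
    by rewrite /= F0 !subr0 addr0 mulr1.
  have -> : u n.+2 - u n.+1 = (u n.+1 - u n) - F (u n.+1 - u n).
    by rewrite FB [u n.+2]/= [X in _ - X]/= opprD addrACA subrr add0r !opprD !opprK addrACA.
  apply: le_trans (Fr _) _; rewrite exprS mulrCA; exact: ler_wpM2l.
have [|w Hw] := geometric_limit cB r01 _ Hu; first by rewrite divr_ge0// ltW.
exists w; split; last by have := Hw 0%N; rewrite /= sub0r normrN mulr1.
apply/eqP; rewrite eq_sym -subr_eq0 -normr_le0; apply/ler_addgt0Pr => eps e0.
set K := `|e| / (1 - r) in Hw.
have K0 : 0 <= K by rewrite divr_ge0// ltW.
(* The residual e - F w splits into two terms, each at most K r^n; the factor 3 leaves room for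
   both. *)
have [n Hn] : exists n, K * r ^+ n * 3 <= eps.
  have [|N /(_ N (leqnn N))/ltW HN] := cvg_geometric0 r01 K0 (_ : 0 < eps / 3).
    by rewrite divr_gt0.
  by exists N; rewrite -ler_pdivlMr.
rewrite add0r; apply: le_trans Hn.
have -> : e - F w = (u n.+1 - w) + (((w - u n) - F (w - u n))).
  have {1}-> : e = u n.+1 - (u n - F (u n)) by rewrite /= addrK.
  rewrite FB; move: (u n.+1) (u n) (F w) (F _) => a b a' b'.
  by rewrite [in LHS]opprB [LHS]addrAC [RHS]addrA [in RHS]subrKA [in RHS]opprB addrACA
    [RHS]addrACA (addrC (- a')).
apply: le_trans (ler_normD _ _) _.
have h1 := Hw n.+1; have h2 := Hw n; have h3 := Fr (w - u n).
rewrite distrC in h2.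
have h4 : r ^+ n.+1 <= r ^+ n by rewrite exprS ler_piMl ?exprn_ge0 // ltW.
have h5 : K * r ^+ n.+1 <= K * r ^+ n by exact: ler_wpM2l.
have h6 : r * `|w - u n| <= `|w - u n| by rewrite ler_piMl // ltW.
apply: le_trans (lerD (le_trans h1 h5) (le_trans h3 (le_trans h6 h2))) _.
have : 0 <= K * r ^+ n by rewrite mulr_ge0// exprn_ge0.
by move: (K * r ^+ n) => t t0; lra.
Qed.

(** * Multipliers, inverses in the algebra bundle and the weight [ell] *)

Section TwistedGroupoid.
Variables (R : realType) (X : topologicalType) (G : ptopologicalType)
  (A E : topologicalType) (Gd : top_groupoid X G)
  (bA : banach_alg_bundle R X A) (gA : alg_G_bundle Gd bA)
  (bE : banach_module_bundle bA E)
  (sigma : G -> G -> A) (Hsigma : multiplier gA sigma).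
Local Notation src := (src Gd).
Local Notation tgt := (tgt Gd).
Local Notation p := (bproj bE).
Local Notation pA := (bproj bA).
Local Notation "g ** h" := (gmul Gd g h) (at level 40, left associativity).
Local Notation "g ^!" := (ginv Gd g) (at level 1).

Lemma ginvK g : g^!^! = g.
Proof.
rewrite -[RHS](gmul_untl Gd) -{1}(src_ginv Gd g) -(gmulVl Gd g^!) -gmulA ?src_ginv ?tgt_ginv//.
by rewrite gmulVl -(tgt_ginv Gd g) -(src_ginv Gd g^!) gmul_untr.
Qed.

Lemma sigma_proj g h : src g = tgt h -> pA (sigma g h) = tgt g.
Proof. by move=> gh; have [] := Hsigma.2.1 g h gh. Qed.

Lemma sigma_central g h : src g = tgt h -> acentral bA (sigma g h).
Proof. by move=> gh; have [] := Hsigma.2.1 g h gh. Qed.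

Lemma sigma_invertible g h : src g = tgt h -> ainvertible bA (sigma g h).
Proof. by move=> gh; have [] := Hsigma.2.1 g h gh. Qed.

Lemma sigma_unit g h : src g = tgt h -> is_unit_arrow Gd g \/ is_unit_arrow Gd h ->
  sigma g h = aone bA (tgt g).
Proof. exact: Hsigma.2.2.1. Qed.

Lemma ainvP a : ainvertible bA a -> pA (ainv bA a) = pA a /\
  amul bA a (ainv bA a) = aone bA (pA a) /\ amul bA (ainv bA a) a = aone bA (pA a).
Proof. by move=> ia; exact: (epsilon_spec (inhabits a) _ ia). Qed.

Lemma ainv_unique a b : ainvertible bA a -> pA b = pA a -> amul bA a b = aone bA (pA a) ->
  b = ainv bA a.
Proof.
move=> /ainvP[pi [ai ia]] pb ab.
by rewrite -[LHS](amul1l bA) pb -ia -amulA ?pi ?pb// ab -pi amul1r.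
Qed.

(** The cocycle identity for the triple h, h^-1, h, in which the two factors having a unit argument
    are 1. *)
Lemma sigma_ginv h : sigma h h^! = gact gA h (sigma h^! h).
Proof.
have := Hsigma.2.2.2 h h^! h; rewrite tgt_ginv src_ginv => /(_ erefl erefl).
rewrite gmulV gmulVl (sigma_unit (g := unt Gd (tgt h))); last by left; exists (tgt h).
  rewrite (sigma_unit (h := unt Gd (src h))); last by right; exists (src h).
    rewrite tgt_unt => H; have := sigma_proj (g := h) (h := h^!); rewrite tgt_ginv => /(_ erefl) ps.
    have ps' : pA (sigma h^! h) = src h by rewrite sigma_proj ?src_ginv ?tgt_ginv.
    have := bproj_gact gA ps' => pg.
    by move: H; rewrite -{1}ps amul1r -{1}pg amul1r.
  by rewrite tgt_unt.
by rewrite src_unt.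
Qed.

Definition sinv h := ainv bA (sigma h h^!).

Lemma sinvP h : [/\ pA (sinv h) = tgt h, amul bA (sigma h h^!) (sinv h) = aone bA (tgt h) &
  amul bA (sinv h) (sigma h h^!) = aone bA (tgt h)].
Proof.
have hh : src h = tgt h^! by rewrite tgt_ginv.
have [p1 [p2 p3]] := ainvP (sigma_invertible hh).
by rewrite /sinv p1 p2 p3 sigma_proj.
Qed.

Lemma ell_ge1 h : 1 <= ell Gd bA sigma h.
Proof. by rewrite /ell le_max lexx. Qed.

Lemma ell_gt0 h : 0 < ell Gd bA sigma h.
Proof. exact: lt_le_trans (ell_ge1 h). Qed.

Lemma norm_sinv_le h : bnorm bA (sinv h) <= ell Gd bA sigma h.
Proof. by rewrite /ell le_max lexx orbT. Qed.

(** By [sigma_ginv] the element [sinv h] is the image of [sinv] at the inverse arrow under the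
    action of [h], which is isometric. *)
Lemma ell_ginv h : ell Gd bA sigma h^! = ell Gd bA sigma h.
Proof.
rewrite /ell -!/(sinv _); congr Num.max.
have [p1 p2 p3] := sinvP h^!; have hh : src h = tgt h^! by rewrite tgt_ginv.
rewrite tgt_ginv ginvK in p1 p2 p3.
have ps : pA (sigma h^! h) = src h by rewrite sigma_proj ?tgt_ginv ?src_ginv.
suff -> : sinv h = gact gA h (sinv h^!) by rewrite gact_norm.
apply/esym/ainv_unique; first exact: sigma_invertible.
  by rewrite bproj_gact// sigma_proj.
by rewrite sigma_ginv -gact_mul// p2 gact_one bproj_gact.
Qed.

Lemma act1E x e : p e = x -> act bE (aone bA x) e = e.
Proof. by move=> <-; exact: act1. Qed.

Lemma bproj_actE x a e : pA a = x -> p e = x -> p (act bE a e) = x.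
Proof. by move=> pa pe; rewrite bproj_act ?pa. Qed.

Lemma bdist_zero e : bdist bE e (bzero bE (p e)) = bnorm bE e.
Proof.
have [x Hx] : exists x, p e = x by exists (p e).
by rewrite Hx; have [u ->] := liftE Hx; rewrite /bdist fval0 fvalB subr0.
Qed.

Lemma act_linear a : fiber_linear bE (pA a) (pA a) (act bE a).
Proof.
split; first by move=> e pe; rewrite bproj_act.
- by move=> e e' pe pe'; rewrite actDr// pe pe'.
- by move=> k e pe; rewrite actZr.
Qed.

Lemma act_dist a e e' : pA a = p e -> p e = p e' ->
  bdist bE (act bE a e) (act bE a e') <= bnorm bA a * bdist bE e e'.
Proof.
move=> ae ee'; rewrite (fiber_linear_dist (act_linear a)) -?ee'//.
by apply: act_norm; rewrite bproj_sub.
Qed.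

Lemma catw_amul (Z : topologicalType) (D : set Z) z (f k : Z -> A) :
  D z -> (forall z, D z -> pA (f z) = pA (k z)) -> catw D f z -> catw D k z ->
  catw D (fun z => amul bA (f z) (k z)) z.
Proof.
move=> Dz fk cf ck; apply: (catw_comp (D' := [set q : A * A | pA q.1 = pA q.2])
  (f := fun z => (f z, k z)) (g := fun q => amul bA q.1 q.2)) => //; first exact: catw_pair.
by have /within_catw := @amul_cont _ _ _ bA; apply; exact: fk.
Qed.

Lemma catw_act (Z : topologicalType) (D : set Z) z (f : Z -> A) (k : Z -> E) :
  D z -> (forall z, D z -> pA (f z) = p (k z)) -> catw D f z -> catw D k z ->
  catw D (fun z => act bE (f z) (k z)) z.
Proof.
move=> Dz fk cf ck; apply: (catw_comp (D' := [set q : A * E | pA q.1 = p q.2])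
  (f := fun z => (f z, k z)) (g := fun q => act bE q.1 q.2)) => //; first exact: catw_pair.
by have /within_catw := @act_cont _ _ _ _ _ bE; apply; exact: fk.
Qed.

Lemma catw_gmul (Z : topologicalType) (D : set Z) z (f k : Z -> G) :
  D z -> (forall z, D z -> src (f z) = tgt (k z)) -> catw D f z -> catw D k z ->
  catw D (fun z => f z ** k z) z.
Proof.
move=> Dz fk cf ck; apply: (catw_comp (D' := [set q : G * G | src q.1 = tgt q.2])
  (f := fun z => (f z, k z)) (g := fun q => q.1 ** q.2)) => //; first exact: catw_pair.
by have /within_catw := @gmul_cont _ _ Gd; apply; exact: fk.
Qed.

Lemma catw_sigma (Z : topologicalType) (D : set Z) z (f k : Z -> G) :
  D z -> (forall z, D z -> src (f z) = tgt (k z)) -> catw D f z -> catw D k z ->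
  catw D (fun z => sigma (f z) (k z)) z.
Proof.
move=> Dz fk cf ck; apply: (catw_comp (D' := [set q : G * G | src q.1 = tgt q.2])
  (f := fun z => (f z, k z)) (g := fun q => sigma q.1 q.2)) => //; first exact: catw_pair.
by have /within_catw := Hsigma.1; apply; exact: fk.
Qed.

(** The inverse b0 at [z0] is lifted to an approximate inverse b in nearby fibers, with |1 - a b| <
    1/2 for a the value of [f]. From i - b = i (1 - a b) with i the true inverse, |i| <= |b| + |i| /
    2. *)
Lemma ainv_locally_bounded (Z : topologicalType) (D : set Z) z0 (f : Z -> A) :
  D z0 -> (forall z, D z -> ainvertible bA (f z)) -> catw D f z0 ->
  exists C : R, 0 <= C /\ \forall z \near z0, D z -> bnorm bA (ainv bA (f z)) <= C.
Proof.
move=> Dz0 fi cf; have [p1 [p2 p3]] := ainvP (fi z0 Dz0).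
set b0 := ainv bA (f z0) in p1 p2 p3.
exists (2 * (bnorm bA b0 + 1)); split.
  by rewrite mulr_ge0// addr_ge0// bnorm_ge0.
have : catw [set q : A * A | pA q.1 = pA q.2]
    (fun q => bdist bA (aone bA (pA q.1)) (amul bA q.1 q.2)) (f z0, b0).
  apply: catw_bdist.
  - by rewrite /= p1.
  - by move=> [a b] /= ab; rewrite bproj_one bproj_mul.
  - apply: (catw_comp (D' := setT) (f := fun q : A * A => pA q.1) (g := aone bA)) => //.
      by apply: continuous_catw; apply: continuous_comp; [exact: cvg_fst|exact: bproj_cont].
    by apply: continuous_catw; exact: aone_cont.
  - apply: catw_amul => //=; apply: continuous_catw; [exact: cvg_fst|exact: cvg_snd].
move=> /(catw_lt (r := 1 / 2)); rewrite /= p2 bdistxx => /(_ ltac:(lra)).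
move=> [[N W] /= [nN nW] HNW].
pose W' := [set b | bnorm bA b < bnorm bA b0 + 1].
have nW' : nbhs b0 W'.
  apply: (@bnorm_cont _ _ _ bA b0 [set r | r < bnorm bA b0 + 1]).
  by apply: open_nbhs_nbhs; split; [exact: open_lt|rewrite /= ltrDl].
have h1 : \forall z \near z0, D z -> N (f z) by move/catwP : cf; exact.
have h2 : \forall z \near z0, D z -> (pA @` (W `&` W')) (pA (f z)).
  have := catw_bproj (bE := bA) cf; move/catwP; apply.
  by rewrite -p1; apply: near_lift; exact: filterI.
move: h1 h2; apply: filterS2 => z Nz Lz Dz.
have [b [Wb W'b] pb] := Lz Dz; have [q1 [q2 q3]] := ainvP (fi z Dz).
set i := ainv bA (f z) in q1 q2 q3 *.
have hd : bdist bA (aone bA (pA (f z))) (amul bA (f z) b) < 1 / 2.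
  by apply: (HNW (f z, b)) => //=; split => //; exact: Nz.
have e1 : bsub bA i b = amul bA i (bsub bA (aone bA (pA (f z))) (amul bA (f z) b)).
  have pm : pA (amul bA (f z) b) = pA (f z) by rewrite bproj_mul// pb.
  rewrite /bsub amulDr ?q1 ?bproj_one ?bproj_scale ?pm// amulZr ?q1 ?pm// amulA ?q1 ?pb//.
  by rewrite q3 -q1 amul1r q1 -pb amul1l.
have h3 := bnorm_le_dist (bE := bA) (e := i) (e' := b); rewrite q1 pb in h3.
have {}h3 := h3 erefl; rewrite /bdist e1 in h3.
have h4 : bnorm bA (amul bA i (bsub bA (aone bA (pA (f z))) (amul bA (f z) b))) <= bnorm bA i * (1 / 2).
  apply: le_trans (anormM _) _.
    by rewrite bproj_sub bproj_one ?q1// bproj_mul// pb.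
  by apply: ler_wpM2l; [exact: bnorm_ge0|exact: ltW].
have h5 : bnorm bA b < bnorm bA b0 + 1 by [].
lra.
Qed.

(** * Inverting an almost representation; the integrand [xi] *)

Section Operators.
Variables (T : G -> E -> E) (HT : pseudorep Gd bE T) (HTA : A_linear gA bE T).

Lemma pseudorep_linear g : fiber_linear bE (src g) (tgt g) (T g).
Proof.
have [Tp [TD [TZ _]]] := HT.
by split=> [e pe|e e' pe pe'|k e pe]; [exact: Tp|exact: TD|exact: TZ].
Qed.

Lemma pseudorep_proj g e : p e = src g -> p (T g e) = tgt g.
Proof. by have [Tp _ _] := pseudorep_linear g; exact: Tp. Qed.

Lemma pseudorep_catw g e : p e = src g ->
  catw [set q : G * E | src q.1 = p q.2] (fun q => T q.1 q.2) (g, e).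
Proof.
move=> pe; have [_ [_ [_ /within_catw/(_ (g, e) (esym pe))]]] := HT.
move=> cT; apply: (catw_comp (D' := setT) (g := snd)) cT _ => //.
by apply: continuous_catw; exact: cvg_snd.
Qed.

Lemma catw_pseudorep (Z : topologicalType) (D : set Z) z (f : Z -> G) (k : Z -> E) :
  D z -> (forall z, D z -> src (f z) = p (k z)) -> catw D f z -> catw D k z ->
  catw D (fun z => T (f z) (k z)) z.
Proof.
move=> Dz fk cf ck; apply: (catw_comp (D' := [set q : G * E | src q.1 = p q.2])
  (f := fun z => (f z, k z)) (g := fun q => T q.1 q.2)) => //.
  exact: catw_pair.
by apply: pseudorep_catw; rewrite fk.
Qed.

(** By continuity at the zero vector a tube of radius eps over a neighborhood is mapped to vectors
    of norm below 1; homogeneity turns this into the bound 2 / eps. *)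
Lemma pseudorep_locally_bounded (g0 : G) : exists C : R, 0 <= C /\
  \forall g \near g0, forall e, p e = src g -> bnorm bE (T g e) <= C * bnorm bE e.
Proof.
have T0 g : T g (bzero bE (src g)) = bzero bE (tgt g).
  by rewrite (fiber_linear_zero (pseudorep_linear g)).
have : catw [set q : G * E | src q.1 = p q.2] (fun q => bnorm bE (T q.1 q.2)) (g0, bzero bE (src g0)).
  apply: catw_bnorm; apply: pseudorep_catw; exact: bproj_zero.
move=> /(catw_lt (r := 1)); rewrite /= T0 bnorm_zero => /(_ ltr01).
move=> [[N W] /= [nN /zero_tube[U [eps [nU e0 UW]]]] HNW].
exists (2 / eps); split; first by rewrite divr_ge0// ltW.
have nU' : \forall g \near g0, U (src g) by exact: (@src_cont _ _ Gd).
move: nN nU'; apply: filterS2 => g Ng Ug e pe.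
have [ne0|] := eqVneq (bnorm bE e) 0.
  by rewrite (bnorm_eq0 ne0) pe T0 !bnorm_zero mulr0.
move=> ne; have n0 : 0 < bnorm bE e by rewrite lt_def ne bnorm_ge0.
pose k := eps / 2 / bnorm bE e.
have k0 : 0 < k by rewrite !divr_gt0.
have ke : bnorm bE (bscale bE k e) = eps / 2 by rewrite bnormZ gtr0_norm// divfK.
have := HNW (g, bscale bE k e); rewrite /= bproj_scale => H.
have [_ _ TZ] := pseudorep_linear g.
have {H} : bnorm bE (T g (bscale bE k e)) < 1.
  by apply: H => //; split => //; apply: UW; rewrite ?bproj_scale ?pe// ke; lra.
rewrite TZ// bnormZ gtr0_norm// mulrC -ltr_pdivlMr// div1r => /ltW h; apply: le_trans h _.
by rewrite /k invf_div invf_div mulrC.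
Qed.

Lemma orbit_src x g : Defs.orbit Gd x (tgt g) -> Defs.orbit Gd x (src g).
Proof.
move=> [k [sk tk]]; exists (g^! ** k); split; first by rewrite src_gmul ?src_ginv.
by rewrite tgt_gmul ?src_ginv// tgt_ginv.
Qed.

(** The condition r(T, x) <= r in real inequalities: [r1] bounds the defect at units, [r2] the
    weighted multiplicative defect. *)
Definition approx_rep (x : X) (r : R) (T : G -> E -> E) := exists r1 r2 : R,
  [/\ 0 <= r1, 0 <= r2, r1 + r2 <= r,
    forall y e, Defs.orbit Gd x y -> p e = y -> bdist bE e (T (unt Gd y) e) <= r1 * bnorm bE e &
    forall g h e, Defs.orbit Gd x (tgt g) -> tgt h = src g -> p e = src h ->
      ell Gd bA sigma g * bdist bE (act bE (sigma g h) (T (g ** h) e)) (T g (T h e))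
        <= r2 * bnorm bE e].

Definition bounded_rep (x : X) (b : R) (T : G -> E -> E) :=
  forall g e, Defs.orbit Gd x (tgt g) -> p e = src g ->
    ell Gd bA sigma g * bnorm bE (T g e) <= b * bnorm bE e.

(** The defect at the pair h, h^-1 is multiplied by [sinv h], whose norm is absorbed by the weight
    [ell]; this turns sigma(h,h^-1) T(h h^-1) into T at a unit, which is close to the identity. *)
Lemma approx_rep_right_inverse x r h e : approx_rep x r T -> Defs.orbit Gd x (tgt h) -> p e = tgt h ->
  bdist bE e (act bE (sinv h) (T h (T h^! e))) <= r * bnorm bE e.
Proof.
move=> [r1 [r2 [r10 r20 r12 H1 H2]]] oh pe.
have hh : src h = tgt h^! by rewrite tgt_ginv.
have [p1 p2 p3] := sinvP h.
have pT1 : p (T (unt Gd (tgt h)) e) = tgt h by rewrite pseudorep_proj ?tgt_unt// src_unt.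
have pTT : p (T h (T h^! e)) = tgt h by rewrite !pseudorep_proj// src_ginv.
have e1 : T (unt Gd (tgt h)) e = act bE (sinv h) (act bE (sigma h h^!) (T (h ** h^!) e)).
  by rewrite gmulV -actM ?p1 ?p3 ?sigma_proj// act1E.
apply: (@le_trans _ _ (r1 * bnorm bE e + r2 * bnorm bE e)); last first.
  by rewrite -mulrDl; apply: ler_wpM2r => //; exact: bnorm_ge0.
apply: le_trans (bdist_triangle (e2 := T (unt Gd (tgt h)) e) _ _) _.
- by rewrite pT1.
- by rewrite bproj_act ?p1 ?pTT ?pT1.
apply: lerD; first exact: H1.
have pa : p (act bE (sigma h h^!) (T (h ** h^!) e)) = tgt h.
  by rewrite gmulV; apply: bproj_actE; rewrite ?sigma_proj ?pT1.
rewrite e1; apply: le_trans (act_dist _ _) _; rewrite ?p1 ?pa ?pTT//.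
apply: le_trans (H2 h h^! e oh _ _); rewrite ?tgt_ginv ?src_ginv//.
by apply: ler_wpM2r; [exact: bdist_ge0|exact: norm_sinv_le].
Qed.

Lemma fiber_solve (y : X) (F : E -> E) r e : fiber_linear bE y y F -> 0 <= r < 1 ->
  (forall e, p e = y -> bdist bE e (F e) <= r * bnorm bE e) -> p e = y ->
  exists w, [/\ p w = y, F w = e & bnorm bE w <= bnorm bE e / (1 - r)].
Proof.
move=> lF r01 H /liftE[u ->]; have [Fp FD FZ] := lF.
pose F' (u : fiber bE y) := tofiber bE y (F (fval u)).
have F'E v : fval (F' v) = F (fval v) by rewrite tofiberK// Fp// fvalP.
have [||w [Fw nw]] := @neumann_solve _ _ F' r u (@fiber_complete _ _ _ bE y) r01.
- by move=> v w; apply: fval_inj; rewrite F'E -!fvalB !F'E (fiber_linear_sub lF)// fvalP.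
- by move=> v; rewrite -!fval_norm -fvalB F'E; apply: H; rewrite fvalP.
by exists (fval w); split; [exact: fvalP|rewrite -F'E Fw|exact: nw].
Qed.

(** The operator sinv(h) T(h) T(h^-1) is within r < 1 of the identity, hence can be solved with
    right-hand side sinv(h) e; multiplying by sigma(h,h^-1) removes [sinv]. *)
Lemma approx_rep_solve x r h e : approx_rep x r T -> r <= 1 / 4 -> Defs.orbit Gd x (tgt h) ->
  p e = tgt h -> exists w, [/\ p w = tgt h, T h (T h^! w) = e &
    bnorm bE w <= ell Gd bA sigma h * bnorm bE e / (1 - r)].
Proof.
move=> aT r4 oh pe; have [p1 p2 p3] := sinvP h.
have hh : src h = tgt h^! by rewrite tgt_ginv.
have r0 : 0 <= r by have [r1 [r2 [? ? ? _ _]]] := aT; lra.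
have lTT : fiber_linear bE (tgt h) (tgt h) (fun e => T h (T h^! e)).
  have := pseudorep_linear h^!; rewrite src_ginv tgt_ginv => l1.
  exact: fiber_linear_comp l1 (pseudorep_linear h).
have lF : fiber_linear bE (tgt h) (tgt h) (fun e => act bE (sinv h) (T h (T h^! e))).
  by have := act_linear (sinv h); rewrite p1; exact: fiber_linear_comp.
have [|||w [pw Fw nw]] := @fiber_solve (tgt h) _ r (act bE (sinv h) e) lF.
- by apply/andP; split => //; lra.
- by move=> e' pe'; exact: (approx_rep_right_inverse aT).
- by rewrite bproj_act ?p1.
have pTT : p (T h (T h^! w)) = tgt h by case: lTT => + _ _; apply.
exists w; split => //.
  have := congr1 (act bE (sigma h h^!)) Fw.
  by rewrite -!actM ?p1 ?sigma_proj// p2 !act1E.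
apply: le_trans nw _; apply: ler_wpM2r; first by rewrite invr_ge0; lra.
apply: le_trans (act_norm _) _; first by rewrite p1.
by apply: ler_wpM2r; [exact: bnorm_ge0|exact: norm_sinv_le].
Qed.

(** The right-inverse estimate at the inverse arrow says that sinv(h^-1) T(h^-1) T(h) is within r of
    the identity of the source fiber, so a vector d killed by T(h) satisfies |d| <= r |d|. *)
Lemma approx_rep_injective x r h f f' : approx_rep x r T -> r <= 1 / 4 -> Defs.orbit Gd x (tgt h) ->
  p f = src h -> p f' = src h -> T h f = T h f' -> f = f'.
Proof.
move=> aT r4 oh pf pf' ff'; have osh : Defs.orbit Gd x (tgt h^!) by rewrite tgt_ginv; exact: orbit_src.
apply: (bdist_eq0 (bE := bE)); first by rewrite pf.
have pd : p (bsub bE f f') = src h by rewrite bproj_sub pf.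
have Td : T h (bsub bE f f') = bzero bE (tgt h).
  have pT : p (T h f') = tgt h by rewrite pseudorep_proj.
  rewrite (fiber_linear_sub (pseudorep_linear h))// ff'.
  by have [u ->] := liftE pT; rewrite fvalB subrr fval0.
have := approx_rep_right_inverse (h := h^!) (e := bsub bE f f') aT osh; rewrite tgt_ginv => /(_ pd).
have [p1 _ _] := sinvP h^!; rewrite tgt_ginv in p1.
rewrite ginvK Td -(src_ginv Gd h) (fiber_linear_zero (pseudorep_linear _)) tgt_ginv.
rewrite -p1 (fiber_linear_zero (act_linear _)) p1 -pd bdist_zero => h1; rewrite /bdist.
have : r * bnorm bE (bsub bE f f') <= 1 / 4 * bnorm bE (bsub bE f f').
  by apply: ler_wpM2r => //; exact: bnorm_ge0.
by have := bnorm_ge0 bE (bsub bE f f'); lra.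
Qed.

Definition tinv h e : E := xget (bzero bE (src h)) [set f | p f = src h /\ T h f = e].

Hypothesis Tapprox : forall x, exists r, r <= 1 / 4 /\ approx_rep x r T.

Lemma orbit_refl x : Defs.orbit Gd x x.
Proof. by exists (unt Gd x); rewrite src_unt tgt_unt. Qed.

Lemma tinv_spec h e : p e = tgt h -> p (tinv h e) = src h /\ T h (tinv h e) = e.
Proof.
move=> pe; have [r [r4 aT]] := Tapprox (tgt h).
have [w [pw Tw _]] := approx_rep_solve aT r4 (orbit_refl _) pe.
rewrite /tinv; case: xgetP => [f -> //|/(_ (T h^! w))]; case.
by split => //; rewrite pseudorep_proj ?tgt_ginv// src_ginv.
Qed.

Lemma tinv_proj h e : p e = tgt h -> p (tinv h e) = src h.
Proof. by case/tinv_spec. Qed.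

Lemma tinvK h e : p e = tgt h -> T h (tinv h e) = e.
Proof. by case/tinv_spec. Qed.

Lemma tinv_uniq h f e : p f = src h -> T h f = e -> tinv h e = f.
Proof.
move=> pf Tf; have pe : p e = tgt h by rewrite -Tf pseudorep_proj.
have [r [r4 aT]] := Tapprox (tgt h).
by apply: (approx_rep_injective aT r4 (orbit_refl _)); rewrite ?tinv_proj ?tinvK.
Qed.

Lemma tinv_rep h e w : p w = tgt h -> T h (T h^! w) = e -> tinv h e = T h^! w.
Proof. by move=> pw; apply: tinv_uniq; rewrite pseudorep_proj ?tgt_ginv// src_ginv. Qed.

Lemma tinv_linear h : fiber_linear bE (tgt h) (src h) (tinv h).
Proof.
have [Tp TD TZ] := pseudorep_linear h; split.
- exact: tinv_proj.
- move=> e e' pe pe'; apply: tinv_uniq.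
    by rewrite bproj_add !tinv_proj.
  by rewrite TD ?tinv_proj// !tinvK.
- move=> k e pe; apply: tinv_uniq; first by rewrite bproj_scale tinv_proj.
  by rewrite TZ ?tinv_proj// tinvK.
Qed.

Lemma tinv_act h a e : pA a = src h -> p e = tgt h ->
  tinv h (act bE (gact gA h a) e) = act bE a (tinv h e).
Proof.
move=> pa pe; apply: tinv_uniq; first by apply: bproj_actE; rewrite ?tinv_proj.
by rewrite HTA ?tinv_proj// tinvK.
Qed.

(** The inverse is T(h^-1) w with |w| <= ell(h) |e| / (1 - r), and the weight cancels against
    ell(h^-1) |T(h^-1) w| <= b |w|. *)
Lemma tinv_norm_le h e x r b : approx_rep x r T -> r <= 1 / 4 -> bounded_rep x b T ->
  Defs.orbit Gd x (tgt h) -> p e = tgt h -> bnorm bE (tinv h e) <= b / (1 - r) * bnorm bE e.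
Proof.
move=> aT r4 bT oh pe; have [w [pw Tw nw]] := approx_rep_solve aT r4 oh pe.
rewrite (tinv_rep pw Tw).
have := bT h^! w; rewrite tgt_ginv src_ginv ell_ginv => /(_ (orbit_src oh) pw) H.
have l0 := ell_gt0 h.
have b0 : 0 <= b * bnorm bE w by apply: le_trans H; rewrite mulr_ge0// ?bnorm_ge0// ltW.
have r1' : 0 < 1 - r by lra.
(* Nonnegativity of [b] is extracted from its bound at a nonzero [w]; if [w] vanishes, so do both
   sides. *)
have [w00|wn0] := eqVneq (bnorm bE w) 0.
  have -> : bnorm bE (T h^! w) = 0.
    apply/eqP; rewrite eq_le bnorm_ge0 andbT -(pmulr_rle0 _ l0).
    by rewrite w00 mulr0 in H.
  have -> : bnorm bE e = 0; last by rewrite mulr0.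
  have w0E : w = bzero bE (tgt h) by rewrite (bnorm_eq0 w00) pw.
  rewrite -Tw w0E -(src_ginv Gd h) (fiber_linear_zero (pseudorep_linear h^!)) tgt_ginv.
  by rewrite (fiber_linear_zero (pseudorep_linear h)) bnorm_zero.
have wp : 0 < bnorm bE w by rewrite lt_def wn0 bnorm_ge0.
have {}b0 : 0 <= b by rewrite -(pmulr_lge0 _ wp).
rewrite -(ler_pM2l l0); apply: le_trans H _.
apply: le_trans (ler_wpM2l b0 nw) _.
by rewrite le_eqVlt; apply/orP; left; apply/eqP; ring.
Qed.

(** The orbitwise constant b need not be locally bounded. Instead the local bounds for T(h^-1) and
    for sigma(h,h^-1)^-1 are combined with 1 / (1 - r) <= 4/3. *)
Lemma tinv_locally_bounded (h0 : G) : exists C : R, 0 < C /\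
  \forall h \near h0, forall e, p e = tgt h -> bnorm bE (tinv h e) <= C * bnorm bE e.
Proof.
have [C1 [C10 H1]] := pseudorep_locally_bounded h0^!.
have cs : catw setT (fun h => sigma h h^!) h0.
  apply: catw_sigma => //; first by move=> h _; rewrite tgt_ginv.
    by apply: continuous_catw; exact: cvg_id.
  by apply: continuous_catw; exact: ginv_cont.
have [||C2 [C20 H2]] := ainv_locally_bounded _ _ cs => //.
  by move=> h _; apply: sigma_invertible; rewrite tgt_ginv.
exists (C1 * (4 / 3) * (C2 + 1) + 1); split; first by rewrite ltr_wpDl// !mulr_ge0// ?addr_ge0//; lra.
have H1' : \forall h \near h0, forall e, p e = src h^! -> bnorm bE (T h^! e) <= C1 * bnorm bE e.
  exact: (@ginv_cont _ _ Gd h0 _ H1).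
move: H1' H2; apply: filterS2 => h H1h /(_ I) H2h e pe.
have [r [r4 aT]] := Tapprox (tgt h).
have [w [pw Tw nw]] := approx_rep_solve aT r4 (orbit_refl _) pe.
rewrite (tinv_rep pw Tw).
have r0 : 0 <= r by have [r1 [r2 [? ? ? _ _]]] := aT; lra.
have lC : ell Gd bA sigma h <= C2 + 1.
  by rewrite /ell ge_max; apply/andP; split; [lra|apply: le_trans H2h _; lra].
have n0 := bnorm_ge0 bE e.
have nw' : bnorm bE w <= 4 / 3 * ((C2 + 1) * bnorm bE e).
  apply: le_trans nw _; rewrite mulrC; apply: ler_pM.
  - by rewrite invr_ge0; lra.
  - by rewrite mulr_ge0// ltW// ell_gt0.
  - by rewrite -[4 / 3]invf_div lef_pV2 ?posrE; lra.
  - exact: ler_wpM2r.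
apply: le_trans (H1h w _) _; first by rewrite src_ginv.
apply: le_trans (ler_wpM2l C10 nw') _.
apply: (@le_trans _ _ (C1 * (4 / 3) * (C2 + 1) * bnorm bE e)); first by rewrite -!mulrA.
by rewrite [leRHS]mulrDl mul1r lerDl.
Qed.

(** A lift e' of a nearby source point close to the inverse image at [z0] is mapped by T close to
    [k z]; the local bound of the inverse transports this closeness back to the source fiber. *)
Lemma catw_tinv (Z : topologicalType) (D : set Z) z0 (f : Z -> G) (k : Z -> E) :
  D z0 -> (forall z, D z -> p (k z) = tgt (f z)) -> catw D f z0 -> catw D k z0 ->
  catw D (fun z => tinv (f z) (k z)) z0.
Proof.
move=> Dz0 fk cf ck; apply: (catw_approx (bE := bE)) => //.
  apply: (catw_eq (f := fun z => src (f z))) => //.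
    by move=> z Dz; rewrite tinv_proj// fk.
  apply: (catw_comp (D' := setT) (g := src)) => //; apply: continuous_catw; exact: src_cont.
move=> eps e0; have pk0 := fk _ Dz0; set e1 := tinv (f z0) (k z0).
have pe1 : p e1 = src (f z0) by exact: tinv_proj.
exists e1; split => //; first by rewrite bdistxx ltW.
move=> W nW; have [C [C0 HC]] := tinv_locally_bounded (f z0).
have : catw [set q : Z * E | D q.1 /\ p q.2 = src (f q.1)]
    (fun q => bdist bE (k q.1) (T (f q.1) q.2)) (z0, e1).
  have cfst (Y : topologicalType) (g : Z -> Y) : catw D g z0 ->
      catw [set q : Z * E | D q.1 /\ p q.2 = src (f q.1)] (fun q => g q.1) (z0, e1).
    move=> cg; apply: (catw_comp (D' := D) (f := fst)) => //; first by move=> q [].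
    by apply: continuous_catw; exact: cvg_fst.
  apply: catw_bdist => //.
  - by move=> q [/= Dq pq]; rewrite fk// pseudorep_proj.
  - exact: cfst.
  - apply: catw_pseudorep => //.
    + by move=> q [].
    + exact: cfst.
    + by apply: continuous_catw; exact: cvg_snd.
move=> /(catw_lt (r := eps / C)); rewrite /= tinvK// bdistxx => /(_ (divr_gt0 e0 C0)).
move=> [[N V] /= [nN nV] HNV].
have h1 : \forall z \near z0, D z -> (p @` (W `&` V)) (src (f z)).
  have : catw D (fun z => src (f z)) z0.
    apply: (catw_comp (D' := setT) (g := src)) => //; apply: continuous_catw; exact: src_cont.
  by move/catwP; apply; rewrite -pe1; apply: near_lift; exact: filterI.
have h2 : \forall z \near z0, D z -> forall e, p e = tgt (f z) ->
    bnorm bE (tinv (f z) e) <= C * bnorm bE e.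
  by have /catwP cf' := cf; exact: (cf' _ HC).
move: nN h1 h2; apply: filterS3 => z Nz Lz Bz Dz.
have [e' [We' Ve'] pe'] := Lz Dz; have pk := fk _ Dz.
exists e'; split => //; first by rewrite tinv_proj.
have pT : p (T (f z) e') = tgt (f z) by rewrite pseudorep_proj.
have {1}<- : tinv (f z) (T (f z) e') = e' by exact: tinv_uniq.
rewrite (fiber_linear_dist (tinv_linear _))//.
apply: le_trans (Bz Dz _ _) _; first by rewrite bproj_sub pk ?pT.
rewrite mulrC -ler_pdivlMr//; apply/ltW; exact: (HNV (z, e')).
Qed.

Definition xi (g : G) (e : E) (h : G) : E := act bE (sigma g h) (T (g ** h) (tinv h e)).

Lemma xi_linear g h : tgt h = src g -> fiber_linear bE (src g) (tgt g) (fun e => xi g e h).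
Proof.
move=> th; rewrite -th; apply: (@fiber_linear_comp _ _ _ _ _ (tgt g) _ (fun e => T (g ** h) (tinv h e))).
  apply: fiber_linear_comp (tinv_linear h) _.
  by have := pseudorep_linear (g ** h); rewrite src_gmul ?tgt_gmul.
by have := act_linear (sigma g h); rewrite sigma_proj.
Qed.

Lemma xi_proj g e h : p e = src g -> tgt h = src g -> p (xi g e h) = tgt g.
Proof. by move=> pe th; have [xp _ _] := xi_linear th; exact: xp. Qed.

Lemma catw_xi (Z : topologicalType) (D : set Z) z0 (f : Z -> G) (k : Z -> E) (l : Z -> G) :
  D z0 -> (forall z, D z -> p (k z) = src (f z) /\ tgt (l z) = src (f z)) ->
  catw D f z0 -> catw D k z0 -> catw D l z0 ->
  catw D (fun z => xi (f z) (k z) (l z)) z0.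
Proof.
move=> Dz0 H cf ck cl.
have H1 z : D z -> src (f z) = tgt (l z) by move=> /H[].
have H2 z : D z -> p (k z) = tgt (l z) by move=> /H[-> ->].
have H3 z : D z -> p (T (f z ** l z) (tinv (l z) (k z))) = tgt (f z).
  by move=> Dz; rewrite pseudorep_proj ?tgt_gmul ?src_gmul ?tinv_proj ?H1 ?H2.
apply: catw_act => //; first by move=> z Dz; rewrite sigma_proj ?H1// H3.
  exact: catw_sigma.
apply: catw_pseudorep => //.
- by move=> z Dz; rewrite src_gmul ?H1// tinv_proj// H2.
- exact: catw_gmul.
- exact: catw_tinv.
Qed.

(** Write a as the image under h of a'. Then a' passes through T(h)^-1 and T(gh), becoming the image
    of a under g, and commutes with sigma(g,h) because the latter is central. *)
Lemma xi_act g e h a : p e = src g -> tgt h = src g -> pA a = src g ->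
  xi g (act bE a e) h = act bE (gact gA g a) (xi g e h).
Proof.
move=> pe th pa; have pa' : pA a = src h^! by rewrite src_ginv th.
pose a' := gact gA h^! a.
have paa : pA a' = src h by rewrite /a' bproj_gact// tgt_ginv.
have aE : a = gact gA h a'.
  by rewrite /a' -gact_comp ?tgt_ginv// gmulV gact_unt// th.
have pt : p (tinv h e) = src h by rewrite tinv_proj// th.
have pga : pA (gact gA g a) = tgt g by rewrite bproj_gact.
rewrite /xi {1}aE tinv_act ?th// HTA ?src_gmul// gact_comp// -aE.
have pT : p (T (g ** h) (tinv h e)) = tgt g by rewrite pseudorep_proj ?tgt_gmul ?src_gmul.
by rewrite -!actM ?pga ?sigma_proj ?pT// sigma_central// sigma_proj.
Qed.

(** In xi(g, xi(h, e, k), hk) the factor T(hk)^-1 cancels T(hk), and by A-linearity sigma(h,k) comes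
    out as its image under g. What remains are the two sides of the cocycle identity for sigma. *)
Lemma xi_cocycle g h k e : src g = tgt h -> src h = tgt k -> p e = src h ->
  act bE (sigma g h) (xi (g ** h) e k) = xi g (xi h e k) (h ** k).
Proof.
move=> gh hk pe; have pt : p (tinv k e) = src k by rewrite tinv_proj// pe.
have ph : p (T (h ** k) (tinv k e)) = tgt h by rewrite pseudorep_proj ?tgt_gmul ?src_gmul.
have psk : pA (sigma h k) = tgt h by rewrite sigma_proj.
have tE : tinv (h ** k) (T (h ** k) (tinv k e)) = tinv k e.
  by apply: tinv_uniq; rewrite ?src_gmul.
have -> : xi g (xi h e k) (h ** k) =
    act bE (gact gA g (sigma h k)) (xi g (T (h ** k) (tinv k e)) (h ** k)).
  by rewrite {1}/xi -/(xi h e k) {1}/xi; apply: xi_act; rewrite ?tgt_gmul ?ph ?psk.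
rewrite /xi tE gmulA//.
have pT : p (T (g ** h ** k) (tinv k e)) = tgt g.
  by rewrite pseudorep_proj ?tgt_gmul ?src_gmul.
have pg : pA (gact gA g (sigma h k)) = tgt g by rewrite bproj_gact ?psk.
rewrite -!actM ?pT ?pg ?sigma_proj ?tgt_gmul ?src_gmul//.
by rewrite Hsigma.2.2.2.
Qed.

End Operators.

End TwistedGroupoid.

(** * One averaging step *)

Section Averaging.
Variables (R : realType) (X : topologicalType) (G : ptopologicalType)
  (A E : topologicalType) (Gd : top_groupoid X G)
  (hG : hausdorff_space G) (lcG : locally_compact [set: G]) (mu : haar_system R Gd)
  (c : X -> R) (cutc : cutoff Gd c)
  (bA : banach_alg_bundle R X A) (gA : alg_G_bundle Gd bA)
  (bE : banach_module_bundle bA E)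
  (sigma : G -> G -> A) (Hsigma : multiplier gA sigma).
Local Notation src := (src Gd).
Local Notation tgt := (tgt Gd).
Local Notation p := (bproj bE).
Local Notation pA := (bproj bA).
Local Notation "g ** h" := (gmul Gd g h) (at level 40, left associativity).
Local Notation ell := (ell Gd bA sigma).
Local Notation approx_rep := (approx_rep Gd bE sigma).
Local Notation bounded_rep := (bounded_rep Gd bE sigma).

Definition average (T : G -> E -> E) (g : G) (e : E) : E :=
  bint mu c bE (src g) (tgt g) (xi Gd bE sigma T g e).

Section OneStep.
Variables (T : G -> E -> E) (HT : pseudorep Gd bE T) (HTA : A_linear gA bE T).
Hypothesis Tapprox : forall x, exists r, r <= 1 / 4 /\ approx_rep x r T.
Local Notation xi := (xi Gd bE sigma T).
Local Notation tinv := (tinv Gd bE T).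
Local Notation T' := (average T).

Lemma xi_integrable g e : p e = src g -> bintegrable Gd c bE (src g) (tgt g) (xi g e).
Proof.
move=> pe; apply: (continuous_bintegrable hG lcG mu cutc) => h th.
  exact: (xi_proj Hsigma HT Tapprox).
apply: (catw_xi Hsigma HT Tapprox) => //; apply: continuous_catw;
  [exact: cst_continuous|exact: cst_continuous|exact: cvg_id].
Qed.

Lemma average_linear g : fiber_linear bE (src g) (tgt g) (T' g).
Proof.
have xl h : carrier Gd c (src g) h -> fiber_linear bE (src g) (tgt g) (fun e => xi g e h).
  by move=> [th _]; exact: (xi_linear Hsigma HT Tapprox).
split=> [e pe|e e' pe pe'|k e pe]; first exact: bproj_bint.
- rewrite /average -(bint_add hG mu cutc (xi_integrable pe) (xi_integrable pe')).2.
  by apply: (eq_bint _ _ _ _).2 => h /xl[_ xD _]; rewrite xD.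
- have [|_ <-] := @bint_linear _ _ _ _ hG mu _ cutc _ bE (src g) _ _ _ `|k| _
    (fiber_linear_scale bE (tgt g) k) _ (xi_integrable pe).
    by move=> u _; rewrite bnormZ.
  by apply: (eq_bint _ _ _ _).2 => h /xl[_ _ xZ]; rewrite xZ.
Qed.

Lemma pseudorep_average : pseudorep Gd bE T'.
Proof.
split; first by move=> g; have [] := average_linear g.
split; first by move=> g; have [] := average_linear g.
split; first by move=> g; have [] := average_linear g.
apply/within_catw => -[g0 e0] /= pe0.
apply: catw_pair; first by apply: continuous_catw; exact: cvg_fst.
have cfst (Y : topologicalType) (f : G -> Y) : continuous f ->
    catw [set q : G * E | src q.1 = p q.2] (fun q => f q.1) (g0, e0).
  move=> cf; apply: (catw_comp (D' := setT) (f := fst)) => //.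
    by apply: continuous_catw; exact: cvg_fst.
  by apply: continuous_catw; exact: cf.
apply: (catw_bint hG lcG cutc (x := fun q : G * E => src q.1) (y := fun q => tgt q.1)
  (xi := fun q => xi q.1 q.2)) => //.
- by apply: cfst; exact: src_cont.
- by apply: cfst; exact: tgt_cont.
- by move=> [g e] h /= ge th; apply: (xi_proj Hsigma HT Tapprox).
move=> [g e] h /= ge th.
apply: (catw_xi Hsigma HT Tapprox (f := fun q : G * E * G => q.1.1)
  (k := fun q => q.1.2) (l := fun q => q.2)) => //=.
- by move=> [[g' e'] h'] /= [].
- by apply: continuous_catw; apply: continuous_comp; [exact: cvg_fst|exact: cvg_fst].
- by apply: continuous_catw; apply: continuous_comp; [exact: cvg_fst|exact: cvg_snd].
- by apply: continuous_catw; exact: cvg_snd.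
Qed.

Lemma A_linear_average : A_linear gA bE T'.
Proof.
move=> g a e pa pe; have pga : pA (gact gA g a) = tgt g by rewrite bproj_gact.
have la : fiber_linear bE (tgt g) (tgt g) (act bE (gact gA g a)).
  by have := act_linear bE (gact gA g a); rewrite pga.
have [|_ <-] := bint_linear hG mu cutc (C := bnorm bA (gact gA g a)) la _ (xi_integrable pe).
  by move=> u pu; apply: act_norm; rewrite pga.
by apply: (eq_bint _ _ _ _).2 => h [th _]; exact: (xi_act Hsigma HT HTA Tapprox).
Qed.

(** At a unit the integrand is T(h) T(h)^-1 e, constantly e; so the unit defect is gone after one
    averaging step. *)
Lemma average_unit x e : p e = x -> T' (unt Gd x) e = e.
Proof.
move=> pe; apply: (bint_cst hG mu cutc _ _).2; first by rewrite tgt_unt.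
move=> h [th _]; rewrite src_unt in th.
rewrite /xi (sigma_unit Hsigma); [|by rewrite src_unt|by left; exists x].
have pe' : p e = tgt h by rewrite th.
rewrite -{2}th gmul_untl (tinvK Hsigma HT Tapprox pe') tgt_unt; exact: act1E.
Qed.

Section Estimates.
Variables (x : X) (r : R).
Hypotheses (r0 : 0 <= r) (r4 : r <= 1 / 4) (aT : approx_rep x r T).

(** Substituting e = T(h) f turns the deviation of [xi] from T(g) into the multiplicative defect at
    the pair g, h applied to f. *)
Lemma approx_rep_xi g h e f : Defs.orbit Gd x (tgt g) -> tgt h = src g -> p e = src g ->
  tinv h e = f -> ell g * bdist bE (xi g e h) (T g e) <= r * bnorm bE f.
Proof.
move=> og th pe tf; have [r1 [r2 [r10 r20 r12 _ H2]]] := aT.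
have pe' : p e = tgt h by rewrite th.
have ptf : p f = src h by rewrite -tf (tinv_proj Hsigma HT Tapprox pe').
have eE : T h f = e by rewrite -tf (tinvK Hsigma HT Tapprox pe').
rewrite /xi tf -eE; apply: le_trans (H2 g h f og th ptf) _.
by apply: ler_wpM2r; [exact: bnorm_ge0|lra].
Qed.

Lemma average_exact g e : r = 0 -> Defs.orbit Gd x (tgt g) -> p e = src g -> T' g e = T g e.
Proof.
move=> r00 og pe; apply: (bint_cst hG mu cutc _ _).2; first exact: (pseudorep_proj HT).
move=> h [th _]; apply: (bdist_eq0 (bE := bE)).
  by rewrite (xi_proj Hsigma HT Tapprox)// (pseudorep_proj HT).
rewrite -(pmulr_rle0 _ (ell_gt0 Gd bA sigma g)).
by apply: le_trans (approx_rep_xi og th pe erefl) _; rewrite r00 mul0r.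
Qed.

Variable b : R.
Hypotheses (b0 : 0 <= b) (bT : bounded_rep x b T).
Local Notation d := (r * b / (1 - r)).

Lemma subr_gt0_quarter : 0 < 1 - r.
Proof. by rewrite subr_gt0; apply: le_lt_trans r4 _; rewrite ltr_pdivrMr// mul1r ltr1n. Qed.

Lemma d_ge0 : 0 <= d.
Proof. by rewrite divr_ge0 ?mulr_ge0// ltW// subr_gt0_quarter. Qed.

Lemma xi_dist g h e : Defs.orbit Gd x (tgt g) -> tgt h = src g -> p e = src g ->
  ell g * bdist bE (xi g e h) (T g e) <= d * bnorm bE e.
Proof.
move=> og th pe; apply: le_trans (approx_rep_xi og th pe erefl) _.
rewrite -!mulrA; apply: ler_wpM2l => //; rewrite mulrA.
apply: (tinv_norm_le Hsigma HT Tapprox aT r4 bT); rewrite th//; exact: orbit_src.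
Qed.

Lemma le_of_ell g u v : ell g * u <= v -> 0 <= u -> u <= v.
Proof.
by move=> h u0; apply: le_trans h; rewrite -{1}(mul1r u); apply: ler_wpM2r => //; exact: ell_ge1.
Qed.

Lemma average_dist g e : Defs.orbit Gd x (tgt g) -> p e = src g ->
  ell g * bdist bE (T' g e) (T g e) <= d * bnorm bE e.
Proof.
move=> og pe; have pT : p (T g e) = tgt g by rewrite (pseudorep_proj HT).
have [ic vc] := bint_cst hG mu cutc (x := src g) pT (xi := fun=> T g e) (fun _ _ => erefl).
rewrite mulrC -ler_pdivlMr ?ell_gt0// -{1}vc.
apply: (bint_dist hG mu cutc (xi_integrable pe) ic) => h [th _].
by rewrite ler_pdivlMr ?ell_gt0// mulrC; exact: xi_dist.
Qed.

(** The constant is b + d = b + r b / (1 - r). *)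
Lemma bounded_rep_average : bounded_rep x (b / (1 - r)) T'.
Proof.
move=> g e og pe; have pT : p (T g e) = tgt g by rewrite (pseudorep_proj HT).
have := bnorm_le_dist (bE := bE) (e := T' g e) (e' := T g e).
rewrite bproj_bint pT => /(_ erefl) h1.
have h2 := average_dist og pe; have h3 := bT og pe.
apply: le_trans (ler_wpM2l (ltW (ell_gt0 Gd bA sigma g)) h1) _.
rewrite mulrDr; apply: le_trans (lerD h3 h2) _.
rewrite -mulrDl le_eqVlt; apply/orP; left; apply/eqP; congr (_ * _).
by field; rewrite gt_eqF// subr_gt0_quarter.
Qed.

(* With [X k f = xi g f (h ** k)] and [Y k = xi h e k], the two terms are the means of
   [X k (Y k)] and of [X k y], where [y] is the mean of [Y]. *)
Lemma average_multiplicative g h e : Defs.orbit Gd x (tgt g) -> tgt h = src g -> p e = src h ->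
  ell g * bdist bE (act bE (sigma g h) (T' (g ** h) e)) (T' g (T' h e)) <=
    2 * d ^+ 2 * bnorm bE e.
Proof.
move=> og th pe; set y := T' h e.
have py : p y = src g by rewrite /y bproj_bint.
have pg : pA (sigma g h) = tgt g by rewrite (sigma_proj Hsigma).
have pgh : p e = src (g ** h) by rewrite src_gmul.
have [tgh sgh] : tgt (g ** h) = tgt g /\ src (g ** h) = src h by rewrite tgt_gmul ?src_gmul.
have lsg : fiber_linear bE (tgt g) (tgt g) (act bE (sigma g h)).
  by have := act_linear bE (sigma g h); rewrite pg.
have iT' : bintegrable Gd c bE (src h) (tgt g) (xi (g ** h) e).
  by have := xi_integrable pgh; rewrite tgh sgh.
have [|iS vS] := bint_linear hG mu cutc (C := bnorm bA (sigma g h)) lsg _ iT'.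
  by move=> u pu; apply: act_norm; rewrite pg.
have eXY k : carrier Gd c (src h) k ->
    act bE (sigma g h) (xi (g ** h) e k) = xi g (xi h e k) (h ** k).
  by move=> [tk _]; apply: (xi_cocycle Hsigma HT HTA Tapprox).
have [iXY vXY] := eq_bint mu bE (tgt g) eXY; have {}iXY := iXY iS.
have iXy : bintegrable Gd c bE (tgt h) (tgt g) (xi g y) by rewrite th; exact: xi_integrable.
have [iX vX] := bint_translate hG mu cutc iXy.
have [C [C0 /nbhs_singleton HC]] := pseudorep_locally_bounded HT g.
have lT : fiber_linear bE (tgt h) (tgt g) (T g) by rewrite th; exact: (pseudorep_linear HT).
have [|iTY vTY] := bint_linear hG mu cutc (C := C) lT _ (xi_integrable pe).
  by move=> u pu; apply: HC; rewrite pu.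
have pTy : p (T g y) = tgt g by rewrite (pseudorep_proj HT).
have [iTy vTy] := bint_cst hG mu cutc (x := src h) pTy (xi := fun=> T g y) (fun _ _ => erefl).
have [iP vP] := bint_sub hG mu cutc iXY iX.
have [iQ vQ] := bint_sub hG mu cutc iTY iTy.
have e1 : bint mu c bE (src h) (tgt g) (fun k => xi g (xi h e k) (h ** k)) =
    act bE (sigma g h) (T' (g ** h) e).
  by rewrite -vXY vS /average tgh sgh.
have e2 : bint mu c bE (src h) (tgt g) (fun k => xi g y (h ** k)) = T' g y.
  by rewrite vX /average th.
rewrite e1 e2 in vP; rewrite vTY vTy -/(average T h e) -/y in vQ.
(* T(g) commutes with means, so T(g) (Y_k - y) has mean zero. Subtracting it is free and replaces
   X_k by X_k - T(g), which makes the estimate quadratic. *)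
have -> : bdist bE (act bE (sigma g h) (T' (g ** h) e)) (T' g y) =
    bdist bE (bint mu c bE (src h) (tgt g)
      (fun k => bsub bE (xi g (xi h e k) (h ** k)) (xi g y (h ** k))))
     (bint mu c bE (src h) (tgt g) (fun k => bsub bE (T g (xi h e k)) (T g y))).
  rewrite vQ; have -> : bsub bE (T g y) (T g y) = bzero bE (tgt g).
    by have [u ->] := liftE pTy; rewrite fvalB subrr.
  by rewrite -{2}(bproj_bint mu c bE (src h) (tgt g)
    (fun k => bsub bE (xi g (xi h e k) (h ** k)) (xi g y (h ** k)))) bdist_zero vP.
rewrite mulrC -ler_pdivlMr ?ell_gt0//; apply: (bint_dist hG mu cutc iP iQ) => k [tk _].
rewrite ler_pdivlMr ?ell_gt0// mulrC.
have thk : tgt (h ** k) = src g by rewrite tgt_gmul.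
have pxi : p (xi h e k) = src g by rewrite (xi_proj Hsigma HT Tapprox).
rewrite -(fiber_linear_sub (xi_linear Hsigma HT Tapprox thk))//.
rewrite -(fiber_linear_sub (pseudorep_linear HT g))//.
(* The first factor d comes from X_k - T(g), with the arrow [h ** k] in the integrand and the vector
   Y_k - y. *)
apply: le_trans (xi_dist og thk _) _; first by rewrite bproj_sub ?pxi.
rewrite (mulrC 2) expr2 -(mulrA d d) -(mulrA d); apply: ler_wpM2l; first exact: d_ge0.
have oh : Defs.orbit Gd x (tgt h) by rewrite th; exact: orbit_src.
have pTh : p (T h e) = tgt h by rewrite (pseudorep_proj HT).
(* The factor 2 d: both Y_k and its mean y are within d |e| of T(h) e. *)
apply: le_trans (bdist_triangle (bE := bE) (e2 := T h e) _ _) _.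
- by rewrite pxi pTh.
- by rewrite py pTh.
have h1 := le_of_ell (xi_dist oh tk pe) (bdist_ge0 _ _ _).
have h2 := le_of_ell (average_dist oh pe) (bdist_ge0 _ _ _).
rewrite (bdistC (bE := bE) (e := T h e)) ?py ?pTh//.
apply: le_trans (lerD h1 h2) _; rewrite le_eqVlt; apply/orP; left; apply/eqP; ring.
Qed.

Lemma approx_rep_average : approx_rep x (2 * d ^+ 2) T'.
Proof.
exists 0, (2 * d ^+ 2); split => //.
- by rewrite mulr_ge0// exprn_ge0// d_ge0.
- by rewrite add0r.
- by move=> y e oy pe; rewrite average_unit// bdistxx mul0r.
- by move=> g h e og th pe; exact: average_multiplicative.
Qed.

End Estimates.

Lemma approx_rep0_average x : approx_rep x 0 T -> approx_rep x 0 T'.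
Proof.
move=> aT; exists 0, 0; split; rewrite ?addr0//.
  by move=> y e oy pe; rewrite average_unit// bdistxx mul0r.
move=> g h e og th pe; have [r1 [r2 [r10 r20 r12 _ H2]]] := aT.
have oh : Defs.orbit Gd x (tgt h) by rewrite th; exact: orbit_src.
have pT : p (T h e) = tgt h by rewrite (pseudorep_proj HT).
rewrite !(average_exact aT)// ?tgt_gmul ?src_gmul// ?pT//.
have -> : 0 = r2 :> R by lra.
exact: H2.
Qed.

End OneStep.

End Averaging.

(** * Iteration and its limit *)

(** With t = 1 / (1 - r) <= 4/3 and y = b^2 r one has y t^2 <= 16/81. The new defect 2 r y t^2 is
    then at most 32/81 r <= 2/5 r, and the new product 2 (y t^2)^2 at most 512/6561 < 1/9. *)
Lemma newton_numbers (R : realFieldType) (b r : R) : 0 <= b -> 0 <= r -> r <= 1 / 4 ->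
  b ^+ 2 * r <= 1 / 9 ->
  2 * (r * b / (1 - r)) ^+ 2 <= 2 / 5 * r /\
  (b / (1 - r)) ^+ 2 * (2 * (r * b / (1 - r)) ^+ 2) <= 1 / 9.
Proof.
move=> b0 r0 r4 y9; set t := (1 - r)^-1; set y := b ^+ 2 * r in y9.
have y0 : 0 <= y by rewrite mulr_ge0// exprn_ge0.
have s0 : 0 < 1 - r by lra.
have t0 : 0 <= t by rewrite invr_ge0 ltW.
have t43 : t <= 4 / 3 by rewrite -[4 / 3]invf_div lef_pV2 ?posrE; lra.
have z0 : 0 <= y * t ^+ 2 by rewrite mulr_ge0// exprn_ge0.
have z1 : y * t ^+ 2 <= 16 / 81.
  have -> : 16 / 81 = 1 / 9 * (4 / 3) ^+ 2 :> R by field.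
  by apply: ler_pM => //; [exact: exprn_ge0|rewrite lerXn2r ?nnegrE//; lra].
have -> : (r * b * t) ^+ 2 = r * (y * t ^+ 2) by rewrite /y; ring.
have -> : (b * t) ^+ 2 * (2 * (r * (y * t ^+ 2))) = 2 * (y * t ^+ 2) ^+ 2 by rewrite /y; ring.
split.
  have : r * (y * t ^+ 2) <= r * (16 / 81) by exact: ler_wpM2l.
  lra.
have : (y * t ^+ 2) ^+ 2 <= (16 / 81) ^+ 2 by rewrite lerXn2r ?nnegrE//; lra.
have -> : (16 / 81) ^+ 2 = 256 / 6561 :> R by field.
lra.
Qed.

Section Iteration.
Variables (R : realType) (X : topologicalType) (G : ptopologicalType)
  (A E : topologicalType) (Gd : top_groupoid X G)
  (hG : hausdorff_space G) (lcG : locally_compact [set: G]) (mu : haar_system R Gd)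
  (c : X -> R) (cutc : cutoff Gd c)
  (bA : banach_alg_bundle R X A) (gA : alg_G_bundle Gd bA)
  (bE : banach_module_bundle bA E)
  (sigma : G -> G -> A) (Hsigma : multiplier gA sigma).
Local Notation src := (src Gd).
Local Notation tgt := (tgt Gd).
Local Notation p := (bproj bE).
Local Notation pA := (bproj bA).
Local Notation "g ** h" := (gmul Gd g h) (at level 40, left associativity).
Local Notation ell := (ell Gd bA sigma).
Local Notation approx_rep := (approx_rep Gd bE sigma).
Local Notation bounded_rep := (bounded_rep Gd bE sigma).
Local Notation average := (average mu c bE sigma).
Local Notation q := (2 / 5 : R).

(* The first alternative covers the orbits on which [b(T, x)] is infinite, where [r(T, x)] vanishes. *)
Definition rate (x : X) (kap : R) (T : G -> E -> E) :=
  (approx_rep x 0 T /\ kap = 0) \/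
  exists b r : R, [/\ 0 <= b, 0 <= r <= 1 / 4, b ^+ 2 * r <= 1 / 9 &
    [/\ approx_rep x r T, bounded_rep x b T & kap = 4 * b * r]].

Definition almost (T : G -> E -> E) :=
  [/\ pseudorep Gd bE T, A_linear gA bE T & forall x, exists kap, rate x kap T].

Lemma almost_approx T : almost T -> forall x, exists r, r <= 1 / 4 /\ approx_rep x r T.
Proof.
move=> [_ _ H] x; have [k [[aT _]|[b [r [_ /andP[_ r4] _ [aT _ _]]]]]] := H x.
  by exists 0; split => //; rewrite divr_ge0.
by exists r.
Qed.

Lemma approx_rep_le x r r' T : r <= r' -> approx_rep x r T -> approx_rep x r' T.
Proof.
by move=> rr' [r1 [r2 [? ? h ? ?]]]; exists r1, r2; split => //; exact: le_trans rr'.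
Qed.

Lemma almost_average T : almost T -> almost (average T).
Proof.
move=> aT; have Ta := almost_approx aT; have [HT HTA H] := aT; split.
- by apply: (pseudorep_average hG lcG mu cutc Hsigma).
- by apply: (A_linear_average hG lcG mu cutc Hsigma).
move=> x; have [k [[aTx _]|[b [r [b0 /andP[r0 r4] y9 [aTx bT _]]]]]] := H x.
  by exists 0; left; split => //; apply: (approx_rep0_average hG mu cutc Hsigma).
have [n1 n2] := newton_numbers b0 r0 r4 y9.
exists (4 * (b / (1 - r)) * (2 * (r * b / (1 - r)) ^+ 2)); right.
exists (b / (1 - r)), (2 * (r * b / (1 - r)) ^+ 2); split => //.
- by rewrite divr_ge0// subr_ge0; lra.
- by rewrite mulr_ge0 ?sqr_ge0//=; lra.
split => //.
- exact: (approx_rep_average hG lcG mu cutc Hsigma HT HTA Ta r0 r4 aTx b0 bT).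
- exact: (bounded_rep_average hG lcG mu cutc Hsigma HT Ta r0 r4 aTx bT).
Qed.

Variables (T : G -> E -> E) (aT : almost T).

Definition iterate n := iter n average T.

Lemma almost_iterate n : almost (iterate n).
Proof. by elim: n => [//|n IH]; exact: almost_average. Qed.

Lemma iterate_exact x n : approx_rep x 0 T -> approx_rep x 0 (iterate n) /\
  forall g e, Defs.orbit Gd x (tgt g) -> p e = src g -> iterate n g e = T g e.
Proof.
move=> aT0; elim: n => [//|n [IH1 IH2]].
have an := almost_iterate n; have Ta := almost_approx an; have [HT HTA _] := an.
split; first by apply: (approx_rep0_average hG mu cutc Hsigma).
move=> g e og pe; rewrite -IH2//.
exact: (average_exact hG mu cutc Hsigma HT Ta IH1).
Qed.

(** The factor 2 - q^n is a closed bound for the product of the factors 1 / (1 - r_k) accumulated by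
    b; it keeps b below twice its initial value. *)
Lemma iterate_bounds x (b r : R) n : 0 <= b -> 0 <= r -> r <= 1 / 4 ->
  b ^+ 2 * r <= 1 / 9 ->
  approx_rep x r T -> bounded_rep x b T ->
  exists bn rn : R, [/\ 0 <= bn <= (2 - q ^+ n) * b, 0 <= rn <= q ^+ n * r, bn ^+ 2 * rn <= 1 / 9 &
    approx_rep x rn (iterate n) /\ bounded_rep x bn (iterate n)].
Proof.
move=> b0 r0 r4 y9 a0 bd0; elim: n => [|n [bn [rn [/andP[bn0 bn1] /andP[rn0 rn1] yn9 [an bdn]]]]].
  have e21 : 2 - 1 = 1 :> R by ring.
  exists b, r; split => //; first by rewrite expr0 e21 mul1r b0 lexx.
  by rewrite expr0 mul1r r0 lexx.
have u0 : 0 <= q ^+ n by rewrite exprn_ge0// divr_ge0.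
have u1 : q ^+ n <= 1 by rewrite exprn_ile1// ?divr_ge0//; lra.
rewrite exprS; move: (q ^+ n) => u in u0 u1 bn1 rn1 *.
have rn4 : rn <= u / 4.
  by apply: le_trans rn1 _; rewrite -[u / 4]mulr1 -mulrA; apply: ler_wpM2l => //; lra.
have rn4' : rn <= 1 / 4 by lra.
have s0 : 0 < 1 - rn by lra.
have [n1 n2] := newton_numbers bn0 rn0 rn4' yn9.
have am := almost_iterate n; have Ta := almost_approx am; have [HT HTA _] := am.
exists (bn / (1 - rn)), (2 * (rn * bn / (1 - rn)) ^+ 2); split => //.
- apply/andP; split; first by rewrite divr_ge0// ltW.
  (* As rn <= u / 4, it suffices that (2 - 2u/5) (1 - u/4) >= 2 - u, which holds for u >= 0. *)
  rewrite ler_pdivrMr//; apply: le_trans bn1 _.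
  rewrite [leRHS]mulrAC; apply: ler_wpM2r => //; nra.
- rewrite mulr_ge0 ?sqr_ge0//=; apply: le_trans n1 _.
  by rewrite -(mulrA q); apply: ler_wpM2l => //; rewrite divr_ge0.
split.
- exact: (approx_rep_average hG lcG mu cutc Hsigma HT HTA Ta rn0 rn4' an bn0 bdn).
- exact: (bounded_rep_average hG lcG mu cutc Hsigma HT Ta rn0 rn4' an bdn).
Qed.

(** The n-th step moves by at most rn bn / (1 - rn) <= (12/5) b r q^n. Since q^n - q^(n+1) = (3/5)
    q^n, this is 4 b r times a telescoping difference. *)
Lemma iterate_rate x kap : rate x kap T -> 0 <= kap <= 1 /\ exists rho : R, 0 <= rho /\
  forall n, approx_rep x (rho * q ^+ n) (iterate n) /\
  forall g e, Defs.orbit Gd x (tgt g) -> p e = src g ->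
    bdist bE (iterate n.+1 g e) (iterate n g e) <= kap * (q ^+ n - q ^+ n.+1) * bnorm bE e.
Proof.
case=> [[aT0 ->]|[b [r [b0 /andP[r0 r4] y9 [a0 bd0 ->]]]]].
  split; first by rewrite lexx ler01.
  exists 0; split => // n; rewrite mul0r; split; first exact: (iterate_exact n aT0).1.
  move=> g e og pe; rewrite !(iterate_exact _ aT0).2// bdistxx !mul0r//.
split.
  rewrite !mulr_ge0//=.
  (* From b^2 r <= 1/9 and r <= 1/4 one gets b r <= 1/6, so the rate 4 b r is below 1 on every
     orbit. *)
  have : (b * r) ^+ 2 <= (1 / 6) ^+ 2.
    have -> : (b * r) ^+ 2 = (b ^+ 2 * r) * r by ring.
    have -> : (1 / 6) ^+ 2 = 1 / 9 * (1 / 4) :> R by field.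
    by apply: ler_pM => //; rewrite mulr_ge0// exprn_ge0.
  rewrite ler_pXn2r ?nnegrE ?mulr_ge0 ?divr_ge0// -mulrA; lra.
exists r; split => // n.
have [bn [rn [/andP[bn0 bn1] /andP[rn0 rn1] yn9 [an bdn]]]] := iterate_bounds n b0 r0 r4 y9 a0 bd0.
split; first by apply: approx_rep_le an; rewrite mulrC.
move=> g e og pe.
have u0 : 0 <= q ^+ n by rewrite exprn_ge0// divr_ge0.
have u1 : q ^+ n <= 1 by rewrite exprn_ile1// ?divr_ge0//; lra.
have rn4 : rn <= q ^+ n / 4.
  by apply: le_trans rn1 _; apply: ler_wpM2l => //; lra.
have rn4' : rn <= 1 / 4 by lra.
have s0 : 0 < 1 - rn by lra.
have am := almost_iterate n; have Ta := almost_approx am; have [HT HTA _] := am.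
have := average_dist hG lcG mu cutc Hsigma HT Ta rn0 rn4' an bdn og pe.
move=> /le_of_ell/(_ (bdist_ge0 _ _ _)) h; apply: le_trans h _.
apply: ler_wpM2r; first exact: bnorm_ge0.
rewrite exprS; move: (q ^+ n) => u in u0 u1 rn4 bn1 rn1 *.
(* Here 2 - u <= (12/5) (1 - u/4), and rn <= u / 4. *)
have h1 : bn / (1 - rn) <= 12 / 5 * b.
  rewrite ler_pdivrMr//; apply: le_trans bn1 _.
  rewrite [leRHS]mulrAC; apply: ler_wpM2r => //; nra.
have h2 : rn * (bn / (1 - rn)) <= u * r * (12 / 5 * b).
  by apply: ler_pM => //; rewrite divr_ge0// ltW.
rewrite -mulrA; apply: le_trans h2 _.
by rewrite le_eqVlt; apply/orP; left; apply/eqP; field.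
Qed.

End Iteration.

(** * Limits of geometrically convergent pseudorepresentations *)

Section Limit.
Variables (R : realType) (X : topologicalType) (G : ptopologicalType)
  (A E : topologicalType) (Gd : top_groupoid X G)
  (bA : banach_alg_bundle R X A) (gA : alg_G_bundle Gd bA)
  (bE : banach_module_bundle bA E).
Local Notation src := (src Gd).
Local Notation tgt := (tgt Gd).
Local Notation p := (bproj bE).
Variables (q : R) (kap : G -> R) (T : nat -> G -> E -> E).
Hypotheses (q01 : 0 <= q < 1) (kap01 : forall g, 0 <= kap g <= 1).
Hypothesis HT : forall n, pseudorep Gd bE (T n).

Lemma limit_exists : (forall n g e, p e = src g ->
    bdist bE (T n.+1 g e) (T n g e) <= kap g * (q ^+ n - q ^+ n.+1) * bnorm bE e) ->
  exists L : G -> E -> E, forall g e, p e = src g -> p (L g e) = tgt g /\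
    forall n, bdist bE (T n g e) (L g e) <= kap g * q ^+ n * bnorm bE e.
Proof.
move=> H; have /boolp.choice[L HL] : forall ge : G * E, exists l, p ge.2 = src ge.1 ->
    p l = tgt ge.1 /\ forall n, bdist bE (T n ge.1 ge.2) l <= kap ge.1 * q ^+ n * bnorm bE ge.2.
  move=> [g e] /=; have [pe|] := pselect (p e = src g); last by exists e.
  pose u n := tofiber bE (tgt g) (T n g e).
  have uE n : fval (u n) = T n g e by rewrite tofiberK// (pseudorep_proj (HT n)).
  have [|n|l Hl] := @geometric_limit _ _ u q (kap g * bnorm bE e) (@fiber_complete _ _ _ bE (tgt g)) q01.
  - by rewrite mulr_ge0 ?bnorm_ge0//; case/andP: (kap01 g).
  - rewrite -fval_norm -fvalB !uE mulrAC; exact: H.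
  exists (fval l) => _; split=> [|n]; first exact: fvalP.
  by rewrite /bdist -uE fvalB fval_norm mulrAC; exact: Hl.
by exists (fun g e => L (g, e)) => g e pe; exact: (HL (g, e)).
Qed.

Variable L : G -> E -> E.
Hypothesis HL : forall g e, p e = src g -> p (L g e) = tgt g /\
  forall n, bdist bE (T n g e) (L g e) <= kap g * q ^+ n * bnorm bE e.

Lemma limit_proj g e : p e = src g -> p (L g e) = tgt g.
Proof. by move=> /HL[]. Qed.

Lemma limit_dist g e n : p e = src g -> bdist bE (T n g e) (L g e) <= q ^+ n * bnorm bE e.
Proof.
move=> pe; apply: le_trans ((HL pe).2 n) _; apply: ler_wpM2r; first exact: bnorm_ge0.
have /andP[k0 k1] := kap01 g; rewrite ler_piMl// exprn_ge0//; by case/andP: q01.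
Qed.

(** The identities of the limit are all obtained from this; [C] may depend on the vectors involved,
    as only n varies. *)
Lemma geometric_eq e e' C : p e = p e' -> (forall n, bdist bE e e' <= C * q ^+ n) -> e = e'.
Proof.
move=> pe H; apply: (bdist_eq0 (bE := bE)) => //; rewrite leNgt; apply/negP => d0.
have C0 : 0 <= C.
  by have := H 0%N; rewrite expr0 mulr1; apply: le_trans; exact: bdist_ge0.
have [N /(_ N (leqnn N))] := cvg_geometric0 q01 C0 d0.
by rewrite ltNge H.
Qed.

Lemma bdistD x e1 e2 f1 f2 : p e1 = x -> p e2 = x -> p f1 = x -> p f2 = x ->
  bdist bE (badd bE e1 e2) (badd bE f1 f2) <= bdist bE e1 f1 + bdist bE e2 f2.
Proof.
move=> /liftE[u ->] /liftE[v ->] /liftE[w ->] /liftE[z ->].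
rewrite !fvalD /bdist !fvalB !fval_norm opprD addrACA; exact: ler_normD.
Qed.

Lemma bdistZ x e e' k : p e = x -> p e' = x ->
  bdist bE (bscale bE k e) (bscale bE k e') = `|k| * bdist bE e e'.
Proof.
by move=> /liftE[u ->] /liftE[v ->]; rewrite !fvalZ /bdist !fvalB !fval_norm -scalerBr normrZ.
Qed.

Lemma limit_linear g : fiber_linear bE (src g) (tgt g) (L g).
Proof.
split=> [e|e e' pe pe'|k e pe]; first exact: limit_proj.
- have pd : p (badd bE e e') = src g by rewrite bproj_add ?pe.
  have pL := limit_proj pe; have pL' := limit_proj pe'.
  apply: (@geometric_eq _ _ (bnorm bE (badd bE e e') + bnorm bE e + bnorm bE e')).
    by rewrite limit_proj// bproj_add ?pL.
  move=> n; have [Tp TD _] := pseudorep_linear (HT n) g.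
  apply: le_trans (bdist_triangle (bE := bE) (e2 := T n g (badd bE e e')) _ _) _.
  + by rewrite limit_proj ?Tp.
  + by rewrite bproj_add ?pL ?Tp.
  have h1 := limit_dist n pd; rewrite bdistC ?limit_proj ?Tp//.
  rewrite {2}TD//; have h2 := bdistD (Tp _ pe) (Tp _ pe') pL pL'.
  have h3 := limit_dist n pe; have h4 := limit_dist n pe'.
  by rewrite !mulrDl -addrA !(mulrC _ (q ^+ n)); apply: lerD => //; apply: le_trans h2 _; exact: lerD.
- have pd : p (bscale bE k e) = src g by rewrite bproj_scale.
  have pL := limit_proj pe.
  apply: (@geometric_eq _ _ (bnorm bE (bscale bE k e) + `|k| * bnorm bE e)).
    by rewrite limit_proj// bproj_scale.
  move=> n; have [Tp _ TZ] := pseudorep_linear (HT n) g.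
  apply: le_trans (bdist_triangle (bE := bE) (e2 := T n g (bscale bE k e)) _ _) _.
  + by rewrite limit_proj ?Tp.
  + by rewrite bproj_scale pL Tp.
  have h1 := limit_dist n pd; rewrite bdistC ?limit_proj ?Tp//.
  rewrite {2}TZ// (bdistZ _ (Tp _ pe) pL); have h3 := limit_dist n pe.
  rewrite mulrDl !(mulrC _ (q ^+ n)); apply: lerD => //.
  by rewrite mulrCA; exact: ler_wpM2l.
Qed.

(** Since the rates are at most 1, the error at stage n is at most q^n |e| for all arrows at once,
    so on vectors of bounded norm the limit is approximated uniformly by a continuous map. *)
Lemma pseudorep_limit : pseudorep Gd bE L.
Proof.
split; first by move=> g; have [] := limit_linear g.
split; first by move=> g; have [] := limit_linear g.
split; first by move=> g; have [] := limit_linear g.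
apply/within_catw => -[g0 e0] /= pe0.
apply: catw_pair; first by apply: continuous_catw; exact: cvg_fst.
apply: (catw_approx (bE := bE)) => //.
  apply: (catw_eq (f := fun q : G * E => tgt q.1)) => //.
    by move=> [g e] /= pe; rewrite limit_proj.
  by apply: continuous_catw; apply: continuous_comp; [exact: cvg_fst|exact: tgt_cont].
move=> eps eps0; have n0 : 0 <= bnorm bE e0 + 1 by rewrite addr_ge0// bnorm_ge0.
have [n /(_ n (leqnn n))/ltW Hn] := cvg_geometric0 q01 n0 eps0.
have qn0 : 0 <= q ^+ n by rewrite exprn_ge0//; case/andP: q01.
have bound g e : src g = p e -> bnorm bE e <= bnorm bE e0 + 1 -> bdist bE (L g e) (T n g e) <= eps.
  move=> pe ne; rewrite bdistC ?limit_proj ?(pseudorep_proj (HT n))//.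
  by apply: le_trans (limit_dist n (esym pe)) _; apply: le_trans Hn; rewrite mulrC; exact: ler_wpM2r.
exists (T n g0 e0); split => /=.
- by rewrite limit_proj ?(pseudorep_proj (HT n)).
- by apply: bound => //; rewrite lerDl.
move=> W nW; have := pseudorep_catw (HT n) (esym pe0); move=> /catwP/(_ W nW).
have : catw [set q : G * E | src q.1 = p q.2] (fun q => bnorm bE q.2) (g0, e0).
  by apply: catw_bnorm; apply: continuous_catw; exact: cvg_snd.
move=> /(catw_lt (r := bnorm bE e0 + 1)); rewrite /= ltrDl => /(_ ltr01).
apply: filterS2 => -[g e] /= ne We pe; exists (T n g e); split.
- exact: We.
- by rewrite limit_proj ?(pseudorep_proj (HT n)).
- by apply: bound => //; apply/ltW/ne.
Qed.

Lemma A_linear_limit : (forall n, A_linear gA bE (T n)) -> A_linear gA bE L.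
Proof.
move=> HA g a e pa pe; have pga : bproj bA (gact gA g a) = tgt g by rewrite bproj_gact.
have pL := limit_proj pe; have pae : p (act bE a e) = src g by exact: bproj_actE.
have paL : p (act bE (gact gA g a) (L g e)) = tgt g by exact: bproj_actE.
apply: (@geometric_eq _ _ (bnorm bE (act bE a e) + bnorm bA (gact gA g a) * bnorm bE e)).
  by rewrite limit_proj// paL.
move=> n; have [Tp _ _] := pseudorep_linear (HT n) g.
apply: le_trans (bdist_triangle (bE := bE) (e2 := T n g (act bE a e)) _ _) _.
- by rewrite limit_proj ?Tp.
- by rewrite paL Tp.
have h1 := limit_dist n pae; rewrite bdistC ?limit_proj ?Tp//.
rewrite {2}HA//; have h3 := limit_dist n pe.
rewrite mulrDl !(mulrC _ (q ^+ n)); apply: lerD => //.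
apply: le_trans (act_dist _ _) _; rewrite ?pga ?pL ?Tp//.
by rewrite mulrCA; apply: ler_wpM2l => //; exact: bnorm_ge0.
Qed.

Lemma limit_unit : (forall n x e, p e = x -> T n.+1 (unt Gd x) e = e) ->
  forall x e, p e = x -> L (unt Gd x) e = e.
Proof.
move=> HU x e pe; have pe' : p e = src (unt Gd x) by rewrite src_unt.
have pL := limit_proj pe'; rewrite tgt_unt in pL.
apply: (@geometric_eq _ _ (bnorm bE e)); first by rewrite pL.
move=> n; rewrite -{2}(HU n x e pe) bdistC ?HU ?pL//.
rewrite -{1}(HU n x e pe); apply: le_trans (limit_dist n.+1 pe') _.
rewrite mulrC; apply: ler_wpM2l; first exact: bnorm_ge0.
have /andP[q0 q1] := q01; by rewrite exprS ler_piMl ?exprn_ge0// ltW.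
Qed.

(** The chain is sigma L(gh), sigma T_n(gh), T_n(g) T_n(h), L(g) T_n(h), L(g) L(h), all applied to
    e. The last link uses the bound [C] of the fixed operator L(g), so bounds on T_n(g) uniform in n
    do not enter. *)
Lemma limit_multiplicative (sigma : G -> G -> A) g h e C rho :
  src g = tgt h -> p e = src h -> bproj bA (sigma g h) = tgt g ->
  (forall u, p u = src g -> bnorm bE (L g u) <= C * bnorm bE u) -> 0 <= C ->
  (forall n, bdist bE (act bE (sigma g h) (T n (gmul Gd g h) e)) (T n g (T n h e))
     <= rho * q ^+ n * bnorm bE e) ->
  act bE (sigma g h) (L (gmul Gd g h) e) = L g (L h e).
Proof.
move=> gh pe ps LC C0 H; have /andP[q0 q1] := q01.
have pe' : p e = src (gmul Gd g h) by rewrite src_gmul.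
have pLgh := limit_proj pe'; rewrite tgt_gmul// in pLgh.
have pLh := limit_proj pe; have pLLh : p (L g (L h e)) = tgt g by rewrite limit_proj// pLh.
apply: (@geometric_eq _ _ (bnorm bA (sigma g h) * bnorm bE e + rho * bnorm bE e +
    ((bnorm bE (L h e) + bnorm bE e) + C * bnorm bE e))).
  by rewrite pLLh; exact: bproj_actE.
move=> n; have qn0 : 0 <= q ^+ n by rewrite exprn_ge0.
have qn1 : q ^+ n <= 1 by rewrite exprn_ile1// ltW.
have [Tp _ _] := pseudorep_linear (HT n) g.
have pTh : p (T n h e) = src g by rewrite (pseudorep_proj (HT n)).
have pTgh : p (T n (gmul Gd g h) e) = tgt g by rewrite (pseudorep_proj (HT n)) ?tgt_gmul.
have pTT : p (T n g (T n h e)) = tgt g by rewrite Tp.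
have pLT : p (L g (T n h e)) = tgt g by rewrite limit_proj.
have ps1 : p (act bE (sigma g h) (L (gmul Gd g h) e)) = tgt g by exact: bproj_actE.
have ps2 : p (act bE (sigma g h) (T n (gmul Gd g h) e)) = tgt g by exact: bproj_actE.
apply: le_trans (bdist_triangle (bE := bE) (e2 := T n g (T n h e)) _ _) _; rewrite ?pTT//.
rewrite mulrDl; apply: lerD.
  apply: le_trans (bdist_triangle (bE := bE)
    (e2 := act bE (sigma g h) (T n (gmul Gd g h) e)) _ _) _; rewrite ?ps2//.
  rewrite mulrDl; apply: lerD; last by have := H n; rewrite mulrAC.
  rewrite bdistC ?ps1 ?ps2//; apply: le_trans (act_dist _ _) _; rewrite ?ps ?pTgh ?pLgh//.
  rewrite -mulrA; apply: ler_wpM2l; first exact: bnorm_ge0.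
  by rewrite mulrC; exact: limit_dist.
apply: le_trans (bdist_triangle (bE := bE) (e2 := L g (T n h e)) _ _) _; rewrite ?pTT ?pLT//.
rewrite mulrDl; have hd := limit_dist n pe; apply: lerD.
  apply: le_trans (limit_dist n pTh) _; rewrite mulrC; apply: ler_wpM2r => //.
  apply: le_trans (bnorm_le_dist (bE := bE) (e' := L h e) _) _; first by rewrite pTh pLh.
  rewrite lerD2l; apply: le_trans hd _; rewrite ler_piMl//; exact: bnorm_ge0.
rewrite (fiber_linear_dist (limit_linear g)) ?pLh//.
apply: le_trans (LC _ _) _; first by rewrite bproj_sub pTh ?pLh.
by rewrite -mulrA; apply: ler_wpM2l => //; rewrite mulrC.
Qed.

End Limit.

(** * From the extended constants to rates *)

Lemma ge0_finite_summands (R : realType) (s t : \bar R) (k : R) :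
  (0 <= s)%E -> (0 <= t)%E -> (s + t <= k%:E)%E -> exists a b : R, s = a%:E /\ t = b%:E.
Proof. by case: s => [a||] //; case: t => [b||] // *; exists a, b. Qed.

Section OperatorNorm.
Variables (R : realType) (X E : topologicalType) (bE : banach_bundle R X E).
Local Notation p := (bproj bE).

Lemma bopnorm_ge0 x F : (0 <= bopnorm bE x F)%E.
Proof.
apply: le_trans (_ : ((bnorm bE (F (bzero bE x)))%:E <= _)%E).
  by rewrite lee_fin bnorm_ge0.
by apply: ereal_sup_ubound; exists (bzero bE x) => //=; rewrite bproj_zero bnorm_zero ler01.
Qed.

Lemma fiber_linear_bound x y F C : fiber_linear bE x y F ->
  (forall e, p e = x -> bnorm bE e <= 1 -> bnorm bE (F e) <= C) ->
  forall e, p e = x -> bnorm bE (F e) <= C * bnorm bE e.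
Proof.
move=> lF H e pe; have [_ _ FZ] := lF.
have [e0|] := eqVneq (bnorm bE e) 0.
  by rewrite (bnorm_eq0 e0) pe (fiber_linear_zero lF) !bnorm_zero mulr0.
move=> ne; have n0 : 0 < bnorm bE e by rewrite lt_def ne bnorm_ge0.
have := H (bscale bE (bnorm bE e)^-1 e); rewrite bproj_scale => /(_ pe).
rewrite FZ// !bnormZ gtr0_norm ?invr_gt0// mulVf// => /(_ (lexx _)).
by rewrite mulrC ler_pdivrMr.
Qed.

Lemma le_bopnorm x F C : 0 <= C -> (forall e, p e = x -> bnorm bE (F e) <= C * bnorm bE e) ->
  (bopnorm bE x F <= C%:E)%E.
Proof.
move=> C0 H; apply: ge_ereal_sup => _ [e [pe e1] <-]; rewrite lee_fin.
by apply: le_trans (H e pe) _; rewrite ler_piMr.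
Qed.

Lemma bopnorm_ub x F e : p e = x -> bnorm bE e <= 1 -> ((bnorm bE (F e))%:E <= bopnorm bE x F)%E.
Proof. by move=> pe e1; apply: ereal_sup_ubound; exists e. Qed.

Lemma fiber_linear_id x : fiber_linear bE x x id.
Proof. by []. Qed.

Lemma fiber_linear_bsub x y F F' : fiber_linear bE x y F -> fiber_linear bE x y F' ->
  fiber_linear bE x y (fun e => bsub bE (F e) (F' e)).
Proof.
move=> [Fp FD FZ] [Fp' FD' FZ']; split.
- by move=> e pe; rewrite bproj_sub Fp ?Fp'.
- move=> e e' pe pe'; rewrite FD// FD'//.
  have [u ->] := liftE (Fp e pe); have [v ->] := liftE (Fp' e pe).
  have [w ->] := liftE (Fp e' pe'); have [z ->] := liftE (Fp' e' pe').
  by rewrite !(fvalD, fvalB) opprD addrACA.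
- move=> k e pe; rewrite FZ// FZ'//.
  have [u ->] := liftE (Fp e pe); have [v ->] := liftE (Fp' e pe).
  by rewrite !(fvalZ, fvalB) scalerBr.
Qed.

End OperatorNorm.

(** * The representation and its distance from [T] *)

Section Existence.
Variables (R : realType) (X : topologicalType) (G : ptopologicalType)
  (A E : topologicalType) (Gd : top_groupoid X G)
  (hG : hausdorff_space G) (lcG : locally_compact [set: G]) (mu : haar_system R Gd)
  (c : X -> R) (cutc : cutoff Gd c)
  (bA : banach_alg_bundle R X A) (gA : alg_G_bundle Gd bA)
  (bE : banach_module_bundle bA E)
  (sigma : G -> G -> A) (Hsigma : multiplier gA sigma)
  (T : G -> E -> E) (HT : pseudorep Gd bE T) (HTA : A_linear gA bE T)
  (Halmost : almost_rep Gd bE sigma T).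
Local Notation src := (src Gd).
Local Notation tgt := (tgt Gd).
Local Notation p := (bproj bE).
Local Notation pA := (bproj bA).
Local Notation "g ** h" := (gmul Gd g h) (at level 40, left associativity).
Local Notation ell := (ell Gd bA sigma).
Local Notation rT := (rT Gd bE sigma T).
Local Notation bT := (bT Gd bE sigma T).
Local Notation iterate := (iterate mu c bE sigma T).

Lemma defect_linear g h : tgt h = src g -> fiber_linear bE (src h) (tgt g)
  (fun e => bsub bE (act bE (sigma g h) (T (g ** h) e)) (T g (T h e))).
Proof.
move=> th; apply: fiber_linear_bsub.
  have l1 := pseudorep_linear HT (g ** h); rewrite src_gmul// tgt_gmul// in l1.
  have l2 := act_linear bE (sigma g h); rewrite (sigma_proj Hsigma)// in l2.
  exact: fiber_linear_comp l1 l2.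
have l1 := pseudorep_linear HT h; rewrite th in l1.
exact: fiber_linear_comp l1 (pseudorep_linear HT g).
Qed.

Lemma unit_defect_linear y :
  fiber_linear bE y y (fun e => bsub bE e (T (unt Gd y) e)).
Proof.
apply: fiber_linear_bsub; first exact: fiber_linear_id.
by have := pseudorep_linear HT (unt Gd y); rewrite src_unt tgt_unt.
Qed.

Lemma bT_ge0 x : (0 <= bT x)%E.
Proof.
apply: le_trans (_ : ((ell (unt Gd x))%:E * bopnorm bE (src (unt Gd x)) (T (unt Gd x)) <= _)%E).
  by rewrite mule_ge0 ?bopnorm_ge0// lee_fin ltW// ell_gt0.
by apply: ereal_sup_ubound; exists (unt Gd x) => //=; rewrite tgt_unt; exact: orbit_refl.
Qed.

(** Both suprema are nonnegative, as the unit at [x] shows, and their sum is at most 1/4; hence both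
    are real numbers and serve as [r1] and [r2]. *)
Lemma rT_approx x : exists r, [/\ rT x = r%:E, 0 <= r & approx_rep Gd bE sigma x r T].
Proof.
have := Halmost x; rewrite /almost_rep /Defs.rT.
set s1 := ereal_sup _; set s2 := ereal_sup _ => H.
have s10 : (0 <= s1)%E.
  apply: le_trans (_ : (bopnorm bE x (fun e => bsub bE e (T (unt Gd x) e)) <= _)%E).
    exact: bopnorm_ge0.
  by apply: ereal_sup_ubound; exists x => //; exact: orbit_refl.
have s20 : (0 <= s2)%E.
  pose u := unt Gd x.
  apply: le_trans (_ : ((ell u)%:E * bopnorm bE (src u)
     (fun e => bsub bE (act bE (sigma u u) (T (u ** u) e)) (T u (T u e))) <= _)%E).
    by rewrite mule_ge0 ?bopnorm_ge0// lee_fin ltW// ell_gt0.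
  apply: ereal_sup_ubound; exists (u, u) => //=; rewrite tgt_unt src_unt; split => //.
  exact: orbit_refl.
have h4 : (s1 + s2 <= (1 / 4)%:E)%E by apply: le_trans H _; rewrite ge_min lexx.
have [r1 [r2 [e1 e2]]] := ge0_finite_summands s10 s20 h4.
rewrite e1 in s10; rewrite e2 in s20; rewrite e1 e2.
exists (r1 + r2); split => //; first by rewrite addr_ge0// -lee_fin.
exists r1, r2; split => //; rewrite -?lee_fin//.
- move=> y e oy pe; apply: (fiber_linear_bound (unit_defect_linear y)) => // e' pe' ne'.
  rewrite -lee_fin -e1; apply: le_trans (bopnorm_ub (fun e => bsub bE e (T (unt Gd y) e)) pe' ne') _.
  by apply: ereal_sup_ubound; exists y.
- move=> g h e og th pe; have l0 := ell_gt0 Gd bA sigma g.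
  rewrite mulrC -ler_pdivlMr// mulrAC.
  apply: (fiber_linear_bound (defect_linear th)) => // e' pe' ne'.
  rewrite ler_pdivlMr// mulrC -lee_fin -e2.
  apply: (@le_trans _ _ ((ell g)%:E * bopnorm bE (src h)
    (fun e => bsub bE (act bE (sigma g h) (T (g ** h) e)) (T g (T h e))))%E).
    rewrite EFinM; apply: lee_wpmul2l; first by rewrite lee_fin ltW.
    exact: (bopnorm_ub (fun e => bsub bE (act bE (sigma g h) (T (g ** h) e)) (T g (T h e)))).
  by apply: ereal_sup_ubound; exists (g, h).
Qed.

(** For finite nonzero b the hypothesis reads b^2 r <= 1/9, which is trivial for b = 0; infinite b
    forces r = 0. *)
Lemma almost_rep_rate x : exists kap, rate Gd bE sigma x kap T /\
  (kap%:E <= 4%:E * bT x * rT x)%E.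
Proof.
have [r [rE r0 aT]] := rT_approx x; have b0 := bT_ge0 x.
have := Halmost x; rewrite rE le_min lee_fin => /andP[r4 hb].
case bE_ : (bT x) b0 hb => [b||] //= b0; last first.
  (* Here [bT x] is infinite and its inverse square is read as 0, so the defect vanishes and the
     rate is 0. *)
  rewrite lee_fin => r00; exists 0; split.
    by left; split => //; have -> : 0 = r by apply/eqP; rewrite eq_le r0 r00.
  by rewrite mule_ge0 ?mule_ge0// lee_fin.
rewrite lee_fin in b0 => hb; exists (4 * b * r); split; last by rewrite !EFinM.
right; exists b, r; split => //; first by rewrite r0 r4.
  case: eqP hb => [-> _|/eqP bn]; first by rewrite expr0n /= mul0r divr_ge0.
  rewrite lee_fin => hb; have b2 : 0 < b ^+ 2 by rewrite exprn_gt0// lt_def bn.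
  by rewrite mulrC -ler_pdivlMr// mulrC div1r.
split => // g e og pe; have l0 := ell_gt0 Gd bA sigma g.
rewrite mulrC -ler_pdivlMr// mulrAC.
apply: (fiber_linear_bound (pseudorep_linear HT g)) => // e' pe' ne'.
rewrite ler_pdivlMr// mulrC -lee_fin -bE_.
apply: (@le_trans _ _ ((ell g)%:E * bopnorm bE (src g) (T g))%E).
  rewrite EFinM; apply: lee_wpmul2l; first by rewrite lee_fin ltW.
  exact: bopnorm_ub.
by apply: ereal_sup_ubound; exists g.
Qed.

Lemma almost_rep_almost : almost gA bE sigma T.
Proof. by split => // x; have [k []] := almost_rep_rate x; exists k. Qed.

Local Notation q := (2 / 5 : R).

(** The last clause records that the iterates converge uniformly, which is what carries uniform
    continuity over to the limit. *)
Lemma sigma_rep_exists : exists L : G -> E -> E, [/\ sigma_rep gA bE sigma L,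
  forall g, (bopnorm bE (src g) (fun e => bsub bE (L g e) (T g e))
    <= 4%:E * bT (tgt g) * rT (tgt g))%E &
  forall n g e, p e = src g -> bdist bE (iterate n g e) (L g e) <= q ^+ n * bnorm bE e].
Proof.
have aT := almost_rep_almost.
have [kap Hkap] := boolp.choice almost_rep_rate.
have Hr x := iterate_rate hG lcG mu cutc Hsigma aT (Hkap x).1.
pose kg g := kap (tgt g).
have kg01 g : 0 <= kg g <= 1 by have [] := Hr (tgt g).
have q01 : 0 <= q < 1 by apply/andP; split; [rewrite divr_ge0|lra].
have an n := almost_iterate hG lcG mu cutc Hsigma aT n.
have HTn n : pseudorep Gd bE (iterate n) by have [] := an n.
have Hstep n g e : p e = src g ->
    bdist bE (iterate n.+1 g e) (iterate n g e) <= kg g * (q ^+ n - q ^+ n.+1) * bnorm bE e.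
  by move=> pe; have [_ [rho [_ /(_ n)[_ H]]]] := Hr (tgt g); apply: H => //; exact: orbit_refl.
have [L HL] := limit_exists q01 kg01 HTn Hstep.
exists L; split.
- split; first exact: (pseudorep_limit q01 kg01 HTn HL).
  split; first by apply: (A_linear_limit q01 kg01 HTn HL) => n; have [] := an n.
  split.
    apply: (limit_unit q01 kg01 HL) => n x e pe.
    have [? ? _] := an n.
    exact: (average_unit hG mu cutc Hsigma (HTn n) (almost_approx (an n))).
  move=> g h e gh pe.
  have [C [C0 /nbhs_singleton HC]] := pseudorep_locally_bounded HT g.
  have [_ [rho [rho0 Hrho]]] := Hr (tgt g).
  (* The estimate at n = 0 puts L(g) within distance 1 of T(g), so a bound [C] of T(g) gives the
     bound [C + 1] for L(g). *)
  apply: (limit_multiplicative (C := C + 1) (rho := rho) q01 kg01 HTn HL) => //.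
  + by rewrite (sigma_proj Hsigma).
  + move=> u pu; apply: le_trans (bnorm_le_dist (bE := bE) (e' := T g u) _) _.
      by rewrite (limit_proj HL)// (pseudorep_proj HT).
    rewrite mulrDl mul1r; apply: lerD; first exact: HC.
    rewrite bdistC ?(limit_proj HL) ?(pseudorep_proj HT)//.
    by apply: le_trans (limit_dist q01 kg01 HL 0 pu) _; rewrite expr0 mul1r.
  + by rewrite addr_ge0.
  + move=> n; have [[r1 [r2 [r10 r20 r12 _ H2]]] _] := Hrho n.
    apply: le_trans (le_of_ell (H2 g h e (orbit_refl _ _) (esym gh) pe) (bdist_ge0 _ _ _)) _.
    by apply: ler_wpM2r; [exact: bnorm_ge0|lra].
- move=> g; apply: le_trans (Hkap (tgt g)).2; apply: le_bopnorm.
    by have /andP[] := kg01 g.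
  (* At n = 0 the iterate is [T] itself and the error is the rate, which is at most 4 b r. *)
  move=> e pe; have [pL /(_ 0%N)] := HL g e pe; rewrite expr0 mulr1 /=.
  by rewrite bdistC// pL (pseudorep_proj HT).
- by move=> n g e pe; exact: (limit_dist q01 kg01 HL).
Qed.

End Existence.

(** * Operator-norm continuity in trivializations *)

Section OperatorContinuity.
Variables (R : realType) (V : normedModType R).
Implicit Types F : V -> V.

Definition vlinear F := forall (k : R) u v, F (k *: u + v) = k *: F u + F v.

Lemma vlinear0 F : vlinear F -> F 0 = 0.
Proof.
move=> lF; have := lF 1 0 0; rewrite !scale1r addr0 => h.
by apply: (addrI (F 0)); rewrite addr0 -h.
Qed.

Lemma vlinearB F u v : vlinear F -> F (u - v) = F u - F v.
Proof. by move=> lF; rewrite addrC -scaleN1r lF scaleN1r addrC. Qed.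

Lemma vlinearZ F k u : vlinear F -> F (k *: u) = k *: F u.
Proof. by move=> lF; rewrite -[k *: u]addr0 lF (vlinear0 lF) addr0. Qed.

Lemma vlinear_sub F F' : vlinear F -> vlinear F' -> vlinear (fun v => F v - F' v).
Proof. by move=> lF lF' k u v; rewrite lF lF' scalerBr opprD addrACA. Qed.

Lemma vlinear_bound F (C : R) : vlinear F ->
  (forall v, `|v| <= 1 -> `|F v| <= C) -> forall v, `|F v| <= C * `|v|.
Proof.
move=> lF H v; have [->|v0] := eqVneq v 0; first by rewrite (vlinear0 lF) normr0 mulr0.
have n0 : 0 < `|v| by rewrite normr_gt0.
have := H (`|v|^-1 *: v); rewrite normrZ gtr0_norm ?invr_gt0// mulVf ?gt_eqF// => /(_ (lexx _)).
by rewrite vlinearZ// normrZ gtr0_norm ?invr_gt0// mulrC ler_pdivrMr.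
Qed.

Lemma opnormV_le F (C : R) : 0 <= C -> vlinear F ->
  (opnormV F <= C%:E)%E <-> forall v, `|F v| <= C * `|v|.
Proof.
move=> C0 lF; split=> H.
  apply: vlinear_bound => // v v1; rewrite -lee_fin; apply: le_trans H.
  by apply: ereal_sup_ubound; exists v.
apply: ge_ereal_sup => _ [v v1 <-]; rewrite lee_fin; apply: le_trans (H v) _.
by rewrite ler_piMr.
Qed.

Lemma continuous_vlinear_bounded F : vlinear F -> {for 0, continuous F} ->
  exists2 C : R, 0 <= C & forall v, `|F v| <= C * `|v|.
Proof.
move=> lF cF; have : \forall v \near (0 : V), `|F v| < 1.
  have : F v @[v --> (0 : V)] --> F 0 := cF.
  rewrite (vlinear0 lF) => /cvgrPdist_lt/(_ 1 ltr01).
  by apply: filterS => v; rewrite sub0r normrN.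
move=> /nbhs_ballP[e /= e0 He].
exists (2 / e); first by rewrite divr_ge0// ltW.
apply: vlinear_bound => // v v1.
have := He ((e / 2) *: v); rewrite -ball_normE /= sub0r normrN normrZ gtr0_norm ?divr_gt0// => H.
have : `|F ((e / 2) *: v)| < 1.
  by apply: H; apply: (@le_lt_trans _ _ (e / 2)); [rewrite ler_piMr// divr_ge0// ltW|lra].
rewrite vlinearZ// normrZ gtr0_norm ?divr_gt0// mulrC -ltr_pdivlMr ?divr_gt0// div1r invf_div.
exact: ltW.
Qed.

Section At.
Variables (Z : topologicalType) (D : set Z) (z0 : Z).

(** [opcont] at one point, with real constants in place of extended operator norms; [opcontP]
    identifies the two for linear families. *)
Definition opc (F : Z -> V -> V) := forall eps : R, 0 < eps ->
  \forall z \near z0, D z -> forall v, `|F z v - F z0 v| <= eps * `|v|.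

Lemma eq_opc (F F' : Z -> V -> V) : D z0 -> (forall z v, D z -> F z v = F' z v) -> opc F -> opc F'.
Proof.
move=> Dz0 FF' H eps e0; apply: filterS (H _ e0) => z Hz Dz v.
by rewrite -!FF'//; exact: Hz.
Qed.

Lemma opc_comp (F F' : Z -> V -> V) : (forall z, D z -> vlinear (F z)) -> D z0 ->
  (exists2 C : R, 0 <= C & forall v, `|F z0 v| <= C * `|v|) ->
  (exists2 C : R, 0 <= C & forall v, `|F' z0 v| <= C * `|v|) ->
  opc F -> opc F' -> opc (fun z v => F z (F' z v)).
Proof.
move=> lF Dz0 [C C0 HC] [C' C'0 HC'] cF cF' eps e0.
(* [e2] is capped at 1 so that F' z is bounded by C' + 1 near [z0]. The two halves of [eps] pay for
   (F z - F z0) F' z and for F z0 (F' z - F' z0). *)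
pose e1 := eps / (2 * (C' + 1)); pose e2 := Num.min 1 (eps / (2 * (C + 1))).
have C1 : 0 < C + 1 by rewrite ltr_wpDl.
have C'1 : 0 < C' + 1 by rewrite ltr_wpDl.
have e10 : 0 < e1 by rewrite divr_gt0// mulr_gt0.
have e20 : 0 < e2 by rewrite lt_min ltr01 divr_gt0// mulr_gt0.
move: (cF _ e10) (cF' _ e20); apply: filterS2 => z H1 H2 Dz v.
have {}H1 := H1 Dz; have {}H2 := H2 Dz.
have n0 := normr_ge0 v.
have h2 : `|F' z v - F' z0 v| <= `|v|.
  by apply: le_trans (H2 v) _; rewrite ler_piMl// ge_min lexx.
have h2' : `|F' z v - F' z0 v| <= eps / (2 * (C + 1)) * `|v|.
  by apply: le_trans (H2 v) _; apply: ler_wpM2r => //; rewrite ge_min lexx orbT.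
have h3 : `|F' z v| <= (C' + 1) * `|v|.
  rewrite -(subrK (F' z0 v) (F' z v)); apply: le_trans (ler_normD _ _) _.
  by rewrite mulrDl mul1r addrC; apply: lerD.
have -> : F z (F' z v) - F z0 (F' z0 v) =
    (F z (F' z v) - F z0 (F' z v)) + F z0 (F' z v - F' z0 v).
  by rewrite (vlinearB _ _ (lF _ Dz0)) subrKA.
apply: le_trans (ler_normD _ _) _.
have -> : eps * `|v| = e1 * ((C' + 1) * `|v|) + (eps / (2 * (C + 1))) * (C + 1) * `|v|.
  by rewrite /e1; field; rewrite !gt_eqF.
apply: lerD; first by apply: le_trans (H1 _) _; apply: ler_wpM2l => //; exact: ltW.
apply: le_trans (HC _) _.
apply: (@le_trans _ _ (C * (eps / (2 * (C + 1)) * `|v|))); first exact: ler_wpM2l.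
rewrite mulrA; apply: ler_wpM2r => //; rewrite mulrC; apply: ler_wpM2l; last by rewrite lerDl.
by rewrite divr_ge0 ?ltW// mulr_gt0.
Qed.

End At.

Lemma opcontP (Z : topologicalType) (D : set Z) (F : Z -> V -> V) :
  (forall z, D z -> vlinear (F z)) ->
  opcont D F <-> forall z0, D z0 -> opc D z0 F.
Proof.
move=> lF; split=> H z0 Dz0 eps e0; have := H z0 Dz0 _ e0; apply: filterS => z Hz Dz.
  by apply/(opnormV_le (ltW e0)); [apply: vlinear_sub; exact: lF|exact: Hz].
by apply/(opnormV_le (ltW e0)); [apply: vlinear_sub; exact: lF|exact: Hz].
Qed.

Lemma opc_precomp (Y Z : topologicalType) (D : set Y) (D' : set Z) (f : Y -> Z) y0
    (F : Z -> V -> V) : catw D f y0 -> (forall y, D y -> D' (f y)) ->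
  opc D' (f y0) F -> opc D y0 (fun y => F (f y)).
Proof.
move=> /catwP cf DD' H eps e0; have := cf _ (H _ e0); apply: filterS => y Hy Dy.
by apply: Hy => //; exact: DD'.
Qed.

Lemma opcont_precomp (Y Z : topologicalType) (D : set Y) (D' : set Z) (f : Y -> Z)
    (F : Z -> V -> V) : continuous f -> (forall y, D y -> D' (f y)) ->
  opcont D' F -> opcont D (fun y => F (f y)).
Proof.
move=> cf DD' H y0 /DD' Dy eps e0.
have /catwP := continuous_catw setT (cf y0).
move=> /(_ _ (H _ Dy _ e0)); apply: filterS => y Hy /DD' Dfy; exact: Hy.
Qed.

Lemma opc_near (Z : topologicalType) (D D' : set Z) z0 (F : Z -> V -> V) :
  (\forall z \near z0, D z -> D' z) -> opc D' z0 F -> opc D z0 F.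
Proof.
move=> N H eps e0; move: N (H _ e0); apply: filterS2 => z Nz Hz Dz.
by apply: Hz; exact: Nz.
Qed.

End OperatorContinuity.

(** * Local trivializations and their pullbacks *)

Section Trivializations.
Variables (R : realType) (X A E : topologicalType)
  (bA : banach_alg_bundle R X A) (bE : banach_module_bundle bA E)
  (V : completeNormedModType R).
Local Notation p := (bproj bE).
Local Notation pA := (bproj bA).

Section OneTrivialization.
Variables (Y : topologicalType) (f : Y -> X) (tau : triv Y V E) (ht : is_triv bE f tau).

Lemma triv_open : open (tdom tau). Proof. by case: ht. Qed.

Lemma near_tdom (Z : topologicalType) (k : Z -> Y) z : {for z, continuous k} ->
  tdom tau (k z) -> \forall z' \near z, tdom tau (k z').
Proof.
move=> ck tz; have : nbhs (k z) (tdom tau) by apply: open_nbhs_nbhs; split => //; exact: triv_open.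
by move/ck.
Qed.

Lemma tphi_proj y v : tdom tau y -> p (tphi tau y v) = f y.
Proof. by case: ht => _ [H _]; exact: H. Qed.

Lemma tphi_linear y k v w : tdom tau y ->
  tphi tau y (k *: v + w) = badd bE (bscale bE k (tphi tau y v)) (tphi tau y w).
Proof. by case: ht => _ [_ [H _]]; exact: H. Qed.

Lemma tphiK y v : tdom tau y -> tpsi tau y (tphi tau y v) = v.
Proof. by case: ht => _ [_ [_ [H _]]]; exact: H. Qed.

Lemma tpsiK y e : tdom tau y -> p e = f y -> tphi tau y (tpsi tau y e) = e.
Proof. by case: ht => _ [_ [_ [_ [H _]]]]; exact: H. Qed.

Lemma tphi_catw y v : tdom tau y ->
  catw [set q : Y * V | tdom tau q.1] (fun q => tphi tau q.1 q.2) (y, v).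
Proof. by case: ht => _ [_ [_ [_ [_ [/within_catw H _]]]]]; exact: (H (y, v)). Qed.

Lemma tpsi_catw y e : tdom tau y -> p e = f y ->
  catw [set q : Y * E | tdom tau q.1 /\ p q.2 = f q.1] (fun q => tpsi tau q.1 q.2) (y, e).
Proof.
by case: ht => _ [_ [_ [_ [_ [_ [/within_catw H _]]]]]] dy pe; exact: (H (y, e) (conj dy pe)).
Qed.

Lemma tphiD y v w : tdom tau y -> tphi tau y (v + w) = badd bE (tphi tau y v) (tphi tau y w).
Proof. by move=> dy; rewrite -{1}[v]scale1r tphi_linear// bscale1. Qed.

Lemma tphi0 y : tdom tau y -> tphi tau y 0 = bzero bE (f y).
Proof.
move=> dy; have pf := tphi_proj 0 dy.
have := tphiD 0 0 dy; rewrite addr0; have [u ->] := liftE pf.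
rewrite fvalD => /fval_inj h; rewrite fval0; congr fval.
by apply: (addrI u); rewrite addr0 -h.
Qed.

Lemma tphiZ y k v : tdom tau y -> tphi tau y (k *: v) = bscale bE k (tphi tau y v).
Proof.
move=> dy; rewrite -{1}[k *: v]addr0 tphi_linear// tphi0//.
have [u ->] := liftE (tphi_proj v dy); by rewrite fval0 fvalZ fvalD addr0.
Qed.

Lemma tphiB y v w : tdom tau y -> tphi tau y (v - w) = bsub bE (tphi tau y v) (tphi tau y w).
Proof. by move=> dy; rewrite tphiD// -scaleN1r tphiZ. Qed.

Lemma tpsi_linear y k e e' : tdom tau y -> p e = f y -> p e' = f y ->
  tpsi tau y (badd bE (bscale bE k e) e') = k *: tpsi tau y e + tpsi tau y e'.
Proof. by move=> dy pe pe'; rewrite -{1}(tpsiK dy pe) -{1}(tpsiK dy pe') -tphi_linear// tphiK. Qed.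

Lemma tpsiB y e e' : tdom tau y -> p e = f y -> p e' = f y ->
  tpsi tau y (bsub bE e e') = tpsi tau y e - tpsi tau y e'.
Proof. by move=> dy pe pe'; rewrite -{1}(tpsiK dy pe) -{1}(tpsiK dy pe') -tphiB// tphiK. Qed.

Hypothesis hn : norm_preserving bE tau.

Lemma tpsi_norm y e : tdom tau y -> p e = f y -> `|tpsi tau y e| = bnorm bE e.
Proof. by move=> dy pe; rewrite -(hn _ dy) tpsiK. Qed.

Lemma tpsi_dist y e e' : tdom tau y -> p e = f y -> p e' = f y ->
  `|tpsi tau y e - tpsi tau y e'| = bdist bE e e'.
Proof. by move=> dy pe pe'; rewrite -tpsiB// tpsi_norm// bproj_sub pe. Qed.

End OneTrivialization.

Lemma expression_linear (Y Y' : topologicalType) (f : Y -> X) (f' : Y' -> X)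
    (tau : triv Y V E) (tau' : triv Y' V E) y y' F :
  is_triv bE f tau -> is_triv bE f' tau' -> tdom tau y -> tdom tau' y' ->
  fiber_linear bE (f y) (f' y') F ->
  vlinear (fun v => tpsi tau' y' (F (tphi tau y v))).
Proof.
move=> h h' dy dy' [Fp FD FZ] k u v.
have pu := tphi_proj h u dy; have pv := tphi_proj h v dy.
by rewrite (tphi_linear h)// FD ?bproj_scale// FZ// (tpsi_linear h')// Fp.
Qed.

Lemma is_triv_pullback (Y Z : topologicalType) (f : Y -> X) (k : Z -> Y) (tau : triv Y V E) (W : set Z) :
  is_triv bE f tau -> continuous k -> open W -> W `<=` k @^-1` tdom tau ->
  is_triv bE (fun z => f (k z)) (Triv W (fun z v => tphi tau (k z) v) (fun z e => tpsi tau (k z) e)).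
Proof.
move=> h ck oW WD; split => //=; split; first by move=> z v /WD; exact: (tphi_proj h).
split; first by move=> z r v w /WD; exact: (tphi_linear h).
split; first by move=> z v /WD; exact: (tphiK h).
split; first by move=> z e /WD; exact: (tpsiK h).
have ckw (D : set (Z * V)) q : catw D (fun q => (k q.1, q.2)) q.
  apply: catw_pair; apply: continuous_catw; last exact: cvg_snd.
  by apply: continuous_comp; [exact: cvg_fst|exact: ck].
have ckE (D : set (Z * E)) q : catw D (fun q => (k q.1, q.2)) q.
  apply: catw_pair; apply: continuous_catw; last exact: cvg_snd.
  by apply: continuous_comp; [exact: cvg_fst|exact: ck].
split.
  apply/within_catw => -[z v] /= Wz.
  apply: (catw_comp (D' := [set q : Y * V | tdom tau q.1]) (f := fun q : Z * V => (k q.1, q.2))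
    (g := fun q => tphi tau q.1 q.2)) => //; first by move=> q /= /WD.
  exact: (tphi_catw h (WD _ Wz)).
split.
  apply/within_catw => -[z e] /= [Wz pe].
  apply: (catw_comp (D' := [set q : Y * E | tdom tau q.1 /\ p q.2 = f q.1])
    (f := fun q : Z * E => (k q.1, q.2)) (g := fun q => tpsi tau q.1 q.2)) => //.
    by move=> q /= [/WD ? ?].
  exact: (tpsi_catw h (WD _ Wz)).
have [_ [_ [_ [_ [_ [_ [_ ca]]]]]]] := h.
move=> [z a] /= [Wz pa] eps e0.
have := ca (k z, a) (conj (WD _ Wz) pa) _ e0.
have : catw setT (fun q : Z * A => (k q.1, q.2)) (z, a).
  apply: catw_pair; apply: continuous_catw; last exact: cvg_snd.
  by apply: continuous_comp; [exact: cvg_fst|exact: ck].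
move=> /catwP H /H; apply: filterS => q /(_ I) /= Hq [Wq pq]; apply: Hq.
by split => //; exact: WD.
Qed.

(** Pullbacks are also cut down to smaller open sets, because [unif_cont] compares a trivialization
    of the source pullback with one of the target pullback on the same domain. *)
Definition restricted_pullback (Y : topologicalType) (f : Y -> X) (al : set (triv X V E)) :
    set (triv Y V E) :=
  [set tau | exists t W, [/\ al t, open W, W `<=` f @^-1` tdom t &
    tau = Triv W (fun y v => tphi t (f y) v) (fun y e => tpsi t (f y) e)]].

Lemma compatible_pullback (Y : topologicalType) (f : Y -> X) (t1 t2 : triv X V E) (W1 W2 : set Y) :
  continuous f -> compatible t1 t2 -> W1 `<=` f @^-1` tdom t1 -> W2 `<=` f @^-1` tdom t2 ->
  compatible (Triv W1 (fun y v => tphi t1 (f y) v) (fun y e => tpsi t1 (f y) e) : triv Y V E)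
    (Triv W2 (fun y v => tphi t2 (f y) v) (fun y e => tpsi t2 (f y) e)).
Proof.
move=> cf [c1 c2] h1 h2; split; first by apply: opcont_precomp c1 => // y /= [/h1 ? /h2 ?].
by apply: opcont_precomp c2 => // y /= [/h1 ? /h2 ?].
Qed.

Lemma restricted_pullback_structure (Y : topologicalType) (f : Y -> X) (S : set (set (triv X V E))) al :
  continuous f -> S al -> atlas bE idfun al ->
  pullback_structure bE f S (restricted_pullback f al).
Proof.
move=> cf Sal [ht hc hcomp].
have oP t : al t -> open (f @^-1` tdom t).
  by move=> /ht[ot _]; apply: open_comp => // y _; exact: cf.
have a0 : atlas bE f (restricted_pullback f al).
  split.
  - move=> _ [t [W [at_ oW WD ->]]]; exact: (is_triv_pullback (ht _ at_)).
  - move=> y; have [t [at_ dy]] := hc (f y).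
    exists (Triv (f @^-1` tdom t) (fun y v => tphi t (f y) v) (fun y e => tpsi t (f y) e)).
    by split => //; exists t, (f @^-1` tdom t); split => //; exact: oP.
  - move=> _ _ [t1 [W1 [a1 o1 h1 ->]]] [t2 [W2 [a2 o2 h2 ->]]].
    by apply: compatible_pullback => //; exact: hcomp.
split => //; exists al; split => //; rewrite /equiv_atlas.
(* The unrestricted pullbacks already belong to the restricted ones, so the union is the same
   atlas. *)
have -> // : restricted_pullback f al `|` pullback_triv f @` al = restricted_pullback f al.
apply/seteqP; split => [tau [//|[t at_ <-]]|tau ?]; last by left.
by exists t, (f @^-1` tdom t); split => //; exact: oP.
Qed.

End Trivializations.

(** * Uniform continuity of averages and limits *)

Lemma norm_sub3 (R : realType) (V : normedModType R) (a b c d : V) (s t u : R) :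
  `|a - b| <= s -> `|b - c| <= t -> `|c - d| <= u -> `|a - d| <= s + t + u.
Proof.
move=> h1 h2 h3; apply: le_trans (ler_distD b _ _) _; rewrite -addrA; apply: lerD => //.
by apply: le_trans (ler_distD c _ _) _; exact: lerD.
Qed.

Section UniformContinuity.
Variables (R : realType) (X : topologicalType) (G : ptopologicalType)
  (A E : topologicalType) (Gd : top_groupoid X G)
  (bA : banach_alg_bundle R X A) (bE : banach_module_bundle bA E)
  (V : completeNormedModType R) (al : set (triv X V E)).
Hypotheses (hal : atlas bE idfun al) (hn : forall tau, al tau -> norm_preserving bE tau).
Local Notation src := (src Gd).
Local Notation tgt := (tgt Gd).
Local Notation p := (bproj bE).
Local Notation pA := (bproj bA).
Local Notation "g ** h" := (gmul Gd g h) (at level 40, left associativity).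

Lemma al_triv t : al t -> is_triv bE idfun t. Proof. by case: hal => h _ _; exact: h. Qed.

Lemma al_cover x : exists2 t, al t & tdom t x.
Proof. by case: hal => _ /(_ x)[t [? ?]] _; exists t. Qed.

Definition expression (ta tb : triv X V E) (x y : X) (F : E -> E) (v : V) := tpsi tb y (F (tphi ta x v)).

(** Uniform continuity tested in one norm-preserving atlas of [E] itself; there distances of local
    expressions are fiber distances, by [tpsi_dist]. *)
Definition unif_continuous (T : G -> E -> E) := forall ta tb g0, al ta -> al tb ->
  tdom ta (src g0) -> tdom tb (tgt g0) ->
  opc [set g | tdom ta (src g) /\ tdom tb (tgt g)] g0
    (fun g => expression ta tb (src g) (tgt g) (T g)).

Lemma norm_expression ta tb x y F v : al ta -> al tb -> tdom ta x -> tdom tb y ->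
  p (F (tphi ta x v)) = y ->
  `|expression ta tb x y F v| = bnorm bE (F (tphi ta x v)).
Proof. by move=> a1 a2 d1 d2 pF; rewrite (tpsi_norm (al_triv a2) (hn a2)). Qed.

Lemma expression_bound ta tb x y F (C : R) v : al ta -> al tb -> tdom ta x -> tdom tb y ->
  fiber_linear bE x y F -> (forall e, p e = x -> bnorm bE (F e) <= C * bnorm bE e) ->
  `|expression ta tb x y F v| <= C * `|v|.
Proof.
move=> a1 a2 d1 d2 [pF _ _] H.
have pv : p (tphi ta x v) = x by exact: (tphi_proj (al_triv a1) v d1).
by rewrite norm_expression// ?pF//; apply: le_trans (H _ pv) _; rewrite (hn a1).
Qed.

Lemma vlinear_expression ta tb x y F : al ta -> al tb -> tdom ta x -> tdom tb y ->
  fiber_linear bE x y F -> vlinear (expression ta tb x y F).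
Proof. by move=> a1 a2 d1 d2 lF; exact: (expression_linear (al_triv a1) (al_triv a2)). Qed.

Lemma riemann_triv (I : finType) (phi : I -> G -> R) (w : I -> V) (L : (G -> R) -> R) tb y :
  al tb -> tdom tb y ->
  fval (riemann L phi (fun i => tofiber bE y (tphi tb y (w i)))) = tphi tb y (riemann L phi w).
Proof.
move=> at_ dy; have ht := al_triv at_.
pose f v := tofiber bE y (tphi tb y v).
have fE v : fval (f v) = tphi tb y v by rewrite tofiberK// (tphi_proj ht).
rewrite -fE; congr fval; rewrite /riemann.
have fD u v : f (u + v) = f u + f v.
  by apply: fval_inj; rewrite -fvalD !fE (tphiD ht).
have f0 : f 0 = 0 by apply: fval_inj; rewrite fE (tphi0 ht)// fval0.
rewrite (big_morph f fD f0); apply: eq_bigr => i _.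
by rewrite -/(f _); apply: fval_inj; rewrite -fvalZ !fE (tphiZ ht).
Qed.

Section Sigma.
Variables (gA : alg_G_bundle Gd bA) (sigma : G -> G -> A) (Hsigma : multiplier gA sigma).

(** The last clause of [is_triv], norm continuity of the action of A, composed with the continuous
    map sigma. *)
Lemma opc_sigma tb g0 h0 : al tb -> src g0 = tgt h0 -> tdom tb (tgt g0) ->
  opc [set q : G * G | src q.1 = tgt q.2 /\ tdom tb (tgt q.1)] (g0, h0)
    (fun q => expression tb tb (tgt q.1) (tgt q.1) (act bE (sigma q.1 q.2))).
Proof.
move=> at_ gh dg; have ht := al_triv at_.
have [_ [_ [_ [_ [_ [_ [_ ca]]]]]]] := ht.
have {}ca := (opcontP _).1 ca.
apply: (opc_precomp (D' := [set q : X * A | tdom tb q.1 /\ pA q.2 = idfun q.1])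
  (f := fun q : G * G => (tgt q.1, sigma q.1 q.2))
  (F := fun q => expression tb tb q.1 q.1 (act bE q.2))).
- apply: catw_pair; first apply: continuous_catw.
    by apply: continuous_comp; [exact: cvg_fst|exact: tgt_cont].
  apply: (catw_sigma Hsigma (f := fst) (k := snd)) => //.
  + by move=> q [].
  + by apply: continuous_catw; exact: cvg_fst.
  + by apply: continuous_catw; exact: cvg_snd.
- by move=> [g h] /= [gh' dg']; split => //; rewrite (sigma_proj Hsigma).
apply: ca => /=; last by split => //; rewrite (sigma_proj Hsigma).
move=> [x a] /= [dx pa]; apply: (expression_linear ht ht dx dx).
by rewrite /= -pa; exact: act_linear.
Qed.

Section Operators.
Variables (T : G -> E -> E) (HT : pseudorep Gd bE T).
Hypothesis Tapprox : forall x, exists r, r <= 1 / 4 /\ approx_rep Gd bE sigma x r T.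
Hypothesis cT : unif_continuous T.
Local Notation xi := (xi Gd bE sigma T).
Local Notation tinv := (tinv Gd bE T).

(** With P the expression of T, N that of its inverse and w = N(h0) v, one has N(h) v - w = N(h)
    (P(h0) w - P(h) w). If C bounds the inverse near [h0], tolerance eps / C^2 for P suffices. *)
Lemma opc_tinv ta tb h0 : al ta -> al tb -> tdom ta (tgt h0) -> tdom tb (src h0) ->
  opc [set h | tdom ta (tgt h) /\ tdom tb (src h)] h0
    (fun h => expression ta tb (tgt h) (src h) (tinv h)).
Proof.
move=> a1 a2 d1 d2 eps e0.
have h1 := al_triv a1; have h2 := al_triv a2.
have [C [C0 HC]] := tinv_locally_bounded Hsigma HT Tapprox h0.
have CC0 : 0 < C * C by exact: mulr_gt0.
have HC0 := nbhs_singleton HC.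
move: (cT a2 a1 d2 d1 (divr_gt0 e0 CC0)) HC; apply: filterS2 => h Hh HCh [dt ds] v.
set w := expression ta tb (tgt h0) (src h0) (tinv h0) v.
have pv0 : p (tphi ta (tgt h0) v) = tgt h0 by exact: (tphi_proj h1 v d1).
have pv : p (tphi ta (tgt h) v) = tgt h by exact: (tphi_proj h1 v dt).
have pw : p (tphi tb (src h) w) = src h by exact: (tphi_proj h2 w ds).
have lN := tinv_linear Hsigma HT Tapprox.
have wC : `|w| <= C * `|v| by exact: (expression_bound v a1 a2 d1 d2 (lN h0) HC0).
have Pw : expression tb ta (src h0) (tgt h0) (T h0) w = v.
  rewrite /w /expression (tpsiK h2)//; last by rewrite (tinv_proj Hsigma HT Tapprox).
  by rewrite (tinvK Hsigma HT Tapprox)// (tphiK h1).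
have pTw : p (T h (tphi tb (src h) w)) = tgt h by rewrite (pseudorep_proj HT).
have wE : tphi tb (src h) w = tinv h (T h (tphi tb (src h) w)).
  by rewrite (tinv_uniq Hsigma HT Tapprox pw erefl).
have -> : expression ta tb (tgt h) (src h) (tinv h) v - w =
    tpsi tb (src h) (tinv h (tphi ta (tgt h) v)) - tpsi tb (src h) (tphi tb (src h) w).
  by rewrite (tphiK h2).
have pN := tinv_proj Hsigma HT Tapprox pv.
rewrite (tpsi_dist h2 (hn a2))// wE.
rewrite (fiber_linear_dist (lN h))//.
apply: le_trans (HCh _ _) _; first by rewrite bproj_sub pv.
rewrite -/(bdist bE _ _) -(tpsi_dist h1 (hn a1) dt)// (tphiK h1)//.
have := Hh (conj ds dt) w; rewrite Pw distrC => H.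
apply: (@le_trans _ _ (C * (eps / (C * C) * (C * `|v|)))); last first.
  by rewrite le_eqVlt; apply/orP; left; apply/eqP; field; rewrite gt_eqF.
apply: ler_wpM2l; first exact: ltW.
apply: le_trans H _; apply: ler_wpM2l => //.
by rewrite divr_ge0// ltW.
Qed.

Lemma xi_locally_bounded g h : src g = tgt h -> exists2 C : R, 0 <= C &
  forall e, p e = src g -> bnorm bE (xi g e h) <= C * bnorm bE e.
Proof.
move=> gh; have [C1 [C10 /nbhs_singleton H1]] := pseudorep_locally_bounded HT (g ** h).
have [C2 [C20 /nbhs_singleton H2]] := tinv_locally_bounded Hsigma HT Tapprox h.
exists (bnorm bA (sigma g h) * (C1 * C2)).
  by rewrite !mulr_ge0 ?bnorm_ge0// ltW.
move=> e pe; have pt : p (tinv h e) = src h by rewrite (tinv_proj Hsigma HT Tapprox)// pe.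
have pT : p (T (g ** h) (tinv h e)) = tgt g.
  by rewrite (pseudorep_proj HT) ?tgt_gmul// src_gmul.
apply: le_trans (act_norm _) _; first by rewrite (sigma_proj Hsigma).
rewrite -!mulrA; apply: ler_wpM2l; first exact: bnorm_ge0.
apply: le_trans (H1 _ _) _; first by rewrite src_gmul.
by apply: ler_wpM2l => //; apply: H2; rewrite pe.
Qed.

(** The three factors of [xi] are expressed through an auxiliary trivialization [td] around the
    source of [h0], where T(h)^-1 lands and T(gh) starts. The product of norm continuous operator
    families is norm continuous. *)
Lemma opc_xi ta tb g0 h0 : al ta -> al tb -> src g0 = tgt h0 ->
  tdom ta (src g0) -> tdom tb (tgt g0) ->
  opc [set q : G * G | src q.1 = tgt q.2 /\ (tdom ta (src q.1) /\ tdom tb (tgt q.1))] (g0, h0)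
    (fun q => expression ta tb (src q.1) (tgt q.1) (fun e => xi q.1 e q.2)).
Proof.
move=> a1 a2 gh d1 d2; have [td a3 d3] := al_cover (src h0).
pose D := [set q : G * G | src q.1 = tgt q.2 /\
  [/\ tdom ta (src q.1), tdom tb (tgt q.1) & tdom td (src q.2)]].
apply: (opc_near (D' := D)).
  have : \forall q \near (g0, h0), tdom td (src (q : G * G).2).
    apply: (near_tdom (al_triv a3) (k := fun q : G * G => src q.2)) => //.
    by apply: continuous_comp; [exact: cvg_snd|exact: src_cont].
  by apply: filterS => q dq [? [? ?]].
have Dz : D (g0, h0) by [].
have lN := tinv_linear Hsigma HT Tapprox.
have Np q v : D q -> p (tinv q.2 (tphi ta (src q.1) v)) = src q.2.
  move=> [qq [dq _ _]]; rewrite (tinv_proj Hsigma HT Tapprox)//.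
  by rewrite (tphi_proj (al_triv a1) v dq).
have Tp q e : D q -> p e = src q.2 -> p (T (q.1 ** q.2) e) = tgt q.1.
  by move=> [qq _] pe; rewrite (pseudorep_proj HT) ?tgt_gmul// src_gmul.
have lT q : D q -> fiber_linear bE (src q.2) (tgt q.1) (T (q.1 ** q.2)).
  by move=> [qq _]; have := pseudorep_linear HT (q.1 ** q.2); rewrite src_gmul// tgt_gmul.
have ls q : D q -> fiber_linear bE (tgt q.1) (tgt q.1) (act bE (sigma q.1 q.2)).
  by move=> [qq _]; have := act_linear bE (sigma q.1 q.2); rewrite (sigma_proj Hsigma).
have lN' q : D q -> fiber_linear bE (src q.1) (src q.2) (tinv q.2).
  by move=> [-> _].
pose S q := expression tb tb (tgt q.1) (tgt q.1) (act bE (sigma q.1 q.2)).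
pose P q := expression td tb (src q.2) (tgt q.1) (T (q.1 ** q.2)).
pose N q := expression ta td (src q.1) (src q.2) (tinv q.2).
have cS : opc D (g0, h0) S.
  apply: opc_near (opc_sigma a2 gh d2); apply: filterE => q [? []] //.
have cP : opc D (g0, h0) P.
  have dg : tdom td (src (g0 ** h0)) by rewrite src_gmul.
  have dt : tdom tb (tgt (g0 ** h0)) by rewrite tgt_gmul.
  apply: (eq_opc
    (F := fun q => expression td tb (src (q.1 ** q.2)) (tgt (q.1 ** q.2)) (T (q.1 ** q.2)))) => //.
    by move=> q v [qq _]; rewrite /P src_gmul// tgt_gmul.
  apply: (opc_precomp (D' := [set g | tdom td (src g) /\ tdom tb (tgt g)])
    (f := fun q : G * G => q.1 ** q.2)
    (F := fun g => expression td tb (src g) (tgt g) (T g))).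
  - apply: (catw_gmul (f := fst) (k := snd)) => //.
    + by move=> q [].
    + by apply: continuous_catw; exact: cvg_fst.
    + by apply: continuous_catw; exact: cvg_snd.
  - by move=> q [qq [_ ? ?]]; rewrite /= src_gmul// tgt_gmul.
  - exact: cT.
have cN : opc D (g0, h0) N.
  have dt : tdom ta (tgt h0) by rewrite -gh.
  apply: (eq_opc (F := fun q => expression ta td (tgt q.2) (src q.2) (tinv q.2))) => //.
    by move=> q v [qq _]; rewrite /N qq.
  apply: (opc_precomp (D' := [set h | tdom ta (tgt h) /\ tdom td (src h)])
    (f := fun q : G * G => q.2)
    (F := fun h => expression ta td (tgt h) (src h) (tinv h))).
  - by apply: continuous_catw; exact: cvg_snd.
  - by move=> q [qq [? _ ?]]; rewrite /= -qq.
  - exact: opc_tinv.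
have bN : exists2 C : R, 0 <= C & forall v, `|N (g0, h0) v| <= C * `|v|.
  have [C [C0 /nbhs_singleton HC]] := tinv_locally_bounded Hsigma HT Tapprox h0.
  exists C; first exact: ltW.
  move=> v; apply: (expression_bound v a1 a3 d1 d3); first exact: (lN' _ Dz).
  by rewrite /= gh.
have bP : exists2 C : R, 0 <= C & forall v, `|P (g0, h0) v| <= C * `|v|.
  have [C [C0 /nbhs_singleton HC]] := pseudorep_locally_bounded HT (g0 ** h0).
  exists C => // v; apply: (expression_bound v a3 a2 d3 d2); first exact: (lT _ Dz).
  by move=> e pe; apply: HC; rewrite src_gmul.
have bS : exists2 C : R, 0 <= C & forall v, `|S (g0, h0) v| <= C * `|v|.
  exists (bnorm bA (sigma g0 h0)); first exact: bnorm_ge0.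
  move=> v; apply: (expression_bound v a2 a2 d2 d2); first exact: (ls _ Dz).
  by move=> e pe; apply: act_norm; rewrite (sigma_proj Hsigma).
have bPN : exists2 C : R, 0 <= C & forall v, `|P (g0, h0) (N (g0, h0) v)| <= C * `|v|.
  have [C1 C10 H1] := bP; have [C2 C20 H2] := bN.
  exists (C1 * C2); first exact: mulr_ge0.
  move=> v; apply: le_trans (H1 _) _; rewrite -mulrA; exact: ler_wpM2l.
have vP q : D q -> vlinear (P q).
  by move=> Dq; have [_ [? ? ?]] := Dq; apply: vlinear_expression => //; exact: lT.
have vS q : D q -> vlinear (S q).
  by move=> Dq; have [_ [? ? ?]] := Dq; apply: vlinear_expression => //; exact: ls.
have := opc_comp vS Dz bS bPN cS (opc_comp vP Dz bP bN cP cN).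
apply: eq_opc => // q v Dq; have [qq [? ? ?]] := Dq.
rewrite /S /P /N /expression (tpsiK (al_triv a3))//; last exact: Np.
by rewrite (tpsiK (al_triv a2))//; apply: Tp => //; exact: Np.
Qed.

Section Average.
Variables (hG : hausdorff_space G) (lcG : locally_compact [set: G]) (mu : haar_system R Gd)
  (c : X -> R) (cutc : cutoff Gd c).

(** The operators [m (hs i)] are frozen at [g0]. By [opc_xi] their Riemann sums approximate the
    local expression of the average in operator norm at [g0] and at all nearby g, with the same
    operators; only the scalar weights change, and they do so continuously. *)
Lemma unif_continuous_average : unif_continuous (average mu c bE sigma T).
Proof.
move=> ta tb g0 a1 a2 d1 d2 eps e0.
pose D := [set g | tdom ta (src g) /\ tdom tb (tgt g)].
have h1 := al_triv a1; have h2 := al_triv a2.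
have Dg0 : D g0 by [].
pose e1 := eps / 3; have e10 : 0 < e1 by rewrite divr_gt0.
pose m h v := expression ta tb (src g0) (tgt g0) (fun e => xi g0 e h) v.
pose Q h0 g h := forall v,
  `|expression ta tb (src g) (tgt g) (fun e => xi g e h) v - m h0 v| <= e1 * `|v|.
have [|I [hs [phi [ths cphi H]]]] := partition_near hG lcG mu cutc (Q := Q) Dg0
    (continuous_catw (D : set G) (@src_cont _ _ Gd g0)).
  move=> h0 th0; have := opc_xi a1 a2 (esym th0) d1 d2 e10.
  by apply: filterS => -[g h] /= Hq Dg th; apply: Hq.
have HC i : exists C : R, 0 <= C /\ forall v, `|m (hs i) v| <= C * `|v|.
  have [C C0 HC] := xi_locally_bounded (esym (ths i)).
  exists C; split => // v; apply: (expression_bound v a1 a2 d1 d2) => //.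
  exact: (xi_linear Hsigma HT Tapprox).
have [C {}HC] := boolp.choice HC.
(* A positive bound for the number of summands; a change of the i-th weight by at most e1 / (n (C i
   + 1)) makes the total change at most e1 in operator norm. *)
pose n : R := #|I|.+1%:R.
have n0 : 0 < n by rewrite ltr0n.
have nearphi : \forall g \near g0, forall i, D g ->
    `|avg mu c (src g) (phi i) - avg mu c (src g0) (phi i)| <= e1 / (n * (C i + 1)).
  apply: filter_forall => i; have /catwP ci := cphi i.
  have d0 : 0 < e1 / (n * (C i + 1)).
    by rewrite divr_gt0// mulr_gt0// ltr_wpDl//; exact: (HC i).1.
  have := ci _ (nbhsx_ballx _ _ d0); apply: filterS => g Hg Dg.
  by apply: ltW; rewrite distrC; exact: Hg.
have approx g v : D g -> partition (@borel_bounded R G) (carrier Gd c (src g)) phi /\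
      (forall i h, carrier Gd c (src g) h -> phi i h != 0 -> Q (hs i) g h) ->
    `|expression ta tb (src g) (tgt g) (average mu c bE sigma T g) v -
      riemann (avg mu c (src g)) phi (fun i => m (hs i) v)| <= e1 * `|v|.
  move=> [dg1 dg2] [Pphi HQ].
  have pv : p (tphi ta (src g) v) = src g by exact: (tphi_proj h1 v dg1).
  have := bint_riemann hG mu cutc (eps := e1 * `|v|)
    (v := fun i => tofiber bE (tgt g) (tphi tb (tgt g) (m (hs i) v)))
    (xi_integrable hG lcG mu cutc Hsigma HT Tapprox pv) Pphi.
  rewrite riemann_triv// -(tpsi_dist h2 (hn a2) dg2) ?bproj_bint// ?(tphi_proj h2)// (tphiK h2)//.
  apply=> i h sh ph; have px : p (xi g (tphi ta (src g) v) h) = tgt g.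
    by apply: (xi_proj Hsigma HT Tapprox) => //; exact: sh.1.
  rewrite tofiberK ?(tphi_proj h2)// -(tpsi_dist h2 (hn a2) dg2)// ?(tphi_proj h2)// (tphiK h2)//.
  exact: (HQ i h sh ph v).
have H0 := nbhs_singleton H Dg0.
move: H nearphi; apply: filterS2 => g /[swap] Hphi H Dg v.
have := approx g v Dg (H Dg); have := approx g0 v Dg0 H0.
set a := expression _ _ _ _ _ _; set b := riemann _ _ _.
set a' := expression _ _ _ _ _ _; set b' := riemann _ _ _ => Ha Ha'.
have Hb : `|b' - b| <= e1 * `|v|.
  rewrite /b /b' /riemann -sumrB; apply: le_trans (ler_norm_sum _ _ _) _.
  apply: (@le_trans _ _ (\sum_(i : I) e1 / n * `|v|)).
    apply: ler_sum => i _; rewrite -scalerBl normrZ.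
    have [C0 HCi] := HC i; have C1 : 0 < C i + 1 by rewrite ltr_wpDl.
    apply: (@le_trans _ _ (e1 / (n * (C i + 1)) * ((C i + 1) * `|v|))).
      apply: ler_pM => //; first exact: Hphi.
      by apply: le_trans (HCi v) _; apply: ler_wpM2r => //; rewrite lerDl.
    rewrite le_eqVlt; apply/orP; left; apply/eqP; field; by rewrite !gt_eqF.
  rewrite sumr_const -[X in X <= _]mulr_natr mulrAC; apply: ler_wpM2r => //.
  by rewrite mulrAC ler_pdivrMr// ler_pM2l// ler_nat.
rewrite distrC in Ha; apply: le_trans (norm_sub3 Ha' Hb Ha) _.
by rewrite -!mulrDl /e1; apply: ler_wpM2r => //; lra.
Qed.

End Average.
End Operators.
End Sigma.

Lemma unif_continuous_limit (T : nat -> G -> E -> E) (L : G -> E -> E) (q : R) :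
  0 <= q < 1 -> (forall n, unif_continuous (T n)) ->
  (forall n g e, p e = src g -> p (T n g e) = tgt g) ->
  (forall g e, p e = src g -> p (L g e) = tgt g) ->
  (forall n g e, p e = src g -> bdist bE (T n g e) (L g e) <= q ^+ n * bnorm bE e) ->
  unif_continuous L.
Proof.
move=> q01 cT pT pL dTL ta tb g0 a1 a2 d1 d2 eps e0.
have e30 : 0 < eps / 3 by rewrite divr_gt0.
have [n Hn] := cvg_geometric0 q01 ler01 e30.
have {Hn}qn : q ^+ n <= eps / 3 by have := Hn n (leqnn n); rewrite mul1r => /ltW.
have close g v : tdom ta (src g) -> tdom tb (tgt g) ->
    `|expression ta tb (src g) (tgt g) (T n g) v - expression ta tb (src g) (tgt g) (L g) v|
      <= eps / 3 * `|v|.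
  move=> dg1 dg2; have pv : p (tphi ta (src g) v) = src g by exact: (tphi_proj (al_triv a1) v dg1).
  rewrite (tpsi_dist (al_triv a2) (hn a2)) ?pT ?pL//.
  by apply: le_trans (dTL _ _ _ pv) _; rewrite (hn a1)//; exact: ler_wpM2r.
have := cT n _ _ _ a1 a2 d1 d2 _ e30; apply: filterS => g Hg Dg v.
have [dg1 dg2] := Dg; have := close g v dg1 dg2; have := close g0 v d1 d2; have := Hg Dg v.
set a := expression _ _ _ _ _ _; set a0 := expression _ _ _ _ _ _.
set b0 := expression _ _ _ _ _ _; set b := expression _ _ _ _ _ _ => H1 H2 H3.
rewrite distrC in H3; apply: le_trans (norm_sub3 H3 H1 H2) _.
by rewrite -!mulrDl; apply: ler_wpM2r => //; lra.
Qed.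

End UniformContinuity.

(** * Passage between atlases *)

Section Structures.
Variables (R : realType) (X : topologicalType) (G : ptopologicalType)
  (A E : topologicalType) (Gd : top_groupoid X G)
  (bA : banach_alg_bundle R X A) (bE : banach_module_bundle bA E)
  (V : completeNormedModType R) (S : set (set (triv X V E))) (al : set (triv X V E)).
Hypotheses (HS : gl_structure bE idfun S) (Sal : S al).
Hypothesis hn : forall tau, al tau -> norm_preserving bE tau.
Local Notation src := (src Gd).
Local Notation tgt := (tgt Gd).
Local Notation p := (bproj bE).

Lemma structure_atlas : atlas bE idfun al.
Proof. by case: HS => _ h _ _; exact: h. Qed.

(** Members of the structure outside [al] need not preserve norms; boundedness of the change of
    coordinates comes from continuity of a linear map at 0. *)
Lemma transition_bounded (Y Y' : topologicalType) (f : Y -> X) (f' : Y' -> X)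
    (tau : triv Y V E) (tau' : triv Y' V E) y y' :
  is_triv bE f tau -> is_triv bE f' tau' -> tdom tau y -> tdom tau' y' -> f y = f' y' ->
  exists2 C : R, 0 <= C & forall v, `|tpsi tau' y' (tphi tau y v)| <= C * `|v|.
Proof.
move=> h h' d d' ff'; apply: continuous_vlinear_bounded.
  have := expression_linear h h' d d' (F := id); apply.
  by rewrite -ff'; exact: fiber_linear_id.
have pv v : p (tphi tau y v) = f' y' by rewrite (tphi_proj h).
have c1 : catw setT (fun v => tphi tau y v) (0 : V).
  apply: (catw_comp (D' := [set q : Y * V | tdom tau q.1]) (f := fun v : V => (y, v))
    (g := fun q => tphi tau q.1 q.2)) => //; last exact: (tphi_catw h d).
  by apply: catw_pair; apply: continuous_catw; [exact: cst_continuous|exact: cvg_id].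
have : catw setT (fun v => tpsi tau' y' (tphi tau y v)) (0 : V).
  apply: (catw_comp (D' := [set q : Y' * E | tdom tau' q.1 /\ p q.2 = f' q.1])
    (f := fun v : V => (y', tphi tau y v)) (g := fun q => tpsi tau' q.1 q.2)).
    by move=> v _; split; [exact: d'|exact: pv].
    apply: catw_pair; last exact: c1.
    by apply: continuous_catw; exact: cst_continuous.
  exact: (tpsi_catw h' d' (pv 0)).
by move=> /catwP H W /H; apply: filterS => v /(_ I).
Qed.

(** [be] is only known to be compatible with the pullback of some atlas [al1] in [S]. The transition
    to [al] therefore factors through a chart [t1] of [al1], which is compatible with [al] since
    both atlases lie in [S]. *)
Lemma transition (Y : topologicalType) (f : Y -> X) (be : set (triv Y V E)) tau ta y0 :
  continuous f -> pullback_structure bE f S be -> be tau -> al ta ->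
  tdom tau y0 -> tdom ta (f y0) ->
  opc [set y | tdom tau y /\ tdom ta (f y)] y0 (fun y v => tpsi ta (f y) (tphi tau y v)) /\
  opc [set y | tdom tau y /\ tdom ta (f y)] y0 (fun y v => tpsi tau y (tphi ta (f y) v)).
Proof.
move=> cf [abe [al1 [Sal1 [H1 _ H2]]]] btau ata d da.
have [_ Sat Seq _] := HS.
have [h1 hcov _] := Sat _ Sal1.
have [t1 [at1 d1]] := hcov (f y0).
have ht1 : is_triv bE idfun t1 by exact: h1.
have hta : is_triv bE idfun ta by have [h _ _] := structure_atlas; exact: h.
have htau : is_triv bE f tau by have [h _ _] := abe; exact: h.
have [c1 c1'] : compatible tau (pullback_triv f t1).
  by apply: H2; [left|right; exists t1].
have [c2 c2'] : compatible t1 ta.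
  by have [_ _ H] := Seq _ _ Sal1 Sal; apply: H; [left|right].
pose D := [set y | [/\ tdom tau y, tdom t1 (f y) & tdom ta (f y)]].
have Dy : D y0 by [].
have nearD : \forall y \near y0, [set y | tdom tau y /\ tdom ta (f y)] y -> D y.
  by apply: filterS (near_tdom ht1 (cf y0) d1) => y ? [].
have lin (Y1 Y2 : topologicalType) (f1 : Y1 -> X) (f2 : Y2 -> X)
    (s1 : triv Y1 V E) (s2 : triv Y2 V E) y1 y2 :
    is_triv bE f1 s1 -> is_triv bE f2 s2 -> tdom s1 y1 -> tdom s2 y2 -> f1 y1 = f2 y2 ->
    vlinear (fun v => tpsi s2 y2 (tphi s1 y1 v)).
  move=> i1 i2 e1 e2 ff; apply: (expression_linear i1 i2 e1 e2 (F := id)).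
  by rewrite -ff; exact: fiber_linear_id.
pose a y v := tpsi t1 (f y) (tphi tau y v).
pose a' y v := tpsi tau y (tphi t1 (f y) v).
pose b y v := tpsi ta (f y) (tphi t1 (f y) v).
pose b' y v := tpsi t1 (f y) (tphi ta (f y) v).
have opcD (F : Y -> V -> V) : (forall y, D y -> vlinear (F y)) ->
    opcont D F -> opc D y0 F by move=> l /(opcontP l); exact.
have sub (Z : topologicalType) (D1 D2 : set Z) (F : Z -> V -> V) :
    D1 `<=` D2 -> opcont D2 F -> opcont D1 F.
  move=> s H z /s Dz e e0; apply: filterS (H z Dz e e0) => w Hw /s; exact: Hw.
have la y : D y -> vlinear (a y) by move=> [? ? ?]; exact: (lin _ _ _ _ _ _ _ _ htau ht1).
have la' y : D y -> vlinear (a' y) by move=> [? ? ?]; exact: (lin _ _ _ _ _ _ _ _ ht1 htau).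
have lb y : D y -> vlinear (b y) by move=> [? ? ?]; exact: (lin _ _ _ _ _ _ _ _ ht1 hta).
have lb' y : D y -> vlinear (b' y) by move=> [? ? ?]; exact: (lin _ _ _ _ _ _ _ _ hta ht1).
have ca : opc D y0 a by apply: opcD => //; apply: sub c1 => y [].
have ca' : opc D y0 a' by apply: opcD => //; apply: sub c1' => y [].
have cb : opc D y0 b.
  by apply: opcD => //; apply: (opcont_precomp cf _ c2) => y [].
have cb' : opc D y0 b'.
  by apply: opcD => //; apply: (opcont_precomp cf _ c2') => y [].
have ba := transition_bounded htau ht1 d d1 erefl.
have ba' := transition_bounded ht1 htau d1 d erefl.
have bb := transition_bounded ht1 hta d1 da erefl.
have bb' := transition_bounded hta ht1 da d1 erefl.
split; apply: (opc_near nearD).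
- have := opc_comp lb Dy bb ba cb ca; apply: eq_opc => // y v [? ? ?].
  by rewrite /a /b (tpsiK ht1)// (tphi_proj htau).
- have := opc_comp la' Dy ba' bb' ca' cb'; apply: eq_opc => // y v [? ? ?].
  by rewrite /a' /b' (tpsiK ht1)// (tphi_proj hta).
Qed.

Lemma unif_cont_continuous T : pseudorep Gd bE T -> unif_cont bE Gd S T ->
  unif_continuous Gd al T.
Proof.
move=> HT uT ta tb g0 a1 a2 d1 d2.
have [ht _ _] := structure_atlas.
pose W := [set g | tdom ta (src g) /\ tdom tb (tgt g)].
have oW : open W.
  apply: openI; (apply: open_comp; [move=> g _|]).
  - exact: src_cont.
  - exact: (triv_open (ht _ a1)).
  - exact: tgt_cont.
  - exact: (triv_open (ht _ a2)).
pose t1 : triv G V E := Triv W (fun g v => tphi ta (src g) v) (fun g e => tpsi ta (src g) e).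
pose t2 : triv G V E := Triv W (fun g v => tphi tb (tgt g) v) (fun g e => tpsi tb (tgt g) e).
have cs : continuous src by exact: src_cont.
have ct : continuous tgt by exact: tgt_cont.
have H : opcont W (fun g => expression ta tb (src g) (tgt g) (T g)); last first.
  apply: (opcontP _).1 H _ _ => // g [dg1 dg2].
  by apply: (expression_linear (ht _ a1) (ht _ a2) dg1 dg2); exact: pseudorep_linear.
apply: (uT t1 t2) => //.
- exists (restricted_pullback src al); split.
    exact: (restricted_pullback_structure cs Sal structure_atlas).
  by exists ta, W; split => // g [].
- exists (restricted_pullback tgt al); split.
    exact: (restricted_pullback_structure ct Sal structure_atlas).
  by exists tb, W; split => // g [].
Qed.

(** Near each arrow the expression in arbitrary charts is the expression in charts of [al] between
    two transition maps, and products of bounded norm continuous families are norm continuous. *)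
Lemma unif_continuous_cont T : pseudorep Gd bE T ->
  unif_continuous Gd al T -> unif_cont bE Gd S T.
Proof.
move=> HT cT t1 t2 [be1 [Hbe1 b1]] [be2 [Hbe2 b2]] dom.
have [ht hc _] := structure_atlas.
have cs : continuous src by exact: src_cont.
have ct : continuous tgt by exact: tgt_cont.
have h1 : is_triv bE src t1 by have [[h _ _] _] := Hbe1; exact: h.
have h2 : is_triv bE tgt t2 by have [[h _ _] _] := Hbe2; exact: h.
have lT := pseudorep_linear HT.
apply/opcontP => [g dg|g0 dg].
  by apply: (expression_linear h1 h2 dg); [rewrite -dom|exact: lT].
have dg2 : tdom t2 g0 by rewrite -dom.
have [ta [a1 d1]] := hc (src g0); have [tb [a2 d2]] := hc (tgt g0).
pose D := [set g | [/\ tdom t1 g, tdom ta (src g) & tdom tb (tgt g)]].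
have Dg : D g0 by [].
have nearD : \forall g \near g0, tdom t1 g -> D g.
  have n1 := near_tdom (ht _ a1) (cs g0) d1.
  have n2 := near_tdom (ht _ a2) (ct g0) d2.
  by move: n1 n2; apply: filterS2 => g ? ? ?.
apply: (opc_near nearD).
have [c1 _] := transition cs Hbe1 b1 a1 dg d1.
have [_ c2] := transition ct Hbe2 b2 a2 dg2 d2.
have {}c1 : opc D g0 (fun g v => tpsi ta (src g) (tphi t1 g v)).
  by apply: opc_near c1; apply: filterE => g [].
have {}c2 : opc D g0 (fun g v => tpsi t2 g (tphi tb (tgt g) v)).
  by apply: opc_near c2; apply: filterE => g [dg' _ ?]; split => //; rewrite -dom.
have c3 : opc D g0 (fun g => expression ta tb (src g) (tgt g) (T g)).
  by apply: opc_near (cT _ _ _ a1 a2 d1 d2); apply: filterE => g [].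
have l2 g : D g -> vlinear (fun v => tpsi t2 g (tphi tb (tgt g) v)).
  move=> [dg' _ db]; rewrite dom in dg'.
  by apply: (expression_linear (ht _ a2) h2 db dg' (F := id)); exact: fiber_linear_id.
have l3 g : D g -> vlinear (expression ta tb (src g) (tgt g) (T g)).
  by move=> [_ da db]; exact: (vlinear_expression structure_atlas a1 a2 da db).
have b1' := transition_bounded h1 (ht _ a1) dg d1 erefl.
have b2' := transition_bounded (ht _ a2) h2 d2 dg2 erefl.
have [C [C0 /nbhs_singleton HC]] := pseudorep_locally_bounded HT g0.
have b3 v : `|expression ta tb (src g0) (tgt g0) (T g0) v| <= C * `|v|.
  exact: (expression_bound structure_atlas hn v a1 a2 d1 d2 (lT g0) HC).
have b3' : exists2 C : R, 0 <= C & forall v, `|expression ta tb (src g0) (tgt g0) (T g0) v| <= C * `|v|.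
  by exists C.
have b31 : exists2 C : R, 0 <= C & forall v,
   `|expression ta tb (src g0) (tgt g0) (T g0) (tpsi ta (src g0) (tphi t1 g0 v))| <= C * `|v|.
  have [C1 C10 H1] := b1'; exists (C * C1); first exact: mulr_ge0.
  by move=> v; apply: le_trans (b3 _) _; rewrite -mulrA; exact: ler_wpM2l.
have := opc_comp l2 Dg b2' b31 c2 (opc_comp l3 Dg b3' b1' c3 c1).
apply: eq_opc => // g v [dg1 da db].
have pv : p (tphi t1 g v) = src g by exact: (tphi_proj h1 v dg1).
rewrite /expression (tpsiK (ht _ a1))// (tpsiK (ht _ a2))//; exact: (pseudorep_proj HT).
Qed.

End Structures.

(** The same limit [L] serves both claims. For the second, uniform continuity is carried from [S] to
    its norm-preserving atlas, through all iterates and the limit there, and back to [S]. *)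
Theorem mainTheorem5 (R : realType) (X : topologicalType) (G : ptopologicalType)
  (A E : topologicalType) (Gd : top_groupoid X G)
  (hG : hausdorff_space G) (lcG : locally_compact [set: G])
  (mu : haar_system R Gd) (Hproper : proper_groupoid Gd R)
  (bA : banach_alg_bundle R X A) (gA : alg_G_bundle Gd bA)
  (bE : banach_module_bundle bA E)
  (sigma : G -> G -> A) (Hsigma : multiplier gA sigma)
  (T : G -> E -> E) (HT : pseudorep Gd bE T) (HTA : A_linear gA bE T)
  (Halmost : almost_rep Gd bE sigma T) :
  (exists Rr : G -> E -> E, sigma_rep gA bE sigma Rr /\
     forall g : G,
       (bopnorm bE (src Gd g) (fun e => bsub bE (Rr g e) (T g e))
        <= 4%:E * bT Gd bE sigma T (tgt Gd g) * rT Gd bE sigma T (tgt Gd g))%E) /\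
  (forall (V : completeNormedModType R) (S : set (set (triv X V E))),
     gi_structure bE S -> unif_cont bE Gd S T ->
     exists Rr : G -> E -> E, [/\ sigma_rep gA bE sigma Rr,
       forall g : G,
         (bopnorm bE (src Gd g) (fun e => bsub bE (Rr g e) (T g e))
          <= 4%:E * bT Gd bE sigma T (tgt Gd g) * rT Gd bE sigma T (tgt Gd g))%E
     & unif_cont bE Gd S Rr]).
Proof.
have [c cutc] := Hproper.
have [L [HL HLT HLn]] := sigma_rep_exists hG lcG mu cutc Hsigma HT HTA Halmost.
split; first by exists L.
move=> V S [HS [al [Sal hn]]] uT; exists L; split => //.
have aT := almost_rep_almost Hsigma HT HTA Halmost.
have an n := almost_iterate hG lcG mu cutc Hsigma aT n.
have hal := structure_atlas HS Sal.
have pL : pseudorep Gd bE L by case: HL.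
apply: (unif_continuous_cont HS Sal hn pL).
have q01 : 0 <= (2 / 5 : R) < 1 by apply/andP; split; [rewrite divr_ge0|lra].
apply: (unif_continuous_limit hal hn q01 _ _ _ HLn).
- elim=> [|n IH]; first exact: (unif_cont_continuous HS Sal HT uT).
  have [pn _ _] := an n.
  exact: (unif_continuous_average hal hn Hsigma pn (almost_approx (an n)) IH hG lcG mu cutc).
- by move=> n g e pe; have [pn _ _] := an n; exact: (pseudorep_proj pn).
- by move=> g e pe; exact: (pseudorep_proj pL).
Qed.
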